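(* There is an absolute constant $C_2>0$ such that $$\left|\mathbb E\langle\Theta\Theta^{\mathsf T},\mathcal S_{A,4}(X)\rangle-\Delta_d^2\|\Lambda^{-2}\|_{\rm F}^2\right|\le C_2\frac{r^2d_{\max}}{\lambda_r^4},$$ where $\Delta_d=d_1-d_2$. Moreover, if $\lambda_r\ge C_1\sqrt{d_{\max}}$ for some large enough constant $C_1>0$, then $$\left|\mathbb E\,\mathrm{dist}^2[(\hat U,\hat V),(U,V)]-2\left(d_\star\|\Lambda^{-1}\|_{\rm F}^2-\Delta_d^2\|\Lambda^{-2}\|_{\rm F}^2\right)\right|\le C_2\frac{r^2d_{\max}}{\lambda_r^4}+C_3 r\left(\frac{d_{\max}}{\lambda_r^2}\right)^3,$$ where $d_\star=d_1+d_2-2r$ and $C_2,C_3>0$ are absolute constants (depending on $C_1$; the constant $C_2$ here need not equal the one in the first bound).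
   Context: Model: $M=U\Lambda V^{\mathsf T}\in\mathbb R^{d_1\times d_2}$ is a deterministic matrix of rank $r$, with $U=(u_1,\dots,u_r)\in\mathbb R^{d_1\times r}$, $V=(v_1,\dots,v_r)\in\mathbb R^{d_2\times r}$, $U^{\mathsf T}U=V^{\mathsf T}V=I_r$, and $\Lambda=\mathrm{diag}(\lambda_1,\dots,\lambda_r)$, $\lambda_1\ge\cdots\ge\lambda_r>0$. One observes $\hat M=M+Z$ where $Z\in\mathbb R^{d_1\times d_2}$ has i.i.d. $\mathcal N(0,1)$ entries. $\hat U,\hat V$ are the top-$r$ left and right singular vectors of $\hat M$, and $$\mathrm{dist}^2[(\hat U,\hat V),(U,V)]:=\|\hat U\hat U^{\mathsf T}-UU^{\mathsf T}\|_{\rm F}^2+\|\hat V\hat V^{\mathsf T}-VV^{\mathsf T}\|_{\rm F}^2 .$$ $d_{\max}=\max\{d_1,d_2\}$; $\|\cdot\|_{\rm F}$ is the Frobenius norm; $\langle B,C\rangle=\mathrm{tr}(B^{\mathsf T}C)$. Symmetrization: $A=\begin{pmatrix}0 & M \\ M^{\mathsf T} & 0\end{pmatrix}$, $X=\begin{pmatrix}0 & Z \\ Z^{\mathsf T} & 0\end{pmatrix}$. For $1\le i\le r$ put $\lambda_{-i}=-\lambda_i$, $\theta_i=\frac1{\sqrt2}\binom{u_i}{v_i}$, $\theta_{-i}=\frac1{\sqrt2}\binom{u_i}{-v_i}$, and $\Theta=(\theta_1,\dots,\theta_r,\theta_{-r},\dots,\theta_{-1})$, so $\Theta\Theta^{\mathsf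 T}=\mathrm{diag}(UU^{\mathsf T},VV^{\mathsf T})$ (block diagonal). Let $\mathfrak P^0=\mathfrak P^\perp=I-\Theta\Theta^{\mathsf T}$ and $\mathfrak P^{-k}=\sum_{1\le|j|\le r}\lambda_j^{-k}\theta_j\theta_j^{\mathsf T}$ for $k\ge1$. For $k\ge1$, $$\mathcal S_{A,k}(X)=\sum_{s_1+\cdots+s_{k+1}=k}(-1)^{1+\tau(\mathbf s)}\mathfrak P^{-s_1}X\mathfrak P^{-s_2}X\cdots X\mathfrak P^{-s_{k+1}},$$ the sum over tuples $\mathbf s$ of non-negative integers, with $\tau(\mathbf s)$ the number of positive entries of $\mathbf s$. Absolute constants do not depend on $d_1,d_2,r,U,V,\Lambda$. *)

(* Defs.v *)
From HB Require Import structures.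
From mathcomp Require Import all_boot all_order all_algebra.
From mathcomp Require Import all_classical all_reals all_analysis.

Set Implicit Arguments.
Unset Strict Implicit.
Unset Printing Implicit Defensive.

Import Order.TTheory GRing.Theory Num.Theory.
Local Open Scope ring_scope.

Definition mxdot (R : realType) (m n : nat) (B C : 'M[R]_(m, n)) : R :=
  \tr (B^T *m C).

Definition frobenius (R : realType) (m n : nat) (B : 'M[R]_(m, n)) : R :=
  Num.sqrt (\sum_i \sum_j B i j ^+ 2).

Definition last_ord (r : nat) (r_gt0 : (0 < r)%N) : 'I_r :=
  Ordinal (etrans (ltn_predL r) r_gt0).

(* The singular values are stored in a row vector: [lam 0 i], [i : 'I_r], is
   the (i+1)-st one. Together with the value [U *m diag_mx lam *m V^T] of the
   signal, these conditions say that it has rank r and that this is its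
   compact SVD. *)
Definition compact_svd (R : realType) (d1 d2 r : nat)
    (U : 'M[R]_(d1, r)) (lam : 'rV[R]_r) (V : 'M[R]_(d2, r)) : Prop :=
  [/\ U^T *m U = 1%:M,
      V^T *m V = 1%:M,
      (forall i j : 'I_r, (i <= j)%N -> lam 0 j <= lam 0 i)
    & (forall i : 'I_r, 0 < lam 0 i)].

(* [Uh] and [Vh] consist of the first r left and right singular vectors in some
   singular value decomposition of [B] with nonincreasing singular values; they
   need not be unique when singular values coincide. *)
Definition top_singular_vectors (R : realType) (d1 d2 r : nat)
    (B : 'M[R]_(d1, d2)) (Uh : 'M[R]_(d1, r)) (Vh : 'M[R]_(d2, r)) : Prop :=
  exists (P : 'M[R]_(d1, minn d1 d2)) (sigma : 'rV[R]_(minn d1 d2))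
         (Q : 'M[R]_(d2, minn d1 d2)) (hr : (r <= minn d1 d2)%N),
    [/\ [/\ P^T *m P = 1%:M,
            Q^T *m Q = 1%:M,
            (forall i j : 'I_(minn d1 d2),
                (i <= j)%N -> sigma 0 j <= sigma 0 i)
          & (forall i : 'I_(minn d1 d2), 0 <= sigma 0 i)],
        B = P *m diag_mx sigma *m Q^T,
        Uh = colsub (widen_ord hr) P
      & Vh = colsub (widen_ord hr) Q].

Definition dist2 (R : realType) (d1 d2 r : nat)
    (Uh : 'M[R]_(d1, r)) (Vh : 'M[R]_(d2, r))
    (U : 'M[R]_(d1, r)) (V : 'M[R]_(d2, r)) : R :=
  frobenius (Uh *m Uh^T - U *m U^T) ^+ 2
  + frobenius (Vh *m Vh^T - V *m V^T) ^+ 2.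

Definition symmetrize (R : realType) (d1 d2 : nat) (B : 'M[R]_(d1, d2)) :
    'M[R]_(d1 + d2) :=
  block_mx 0 B B^T 0.

(* The signed indices +i and -i, 1 <= i <= r, are encoded as pairs
   [(b, i) : bool * 'I_r], where [b = true] is the negative sign. *)
Definition slam (R : realType) (r : nat) (lam : 'rV[R]_r)
    (b : bool) (i : 'I_r) : R :=
  (-1) ^+ b * lam 0 i.

Definition theta (R : realType) (d1 d2 r : nat)
    (U : 'M[R]_(d1, r)) (V : 'M[R]_(d2, r)) (b : bool) (i : 'I_r) :
    'cV[R]_(d1 + d2) :=
  (Num.sqrt 2)^-1 *: col_mx (col i U) ((-1) ^+ b *: col i V).

(* The columns are theta_1, ..., theta_r, theta_{-r}, ..., theta_{-1}; hence
   the index reversal in the second block. *)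
Definition Theta (R : realType) (d1 d2 r : nat)
    (U : 'M[R]_(d1, r)) (V : 'M[R]_(d2, r)) : 'M[R]_(d1 + d2, r + r) :=
  row_mx (\matrix_(k < d1 + d2, i < r) theta U V false i k 0)
         (\matrix_(k < d1 + d2, i < r) theta U V true (rev_ord i) k 0).

(* [frakP U lam V k] is the matrix with superscript -k, for k >= 0. *)
Definition frakP (R : realType) (d1 d2 r : nat)
    (U : 'M[R]_(d1, r)) (lam : 'rV[R]_r) (V : 'M[R]_(d2, r)) (k : nat) :
    'M[R]_(d1 + d2) :=
  if k is 0%N then 1%:M - Theta U V *m (Theta U V)^T
  else \sum_(b : bool) \sum_(i < r)
         slam lam b i ^- k *: (theta U V b i *m (theta U V b i)^T).

(* A tuple of k+1 natural numbers with sum k has entries at most k, so these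
   tuples are the functions ['I_k.+1 -> 'I_k.+1] with sum k. The tuple is
   indexed from 0, and the first factor of the product is split off. *)
Definition SA (R : realType) (d1 d2 r : nat)
    (U : 'M[R]_(d1, r)) (lam : 'rV[R]_r) (V : 'M[R]_(d2, r)) (k : nat)
    (X : 'M[R]_(d1 + d2)) : 'M[R]_(d1 + d2) :=
  \sum_(s : {ffun 'I_k.+1 -> 'I_k.+1} | (\sum_j s j == k)%N)
    (-1) ^+ (1 + #|[pred j | (0 < s j)%N]|)
    *: (frakP U lam V (s ord0)
        *m \big[mulmx/1%:M]_(j < k) (X *m frakP U lam V (s (lift ord0 j)))).

(* Mutual independence: the product rule over every finite subfamily. *)
Definition mutually_independent (R : realType) (d : measure_display)
    (T : measurableType d) (P : probability T R) (I : finType)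
    (X : I -> {RV P >-> R}) : Prop :=
  forall (J : {set I}) (B : I -> set R), (forall i, measurable (B i)) ->
    P [set w | forall i, i \in J -> B i (X i w)]%classic
    = (\prod_(i in J) P (X i @^-1` B i)%classic)%E.

(* The second parameter of [normal_prob] is the standard deviation. *)
Definition iid_std_normal (R : realType) (d : measure_display)
    (T : measurableType d) (P : probability T R) (d1 d2 : nat)
    (Z : 'I_d1 * 'I_d2 -> {RV P >-> R}) : Prop :=
  mutually_independent Z /\
  (forall ij B, measurable B -> distribution P (Z ij) B = normal_prob 0 1 B).

Definition noise (R : realType) (d : measure_display)
    (T : measurableType d) (P : probability T R) (d1 d2 : nat)
    (Z : 'I_d1 * 'I_d2 -> {RV P >-> R}) (w : T) : 'M[R]_(d1, d2) :=
  \matrix_(i < d1, j < d2) Z (i, j) w.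

(* Main.v *)
Require Import Defs.
From mathcomp Require Import all_boot all_order all_algebra.
From mathcomp Require Import all_classical all_reals all_analysis.
From mathcomp Require Import measurable_realfun.
From mathcomp Require Import ring lra.
Set Implicit Arguments.
Unset Strict Implicit.
Unset Printing Implicit Defensive.
Import Order.TTheory GRing.Theory Num.Theory.
Import numFieldNormedType.Exports.
Local Open Scope classical_set_scope.
Local Open Scope ring_scope.

(**
Notation for this explanation: [A] and [X] are the symmetrized signal and noise,
[Pi = Theta Theta^T], [W = 1 - Pi], [P] is the inverse of [A] on the range of
[Pi], so that [frakP k = P ^ k] for [k > 0], and [Ph] is the block diagonal
matrix with blocks [Uh Uh^T] and [Vh Vh^T], the empirical counterpart of [Pi].

Deterministic expansion. The projection [Ph] commutes with [A + X]. From this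
and from [Ph ^ 2 = Ph], its compressions [E = W Ph Pi], [G = Pi - Pi Ph Pi] and
[H = W Ph W] satisfy three exact equations ([proj_eqE], [proj_eqG],
[proj_eqH]): [E] is [W X P] plus terms that carry one more factor [X], while
[G = E^T E + G G] and [H = E E^T + H H]. They determine [E], [G] and [H] order
by order in [X]. The distance is [2 tr G] ([dist2_trG]), and repeated
substitution gives [G = G2 + G3 + G4 + G5 + R], where [Gk] is homogeneous of
degree [k] in [X] and [R] is of order [(N / lamr) ^ 6] as soon as [N] bounds
the operator norm of the noise ([rest_G5]). The a priori bounds that start the
substitution, [E] of first order and [G], [H] of second order, come from Weyl
inequalities for the singular values. Everything lives on the range of [Pi],
of dimension [2 r], so the trace of [R] costs a factor [r]
([dist2_expansion]).

Means. The odd terms [G3] and [G5] have mean zero. The traces of [G2] and [G4]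
are combinations of traces of words in which [X] alternates with fixed
matrices; by Wick's formula ([has_mean_tr2], [has_mean_tr4]) their means depend
on the law of [X] only through the map [B |-> E (X B X)], which is
[(B^T - J B^T J + tr B - tr (J B) J) / 2] with [J] the diagonal matrix of signs
of the two blocks ([symdelta_covE]). Since [J] commutes with [W] and
anticommutes with [P], the means are explicit: the trace of [G2] has mean
[dstar |Lambda^-1|^2], and the trace of [G4], which is the opposite of
[<Theta Theta^T, S_{A,4}(X)>] ([tr_pG4], [tr_SA4]), has mean
[(dstar - Delta^2) |Lambda^-2|^2] ([fourth_mean]). So in both claims the
quantity of order [r^2 dmax / lamr^4] is a multiple of
[dstar |Lambda^-2|^2] ([bias_le]).

Remainder. What is left is [E N^6 <= C dmax^3] for a random bound [N] on the
operator norm of the noise. It is obtained from the exponential moments of the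
bilinear form of the noise at the points of a finite grid of the unit ball
([norm_boundP], [norm_bound_mean]).
*)

(** * Integration against a density and Gaussian moments *)

Section density.
Context d d' (T : measurableType d) (Y : measurableType d') (R : realType).
Variables (mu : {measure set T -> \bar R}) (nu : {measure set Y -> \bar R}).
Variables (X : T -> Y) (G : T -> R).
Hypotheses (mX : measurable_fun setT X) (mG : measurable_fun setT G).
Hypothesis G0 : forall t, 0 <= G t.
Hypothesis nuE : forall B, measurable B ->
  nu B = (\int[mu]_(t in X @^-1` B) (G t)%:E)%E.

Import HBNNSimple.

(** The hypothesis is the statement for indicators; it passes to nonnegative
    simple functions by linearity and to [f] by monotone convergence. It is
    used with [X] the identity, for integrals against the Gaussian density,
    and with [G] a product of other independent factors and of an indicator,
    to split off one variable. *)
Lemma ge0_integral_density (f : Y -> R) : measurable_fun setT f ->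
  (forall y, 0 <= f y) ->
  (\int[nu]_y (f y)%:E = \int[mu]_t (f (X t) * G t)%:E)%E.
Proof.
move=> mf f0.
have mfE : measurable_fun setT (fun y : Y => (f y)%:E : \bar R) by exact/measurable_EFinP.
pose h := nnsfun_approx measurableT mfE.
have hcvg y : (h n y)%:E @[n --> \oo] --> (f y)%:E.
  by apply: (@cvg_nnsfun_approx _ _ _ _ measurableT _ mfE) => // z _ /=; rewrite lee_fin.
have hnd y : {homo h ^~ y : m n / (m <= n)%N >-> m <= n}.
  by move=> m n mn; exact/lefP/nd_nnsfun_approx.
have -> : (\int[nu]_y (f y)%:E)%E = limn (fun n => \int[nu]_y (h n y)%:E)%E.
  rewrite -monotone_convergence //.
  - by apply: eq_integral => y _; apply/esym/cvg_lim => //; exact: hcvg.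
  - by move=> n; exact/measurable_EFinP/measurable_funP.
  - by move=> n y _; rewrite lee_fin.
  - by move=> y _ m n mn; rewrite lee_fin; exact: hnd.
have mhX n : measurable_fun setT (fun t => h n (X t)) by exact: measurableT_comp.
have -> : (\int[mu]_t (f (X t) * G t)%:E)%E
    = limn (fun n => \int[mu]_t (h n (X t) * G t)%:E)%E.
  rewrite -monotone_convergence //.
  - apply: eq_integral => t _; apply/esym/cvg_lim => //.
    apply: (@cvg_trans _ ((h n (X t))%:E * (G t)%:E @[n --> \oo])%E).
      by under eq_fun do rewrite EFinM.
    by rewrite EFinM; apply: cvgeZr => //; exact: hcvg.
  - by move=> n; apply/measurable_EFinP/measurable_funM.
  - by move=> n y _; rewrite lee_fin mulr_ge0.
  - by move=> y _ m n mn; rewrite lee_fin ler_wpM2r //; exact: hnd.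
congr (limn _); apply/funext => n.
have mI r : measurable (h n @^-1` [set r]) by exact: measurable_sfunP.
have mIX r : measurable (X @^-1` (h n @^-1` [set r])).
  by rewrite -[X in measurable X]setTI; exact: mX.
transitivity (\sum_(k \in range (h n))
    \int[nu]_y (k * \1_(h n @^-1` [set k]) y)%:E)%E.
  under eq_integral do rewrite fimfunE -fsumEFin//.
  rewrite ge0_integral_fsum//.
  - by move=> y; exact/measurable_EFinP/measurable_funM.
  - by move=> y x _; rewrite nnfun_muleindic_ge0.
transitivity (\sum_(k \in range (h n))
    \int[mu]_t (k * \1_(h n @^-1` [set k]) (X t) * G t)%:E)%E; last first.
  rewrite -ge0_integral_fsum//.
  - apply: eq_integral => t _; rewrite [in RHS]fimfunE fsumEFin//.
    by rewrite fsbig_finite // [in RHS]fsbig_finite //= -mulr_suml.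
  - move=> k; apply/measurable_EFinP/measurable_funM => //.
    by apply: measurable_funM => //; exact: (measurableT_comp (measurable_indic (mI k)) mX).
  - move=> k t _; rewrite EFinM mule_ge0 ?lee_fin //.
    by have := nnfun_muleindic_ge0 (h n) k (X t); rewrite lee_fin.
apply: eq_fsbigr => r /[!inE] -[y _ <-{r}].
have hy : 0 <= h n y by [].
under eq_integral do rewrite EFinM.
rewrite ge0_integralZl_EFin //; last exact/measurable_EFinP/measurable_indic.
rewrite integral_indic // setIT nuE //.
have -> : (\int[mu]_(t in X @^-1` (h n @^-1` [set h n y])) (G t)%:E)%E
   = (\int[mu]_t (\1_(h n @^-1` [set h n y]) (X t) * G t)%:E)%E.
  rewrite integral_mkcond; apply: eq_integral => t _.
  rewrite patchE indicE /=.
  have -> : (t \in X @^-1` (h n @^-1` [set h n y]))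
    = (X t \in h n @^-1` [set h n y]) by apply/idP/idP; rewrite !inE.
  by case: ifPn; rewrite ?mul1r ?mul0r.
rewrite -ge0_integralZl_EFin //.
- by apply: eq_integral => t _; rewrite -EFinM mulrA.
- by move=> t _; rewrite lee_fin mulr_ge0.
- apply/measurable_EFinP/measurable_funM => //.
  exact: (measurableT_comp (measurable_indic (mI _)) mX).
Qed.

End density.

Section gaussian_moments.
Context {R : realType}.
Implicit Types (t x : R) (k n : nat).
Local Notation mu := (@lebesgue_measure R).
Local Notation gamma := (@normal_prob R 0 1).
Local Notation phi := (@normal_pdf R 0 1).

Lemma phiE x : phi x = normal_peak 1 * expR (- x ^+ 2 / 2).
Proof.
by rewrite normal_pdfE ?oner_neq0 // /normal_fun subr0 expr1n.
Qed.

Lemma ge0_integral_gamma (f : R -> R) : measurable_fun setT f ->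
  (forall y, 0 <= f y) ->
  (\int[gamma]_y (f y)%:E = \int[mu]_t (f t * phi t)%:E)%E.
Proof.
move=> mf f0.
apply: (@ge0_integral_density _ _ _ _ _ mu gamma idfun phi) => //.
- exact: measurable_id.
- exact: measurable_normal_pdf.
- by move=> t; exact: normal_pdf_ge0.
Qed.

(** Completing the square: [expR (t * x)] times the standard density is
    [expR (t ^+ 2 / 2)] times the density centred at [t]. *)
Lemma gaussian_mgf t :
  (\int[gamma]_x (expR (t * x))%:E = (expR (t ^+ 2 / 2))%:E)%E.
Proof.
have mf : measurable_fun setT (fun x => expR (t * x)).
  by apply: measurableT_comp; [exact: measurable_expR | exact: mulrl_measurable].
rewrite ge0_integral_gamma //.
transitivity (\int[mu]_x ((expR (t ^+ 2 / 2))%:E * (normal_pdf t 1 x)%:E))%E.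
  apply: eq_integral => x _; rewrite -EFinM; congr EFin.
  rewrite phiE normal_pdfE ?oner_neq0 // /normal_fun expr1n.
  rewrite mulrCA [RHS]mulrCA -!expRD; congr (_ * expR _).
  by rewrite -[1 *+ 2]/(2%:R : R); field.
rewrite ge0_integralZl_EFin ?expR_ge0 //; last 2 first.
- by move=> x _; rewrite lee_fin normal_pdf_ge0.
- by apply/measurable_EFinP; exact: measurable_normal_pdf.
by rewrite integral_normal_pdf mule1.
Qed.

(** Since exponentials have finite Gaussian means, this domination gives
    finite moments of all orders. *)
Lemma normX_le_expR k x : `|x| ^+ k <= k`!%:R * (expR x + expR (- x)).
Proof.
have h : `|x| ^+ k <= k`!%:R * expR `|x|.
  case: k => [|k].
    by rewrite expr0 fact0 mul1r -[X in X <= _]expR0 ler_expR.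
  have := expR_ge1Dxn k (normr_ge0 x).
  have f0 : 0 < k.+1`!%:R :> R by rewrite ltr0n fact_gt0.
  rewrite -ler_pdivrMl // mulrC => h; apply: le_trans h.
  by rewrite lerDr.
apply: (le_trans h); rewrite ler_wpM2l //.
by case: (ger0P x) => _; rewrite ?lerDl ?lerDr expR_ge0.
Qed.

Lemma integrable_gammaX k : gamma.-integrable setT (fun x => (x ^+ k)%:E).
Proof.
have ie t : gamma.-integrable setT (fun x => (expR (t * x))%:E).
  have mt : measurable_fun setT (fun x => expR (t * x)).
    by apply: measurableT_comp; [exact: measurable_expR | exact: mulrl_measurable].
  apply/integrableP; split; first exact/measurable_EFinP.
  under eq_integral do rewrite /= ger0_norm ?expR_ge0//.
  by rewrite gaussian_mgf ltry.
have ig : gamma.-integrable setT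
    (fun x => (k`!%:R)%:E * ((expR (1 * x))%:E + (expR (-1 * x))%:E))%E.
  by apply: integrableZl => //; apply: integrableD => //; exact: ie.
apply: le_integrable ig => //.
- by apply/measurable_EFinP; exact: measurable_funX.
- move=> x _ /=; rewrite lee_fin mul1r mulN1r normrX.
  by apply: (le_trans (normX_le_expR _ _)); exact: ler_norm.
Qed.

Definition gmoment k : R := fine (\int[gamma]_x (x ^+ k)%:E)%E.

Lemma gmomentE k : (\int[gamma]_x (x ^+ k)%:E = (gmoment k)%:E)%E.
Proof. by rewrite /gmoment fineK // integrable_fin_num //; exact: integrable_gammaX. Qed.

Lemma integrable_phiX k : mu.-integrable setT (fun x => (x ^+ k * phi x)%:E).
Proof.
have := integrable_gammaX k => /integrableP[_ h].
have mx : measurable_fun setT (fun x : R => x ^+ k) by exact: measurable_funX.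
apply/integrableP; split.
  by apply/measurable_EFinP/measurable_funM => //; exact: measurable_normal_pdf.
move: h; rewrite (_ : (fun x => `|_|%E) = (fun x => (`|x ^+ k|)%:E)) //.
rewrite ge0_integral_gamma //; last exact: measurableT_comp.
under eq_integral => x _ do
  rewrite -[phi x]ger0_norm ?normal_pdf_ge0 // -normrM.
by [].
Qed.

Lemma integral_phiX k : (\int[mu]_x (x ^+ k * phi x)%:E = (gmoment k)%:E)%E.
Proof.
have mx : measurable_fun setT (fun x : R => x ^+ k) by exact: measurable_funX.
have mphi : measurable_fun setT phi by exact: measurable_normal_pdf.
rewrite -gmomentE integralE [RHS]integralE.
have -> : (fun x : R => (x ^+ k)%:E)^\+%E
  = (fun x => (Num.max (x ^+ k) 0)%:E) :> (R -> \bar R).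
  by apply/funext => x; rewrite funeposE -EFin_max.
have -> : (fun x : R => (x ^+ k)%:E)^\-%E
  = (fun x => (Num.max (- x ^+ k) 0)%:E) :> (R -> \bar R).
  by apply/funext => x; rewrite funenegE -EFinN -EFin_max.
rewrite !ge0_integral_gamma //; last first.
- by move=> x; rewrite le_max lexx orbT.
- by apply: measurable_maxr => //.
- by move=> x; rewrite le_max lexx orbT.
- by apply: measurable_maxr => //; exact: measurableT_comp.
congr (_ - _)%E; apply: eq_integral => x _; rewrite ?funeposE ?funenegE -?EFinN -EFin_max maxr_pMl ?normal_pdf_ge0 // mul0r //.
by rewrite mulNr.
Qed.

Lemma is_derive_phiX k x :
  is_derive x (1:R) (fun x => x ^+ k * phi x)
    (k%:R * (x ^+ k.-1 * phi x) - x ^+ k.+1 * phi x).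
Proof.
have hX m : is_derive x (1:R) (fun y : R => y ^+ m) (m%:R * x ^+ m.-1).
  have -> : (fun y : R => y ^+ m) = (id : R -> R) ^+ m.
    by apply/funext => y; rewrite fctE.
  apply: (is_derive_eq (is_deriveX m (is_derive_id x 1))).
  by rewrite /GRing.scale /= mulr1.
have h2 : is_derive x (1:R) (fun y : R => - y ^+ 2 / 2) (- x).
  have -> : (fun y : R => - y ^+ 2 / 2) = (- 2^-1) *: (fun y : R => y ^+ 2).
    by apply/funext => y; transitivity (- 2^-1 * y ^+ 2); first by field.
  apply: (is_derive_eq (is_deriveZ (- 2^-1) (hX 2%N))).
  by rewrite /GRing.scale /= expr1; field.
have h3 := is_derive1_comp (is_derive_expR _) h2.
have h4 := is_deriveZ (normal_peak 1) h3.
have -> : (fun x => x ^+ k * phi x)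
    = (fun y : R => y ^+ k) * (normal_peak 1 *: (expR \o (fun y : R => - y ^+ 2 / 2))).
  by apply/funext => y; rewrite phiE.
apply: (is_derive_eq (is_deriveM (hX k) h4)).
rewrite !phiE /GRing.scale /= (exprS x k).
by rewrite -[normal_peak 1 *: expR _]/(normal_peak 1 * expR _); ring.
Qed.

(** The integers are where the boundary terms of the integration by parts in
    [gmoment_rec] are taken. *)
Lemma phi_decay k n :
  `|n.+1%:R ^+ k * phi n.+1%:R| <= (normal_peak 1 * (2 ^+ k.+1 * k.+1`!%:R)) / n.+1%:R.
Proof.
set N : R := n.+1%:R; have N1 : 1 <= N by rewrite ler1n.
have N0 : 0 < N by apply: lt_le_trans N1.
have p0 := normal_peak_ge0 (1 : R).
rewrite phiE ger0_norm; last by rewrite !mulr_ge0 ?exprn_ge0 ?expR_ge0 // ltW.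
rewrite mulrCA -mulrA ler_wpM2l // ler_pdivlMr //.
rewrite mulrAC -exprSr mulNr expRN ler_pdivrMr ?expR_gt0 //.
have h : (N ^+ 2 / 2) ^+ k.+1 <= k.+1`!%:R * expR (N ^+ 2 / 2).
  have f0 : 0 < k.+1`!%:R :> R by rewrite ltr0n fact_gt0.
  rewrite -ler_pdivrMl // mulrC.
  have y0 : 0 <= N ^+ 2 / 2 by rewrite divr_ge0 // exprn_ge0 // ltW.
  by apply: le_trans (expR_ge1Dxn k y0); rewrite lerDr.
apply: (@le_trans _ _ (2 ^+ k.+1 * (N ^+ 2 / 2) ^+ k.+1)).
  rewrite -exprMn mulrC divfK // -exprM mulnC.
  by rewrite ler_weXn2l // leq_pmulr.
apply: (le_trans (ler_wpM2l _ h)); first by rewrite exprn_ge0.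
by rewrite mulrA.
Qed.

Lemma phiN x : phi (- x) = phi x.
Proof. by rewrite !phiE sqrrN. Qed.

(** Integration by parts: the derivative [f] of [x ^+ k * phi x] has integral
    zero, because [x ^+ k * phi x] vanishes at infinity. The case [k = 0] is
    covered because the factor [k%:R] is then zero. *)
Lemma gmoment_rec k : gmoment k.+1 = k%:R * gmoment k.-1.
Proof.
pose f x := k%:R * (x ^+ k.-1 * phi x) - x ^+ k.+1 * phi x.
pose F x := x ^+ k * phi x.
have cX m : continuous (fun x : R => x ^+ m * phi x).
  move=> x; apply/differentiable_continuous/derivable1_diffP.
  by have [] := is_derive_phiX m x.
have cf : continuous f.
  move=> x; apply: cvgB; last exact: cX.
  by apply: cvgM; [exact: cvg_cst | exact: cX].
have iX m : mu.-integrable setT (fun x => (x ^+ m * phi x)%:E) by exact: integrable_phiX.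
have iF : mu.-integrable setT (fun x => (f x)%:E).
  have -> : (fun x => (f x)%:E)
    = (fun x => k%:R%:E * (x ^+ k.-1 * phi x)%:E - (x ^+ k.+1 * phi x)%:E)%E by [].
  by apply: integrableB => //; apply: integrableZl.
have mf : measurable_fun setT f.
  exact: continuous_measurable_fun.
have Ef : (\int[mu]_x (f x)%:E = (k%:R * gmoment k.-1 - gmoment k.+1)%:E)%E.
  have -> : (fun x => (f x)%:E)
    = (fun x => k%:R%:E * (x ^+ k.-1 * phi x)%:E - (x ^+ k.+1 * phi x)%:E)%E by [].
  rewrite integralB //; last by apply: integrableZl.
  by rewrite integralZl // !integral_phiX.
(* The integral of [f] is the limit of its integrals on the intervals [I n],
   which are boundary terms by the fundamental theorem of calculus. *)
pose I n := `[- n.+1%:R, n.+1%:R : R]%classic.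
have FTC n : (\int[mu]_(x in I n) (f x)%:E = (F n.+1%:R - F (- n.+1%:R))%:E)%E.
  have n0 : 0 < n.+1%:R :> R by rewrite ltr0n.
  rewrite (@continuous_FTC2 _ f F) //.
  - by apply: lt_trans n0; rewrite oppr_lt0.
  - exact: continuous_subspaceT.
  - split.
    + by move=> x _; have [] := is_derive_phiX k x.
    + by apply: cvg_at_right_filter; exact: cX.
    + by apply: cvg_at_left_filter; exact: cX.
  - by move=> x _; rewrite derive1E; have [_ ->] := is_derive_phiX k x.
have lim1 : (\int[mu]_(x in I n) (f x)%:E @[n --> \oo] --> \int[mu]_x (f x)%:E)%E.
  under eq_fun do rewrite integral_mkcond.
  apply: (@dominated_cvg _ _ _ mu setT measurableT _ _ (fun x => `|(f x)%:E|%E)) => //.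
  - move=> n; apply: (measurable_restrictT _ _).1 => //.
      exact: measurable_itv.
    by apply: measurable_funTS; exact/measurable_EFinP.
  - move=> x _; apply: cvg_near_cst; near=> n.
    rewrite patchE mem_set // /I /= in_itv /= -ler_norml.
    apply: (@le_trans _ _ n%:R); last by rewrite ler_nat.
    by near: n; exact: nbhs_infty_ger.
  - exact: integrable_abse.
  - by move=> n x _; rewrite patchE; case: ifP => // _; rewrite abse0 abse_ge0.
have lim2 : (\int[mu]_(x in I n) (f x)%:E @[n --> \oo] --> 0%:E)%E.
  under eq_fun do rewrite FTC.
  apply: cvg_EFin; first by near=> n.
  rewrite -[X in _ --> X]subr0.
  pose C : R := normal_peak 1 * (2 ^+ k.+1 * k.+1`!%:R).
  have CC : (C / n.+1%:R) @[n --> \oo] --> (0 : R).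
    rewrite -(mulr0 C); apply: cvgM; first exact: cvg_cst.
    exact: cvg_harmonic.
  have sq (u : nat -> R) : (forall n, `|u n| <= C / n.+1%:R) -> u n @[n --> \oo] --> (0 : R).
    move=> hu; apply: (@squeeze_cvgr _ _ _ _ (fun n => - (C / n.+1%:R)) (fun n => C / n.+1%:R)) => //.
    - by near=> n; rewrite -ler_norml.
    - by rewrite -oppr0; exact: cvgN.
  apply: cvgB; apply: sq => n.
    exact: phi_decay.
  by rewrite /F phiN normrM normrX normrN -normrX -normrM; exact: phi_decay.
have lim12 : (\int[mu]_x (f x)%:E = 0%:E)%E by exact: cvg_unique lim1 lim2.
have h : k%:R * gmoment k.-1 - gmoment k.+1 = 0 by apply: EFin_inj; rewrite -Ef lim12.
by apply/esym/eqP; rewrite -subr_eq0 h.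
Unshelve. all: by end_near. Qed.

Lemma gmoment0 : gmoment 0 = 1.
Proof.
rewrite /gmoment; under eq_integral do rewrite expr0.
rewrite integral_cst //.
by rewrite mul1e [X in fine X]probability_setT.
Qed.

Lemma gmoment_odd k : odd k -> gmoment k = 0.
Proof.
elim/ltn_ind: k => -[//|[|k]] IH; rewrite gmoment_rec ?mul0r //=.
by rewrite negbK => ok; rewrite IH ?mulr0.
Qed.

Lemma gmoment2 : gmoment 2 = 1.
Proof. by rewrite gmoment_rec gmoment0 mulr1. Qed.

Lemma gmoment4 : gmoment 4 = 3.
Proof. by rewrite gmoment_rec gmoment2 mulr1. Qed.

End gaussian_moments.

(** * Expectations of products of independent variables *)

Section independence.
Context d (T : measurableType d) (R : realType) (P : probability T R).
Context (I : finType) (Z : I -> {RV P >-> R}).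
Hypothesis indep : mutually_independent Z.

(** Keeping the indicator of such an event inside the integrals below allows
    an induction on the number of factors, in which the product rule for
    events is used for one variable at a time. *)
Definition jointly (J : {set I}) (B : I -> set R) : set T :=
  [set w | forall i, i \in J -> B i (Z i w)].

Lemma measurable_jointly (J : {set I}) (B : I -> set R) : (forall i, measurable (B i)) ->
  measurable (jointly J B).
Proof.
move=> mB; rewrite (_ : jointly J B = \bigcap_(i in [set` J]) (Z i @^-1` B i)); last first.
  by apply/seteqP; split=> w /= h i; [move=> iJ; exact: h|move=> iJ; exact: h].
apply: fin_bigcap_measurable => // i _.
by rewrite -[X in measurable X]setTI; exact: measurable_funP.
Qed.

Lemma jointly_setU1 (J : {set I}) (B : I -> set R) k (C : set R) : k \notin J ->
  (forall i, measurable (B i)) -> measurable C ->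
  let B' i := if i == k then C else B i in
  jointly (k |: J) B' = (Z k @^-1` C) `&` jointly J B /\
  (P (jointly (k |: J) B') = P (Z k @^-1` C) * P (jointly J B))%E.
Proof.
move=> kJ mB mC B'.
have mB' i : measurable (B' i) by rewrite /B'; case: ifP.
split.
  apply/seteqP; split=> w /=.
    move=> h; split; first by have := h k; rewrite setU11 /B' eqxx; exact.
    move=> i iJ; have := h i; rewrite setU1r // /B' => /(_ isT).
    by case: eqP => // e; move: kJ; rewrite -e iJ.
  by move=> [h1 h2] i; rewrite !inE /B'; case: eqP => [-> //|_ /=]; exact: h2.
rewrite /jointly indep // indep // big_setU1 //= /B' eqxx.
congr (_ * _)%E; apply: eq_bigr => i iJ.
by case: eqP => // e; move: kJ; rewrite -e iJ.
Qed.

(** The induction hypothesis, applied to the events [jointly J B] with one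
    more condition on [Z k], says that the measure of density [G], the product
    of the remaining factors and the indicator, has as image under [Z k] a
    multiple of the law of [Z k]. Integrating [f k] against this image
    produces the factor [m k]. *)
Lemma ge0_expectation_prod (f : I -> R -> R) (m : I -> R) :
  (forall i, measurable_fun setT (f i)) -> (forall i x, 0 <= f i x) ->
  (forall i, (\int[P]_w (f i (Z i w))%:E = (m i)%:E)%E) ->
  forall (s : seq I) (J : {set I}) (B : I -> set R), uniq s ->
  (forall i, i \in s -> i \notin J) -> (forall i, measurable (B i)) ->
  (\int[P]_w ((\prod_(i <- s) f i (Z i w)) * \1_(jointly J B) w)%:E
   = (\prod_(i <- s) m i)%:E * P (jointly J B))%E.
Proof.
move=> mf f0 fm; have m0 i : 0 <= m i.
  by rewrite -lee_fin -fm; apply: integral_ge0 => w _; rewrite lee_fin.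
elim=> [|k s IH] J B us sJ mB.
  rewrite big_nil mul1e; under eq_integral do rewrite big_nil mul1r.
  by rewrite integral_indic ?setIT //; exact: measurable_jointly.
move: us => /= /andP[ks us].
have kJ : k \notin J by apply: sJ; rewrite mem_head.
pose G w := (\prod_(i <- s) f i (Z i w)) * \1_(jointly J B) w : R.
have mZ i : measurable_fun setT (fun w => f i (Z i w)) by exact: measurableT_comp.
have mG : measurable_fun setT G.
  apply: measurable_funM; last by apply: measurable_indic; exact: measurable_jointly.
  by apply: measurable_prod => i _; exact: mZ.
have G0 w : 0 <= G w by rewrite mulr_ge0 // prodr_ge0.
have pJ : P (jointly J B) \is a fin_num by apply: fin_num_measure; exact: measurable_jointly.
have c0 : 0 <= (\prod_(i <- s) m i) * fine (P (jointly J B)).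
  by rewrite mulr_ge0 ?prodr_ge0 // fine_ge0.
pose c := NngNum c0.
have cE : (c%:num%:E = (\prod_(i <- s) m i)%:E * P (jointly J B))%E.
  by rewrite /= EFinM fineK.
have key C : measurable C ->
   (mscale c (distribution P (Z k)) C = \int[P]_(w in Z k @^-1` C) (G w)%:E)%E.
  move=> mC; have [e1 e2] := jointly_setU1 kJ mB mC.
  set B' := fun i => _ in e1 e2.
  have mB' i : measurable (B' i) by rewrite /B'; case: ifP.
  have := IH (k |: J) B' us; rewrite e1 => h.
  rewrite /mscale /= -/(c%:num) cE -muleA [X in (_ * X)%E]muleC.
  rewrite integral_mkcond.
  transitivity (\int[P]_w ((\prod_(i <- s) f i (Z i w))
     * \1_(Z k @^-1` C `&` jointly J B) w)%:E)%E.
    rewrite h; first by congr (_ * _)%E; rewrite -e2 e1.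
    - move=> i si; rewrite !inE negb_or sJ ?inE ?si ?orbT // andbT.
      by apply: contraNneq ks => <-.
    - exact: mB'.
  apply: eq_integral => w _; rewrite patchE /G !indicE in_setI.
  by case: (w \in _); rewrite ?mul1r //= mulr0.
under eq_integral do rewrite big_cons -mulrA.
rewrite -(@ge0_integral_density _ _ _ _ _ P (mscale c (distribution P (Z k))) (Z k) G) //.
rewrite ge0_integral_mscale //; last 2 first.
- by apply/measurable_EFinP.
- by move=> x _; rewrite lee_fin.
rewrite ge0_integral_distribution //; last 2 first.
- by apply/measurable_EFinP.
- by move=> x; rewrite lee_fin.
by rewrite [X in (_ * X)%E]fm cE big_cons EFinM muleC muleA.
Qed.

End independence.

Section mean.
Context d (T : measurableType d) (R : realType) (P : probability T R).
Implicit Types (f g : T -> R).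

(** Integrability and the value of the integral are kept together, so that the
    rules of calculus below have no side conditions. *)
Definition has_mean f (e : R) :=
  P.-integrable setT (fun w => (f w)%:E) /\ (\int[P]_w (f w)%:E = e%:E)%E.

Lemma has_mean_eq f g e e' : f =1 g -> e = e' -> has_mean f e -> has_mean g e'.
Proof. by move=> /funext -> ->. Qed.

Lemma has_mean_cst c : has_mean (fun=> c) c.
Proof.
split; first exact: finite_measure_integrable_cst.
by rewrite integral_cst //= probability_setT mule1.
Qed.

Lemma has_meanD f g e e' :
  has_mean f e -> has_mean g e' -> has_mean (fun w => f w + g w) (e + e').
Proof.
move=> [f1 f2] [g1 g2]; split; first exact: (integrableD measurableT f1 g1).
by under eq_integral do rewrite EFinD; rewrite integralD // f2 g2.
Qed.

Lemma has_meanZ c f e : has_mean f e -> has_mean (fun w => c * f w) (c * e).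
Proof.
move=> [f1 f2]; split; first exact: (integrableZl measurableT c f1).
by under eq_integral do rewrite EFinM; rewrite integralZl // f2.
Qed.

Lemma has_meanN f e : has_mean f e -> has_mean (fun w => - f w) (- e).
Proof.
move=> /(has_meanZ (-1)); apply: has_mean_eq; first by move=> w; rewrite mulN1r.
by rewrite mulN1r.
Qed.

Lemma has_meanB f g e e' :
  has_mean f e -> has_mean g e' -> has_mean (fun w => f w - g w) (e - e').
Proof. by move=> hf /has_meanN; exact: has_meanD. Qed.

Lemma has_mean_sum (I : Type) (s : seq I) (p : pred I) (F : I -> T -> R) (e : I -> R) :
  (forall i, has_mean (F i) (e i)) ->
  has_mean (fun w => \sum_(i <- s | p i) F i w) (\sum_(i <- s | p i) e i).
Proof.
move=> h; elim: s => [|i s IH].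
  by apply: has_mean_eq (has_mean_cst 0) => [w|]; rewrite big_nil.
case pi : (p i).
  by apply: has_mean_eq (has_meanD (h i) IH) => [w|]; rewrite big_cons pi.
by apply: has_mean_eq IH => [w|]; rewrite big_cons pi.
Qed.

Lemma has_mean_expectation f e : has_mean f e -> ('E_P[f] = e%:E)%E.
Proof. by case=> _ fe; rewrite unlock. Qed.

Lemma has_mean_exists f : P.-integrable setT (fun w => (f w)%:E) ->
  has_mean f (fine 'E_P[f]).
Proof.
by move=> h; split=> //; rewrite unlock fineK //; exact: integrable_fin_num.
Qed.

Lemma has_mean_le f g e e' : (forall w, f w <= g w) ->
  has_mean f e -> has_mean g e' -> e <= e'.
Proof.
move=> fg [f1 f2] [g1 g2]; rewrite -lee_fin -f2 -g2; apply: le_integral => //.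
by move=> w _; rewrite lee_fin.
Qed.

Lemma has_mean_unique f e e' : has_mean f e -> has_mean f e' -> e = e'.
Proof. by move=> [_ h1] [_ h2]; apply: EFin_inj; rewrite -h1 -h2. Qed.

End mean.

Section gaussian_family.
Context d (T : measurableType d) (R : realType) (P : probability T R).
Context (I : finType) (Z : I -> {RV P >-> R}).
Hypothesis indep : mutually_independent Z.
Hypothesis law : forall i B, measurable B ->
  distribution P (Z i) B = normal_prob 0 1 B.

Lemma integral_law i (f : R -> R) : measurable_fun setT f ->
  (forall x, 0 <= f x) ->
  (\int[P]_w (f (Z i w))%:E = \int[normal_prob 0 1]_x (f x)%:E)%E.
Proof.
move=> mf f0.
transitivity (\int[distribution P (Z i)]_x (f x)%:E)%E.
  by rewrite ge0_integral_distribution //; apply/measurable_EFinP.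
rewrite ge0_integral_gamma //.
apply: (@ge0_integral_density _ _ _ _ _ (@lebesgue_measure R)
  (distribution P (Z i)) idfun (normal_pdf 0 1)) => //.
- exact: measurable_id.
- exact: measurable_normal_pdf.
- by move=> t; exact: normal_pdf_ge0.
- by move=> B mB; exact: (law i mB).
Qed.

Lemma ge0_has_mean (f : T -> R) (e : R) : measurable_fun setT f ->
  (forall w, 0 <= f w) -> (\int[P]_w (f w)%:E = e%:E)%E -> has_mean P f e.
Proof.
move=> mf f0 fe; split => //; apply/integrableP; split.
  exact/measurable_EFinP.
by under eq_integral do rewrite /= ger0_norm ?f0 //; rewrite fe ltry.
Qed.

Lemma has_mean_gammaX i k : has_mean P (fun w => Z i w ^+ k) (gmoment k).
Proof.
have mx : measurable_fun setT (fun x : R => x ^+ k) by exact: measurable_funX.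
have ix := @integrable_gammaX R k.
(* [integral_law] is about nonnegative functions; the power is split into its
   positive and negative parts. *)
have part (f : R -> R) : measurable_fun setT f -> (forall x, 0 <= f x) ->
    (forall x, f x <= `|x ^+ k|) ->
    has_mean P (fun w => f (Z i w)) (fine (\int[normal_prob 0 1]_x (f x)%:E)%E).
  move=> mf f0 fx; apply: ge0_has_mean => //; first exact: measurableT_comp.
  rewrite integral_law // fineK // integrable_fin_num //.
  apply: le_integrable ix => //; first exact/measurable_EFinP.
  by move=> x _; rewrite /= lee_fin ger0_norm.
have m1 : measurable_fun setT (fun x : R => Num.max (x ^+ k) 0) by exact: measurable_maxr.
have m2 : measurable_fun setT (fun x : R => Num.max (- x ^+ k) 0).
  by apply: measurable_maxr => //; exact: measurableT_comp.
have h1 := part _ m1 _ _; have h2 := part _ m2 _ _.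
apply: has_mean_eq (has_meanB (h1 _ _) (h2 _ _)).
- move=> w /=; set y := Z i w ^+ k.
  by case: (leP y 0) => y0; case: leP => //; lra.
- rewrite /gmoment [in RHS]integralE.
  have -> : (fun x : R => (x ^+ k)%:E)^\+%E
    = (fun x => (Num.max (x ^+ k) 0)%:E) :> (R -> \bar R).
    by apply/funext => x; rewrite funeposE -EFin_max.
  have -> : (fun x : R => (x ^+ k)%:E)^\-%E
    = (fun x => (Num.max (- x ^+ k) 0)%:E) :> (R -> \bar R).
    by apply/funext => x; rewrite funenegE -EFinN -EFin_max.
  rewrite [RHS]fineB //.
  - rewrite integrable_fin_num //.
    apply: le_integrable ix => //; first exact/measurable_EFinP.
    move=> x _; rewrite /= lee_fin ger0_norm ?le_max ?lexx ?orbT //.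
    by rewrite ge_max ler_norm normr_ge0.
  - rewrite integrable_fin_num //.
    apply: le_integrable ix => //; first exact/measurable_EFinP.
    move=> x _; rewrite /= lee_fin ger0_norm ?le_max ?lexx ?orbT //.
    by rewrite ge_max normr_ge0 andbT lerNl lerNnormlW.
- by move=> x; rewrite le_max lexx orbT.
- by move=> x; rewrite ge_max ler_norm normr_ge0.
- by move=> x; rewrite le_max lexx orbT.
- by move=> x; rewrite ge_max normr_ge0 andbT lerNl lerNnormlW.
Qed.

End gaussian_family.

(** * Wick's formula *)

Section wick.
Context d (T : measurableType d) (R : realType) (P : probability T R).
Context (I : finType) (Z : I -> {RV P >-> R}).
Hypothesis indep : mutually_independent Z.

Lemma ge0_has_mean_prod (f : I -> R -> R) (m : I -> R) :
  (forall i, measurable_fun setT (f i)) -> (forall i x, 0 <= f i x) ->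
  (forall i, has_mean P (fun w => f i (Z i w)) (m i)) ->
  has_mean P (fun w => \prod_i f i (Z i w)) (\prod_i m i).
Proof.
move=> mf f0 fm; apply: ge0_has_mean.
- by apply: measurable_prod => i _; exact: measurableT_comp.
- by move=> w; exact: prodr_ge0.
- have h := ge0_expectation_prod indep mf f0 (fun i => (fm i).2).
  have := h (index_enum I) finset.set0 (fun=> setT) (index_enum_uniq _).
  have -> : jointly Z finset.set0 (fun=> setT) = setT.
    by apply/seteqP; split=> w // _ i; rewrite inE.
  rewrite probability_setT mule1 => <- //.
  + by apply: eq_integral => w _; rewrite indicT mulr1.
  + by move=> i _; rewrite inE.
Qed.

(** Both sides are linear in each [f k], and [f k] is the difference of two
    nonnegative functions. So the factors of variable sign, listed in [s], can
    be removed one after the other, until [ge0_has_mean_prod] applies. *)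
Lemma has_mean_prod (f : I -> R -> R) (m : I -> R) :
  (forall i, measurable_fun setT (f i)) ->
  (forall i, has_mean P (fun w => f i (Z i w)) (m i)) ->
  has_mean P (fun w => \prod_i f i (Z i w)) (\prod_i m i).
Proof.
move=> mf fm.
suff claim (s : seq I) : forall (f : I -> R -> R) (m : I -> R),
    (forall i, measurable_fun setT (f i)) ->
    (forall i, has_mean P (fun w => f i (Z i w)) (m i)) ->
    (forall i, i \notin s -> forall x, 0 <= f i x) ->
    has_mean P (fun w => \prod_i f i (Z i w)) (\prod_i m i).
  by apply: (claim (index_enum I)) => // i; rewrite mem_index_enum.
elim: s {f m mf fm} => [|k s IH] f m mf fm f0.
  by apply: ge0_has_mean_prod => // i; apply: f0.
pose upd (g : R -> R) i := if i == k then g else f i.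
pose updm (e : R) i := if i == k then e else m i.
have step (g : R -> R) e : measurable_fun setT g -> (forall x, 0 <= g x) ->
    has_mean P (fun w => g (Z k w)) e ->
    has_mean P (fun w => g (Z k w) * \prod_(i | i != k) f i (Z i w))
               (e * \prod_(i | i != k) m i).
  move=> mg g0 ge.
  have -> : e * \prod_(i | i != k) m i = \prod_i updm e i.
    rewrite [RHS](bigD1 k) //= {1}/updm eqxx; congr (_ * _).
    by apply: eq_bigr => i /negbTE ik; rewrite /updm ik.
  apply: (has_mean_eq _ erefl (IH (upd g) (updm e) _ _ _)).
  - move=> w; rewrite (bigD1 k) //= {1}/upd eqxx; congr (_ * _).
    by apply: eq_bigr => i /negbTE ik; rewrite /upd ik.
  - by move=> i; rewrite /upd; case: ifP.
  - by move=> i; rewrite /upd /updm; case: eqP => [->|].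
  - move=> i si x; rewrite /upd; case: eqP => // /eqP ik.
    by apply: f0; rewrite inE negb_or ik si.
have mp : measurable_fun setT (fun x => Num.max (f k x) 0) by exact: measurable_maxr.
have mn : measurable_fun setT (fun x => Num.max (- f k x) 0).
  by apply: measurable_maxr => //; exact: measurableT_comp.
have [ik _] := fm k.
have mfZ : measurable_fun setT (fun w => f k (Z k w)) by exact: measurableT_comp.
have part (g : R -> R) : measurable_fun setT g ->
    (forall x, `|g x| <= `|f k x|) -> exists e, has_mean P (fun w => g (Z k w)) e.
  move=> mg gf; exists (fine 'E_P[fun w => g (Z k w)]); apply: has_mean_exists.
  apply: le_integrable ik => //; first by apply/measurable_EFinP; exact: measurableT_comp.
  by move=> w _; rewrite /= lee_fin.
have p0 x : 0 <= Num.max x (0 : R) by rewrite le_max lexx orbT.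
have [e1 h1] : exists e, has_mean P (fun w => Num.max (f k (Z k w)) 0) e.
  by apply: (part _ mp) => x; rewrite ger0_norm // ge_max ler_norm normr_ge0.
have [e2 h2] : exists e, has_mean P (fun w => Num.max (- f k (Z k w)) 0) e.
  by apply: (part _ mn) => x; rewrite ger0_norm // ge_max normr_ge0 andbT lerNl lerNnormlW.
have e12 : m k = e1 - e2.
  apply: has_mean_unique (fm k) _; apply: has_mean_eq (has_meanB h1 h2) => // w.
  set y := f k _.
  by case: (leP y 0) => y0; case: leP => //; lra.
apply: has_mean_eq (has_meanB (step _ _ mp (fun x => p0 _) h1) (step _ _ mn (fun x => p0 _) h2)).
- move=> w; rewrite [RHS](bigD1 k) //= -mulrBl; congr (_ * _).
  set y := f k _.
  by case: (leP y 0) => y0; case: leP => //; lra.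
- by rewrite [RHS](bigD1 k) //= e12 -mulrBl.
Qed.

Hypothesis law : forall i B, measurable B ->
  distribution P (Z i) B = normal_prob 0 1 B.

Lemma prod_count (V : I -> R) (a : seq I) :
  \prod_(i <- a) V i = \prod_i V i ^+ count_mem i a.
Proof.
elim: a => [|j a IH]; first by rewrite big_nil big1.
rewrite big_cons IH (bigD1 j) //= [RHS](bigD1 j) //= eqxx exprD expr1 mulrA.
by congr (_ * _); apply: eq_bigr => i; rewrite eq_sym => /negbTE ->.
Qed.

Lemma has_mean_monomial (a : seq I) :
  has_mean P (fun w => \prod_(i <- a) Z i w) (\prod_i gmoment (count_mem i a)).
Proof.
apply: (@has_mean_eq _ _ _ _ (fun w => \prod_i Z i w ^+ count_mem i a)) => [w|//|].
  by rewrite -prod_count.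
apply: (@has_mean_prod (fun i x => x ^+ count_mem i a)) => i.
  exact: measurable_funX.
exact: has_mean_gammaX.
Qed.

(** Some variable occurs an odd number of times, and its odd moment is a
    factor of the mean. *)
Lemma has_mean_odd_monomial (a : seq I) : odd (size a) ->
  has_mean P (fun w => \prod_(i <- a) Z i w) 0.
Proof.
move=> oa; apply: has_mean_eq (has_mean_monomial a) => //.
have [i oi] : exists i, odd (count_mem i a).
  apply/existsP; apply: contraLR oa; rewrite negb_exists => /forallP ev.
  have -> : size a = (\sum_i count_mem i a)%N.
    elim: (a) => [|j b IH] /=; first by rewrite big1.
    rewrite big_split /= -IH (bigD1 j) //= eqxx big1 // => i.
    by rewrite eq_sym => /negbTE ->.
  by elim/big_rec: _ => // i n _; rewrite oddD (negbTE (ev i)).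
by rewrite (bigD1 i) //= gmoment_odd // mul0r.
Qed.

Lemma has_mean_wick2 a b : has_mean P (fun w => Z a w * Z b w) (a == b)%:R.
Proof.
apply: has_mean_eq (has_mean_monomial [:: a; b]).
  by move=> w; rewrite !big_cons big_nil mulr1.
rewrite (bigD1 a) //= eqxx (eq_sym b).
have [<-|ab] := eqVneq a b; last by rewrite gmoment_odd ?mul0r.
rewrite (_ : (_ + _)%N = 2%N) // gmoment2 mul1r big1 // => i ia.
by rewrite eq_sym (negbTE ia) gmoment0.
Qed.

(** One term for each pairing of the four indices. When all indices coincide
    the three terms add up to the fourth moment, and when they form two
    distinct pairs exactly one term is 1. *)
Lemma has_mean_wick4 a b c e :
  has_mean P (fun w => Z a w * Z b w * Z c w * Z e w)
   (((a == b) && (c == e))%:R + ((a == c) && (b == e))%:R + ((a == e) && (b == c))%:R).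
Proof.
apply: has_mean_eq (has_mean_monomial [:: a; b; c; e]).
  by move=> w; rewrite !big_cons big_nil mulr1 !mulrA.
set s := [:: a; b; c; e].
have -> : \prod_i gmoment (R := R) (count_mem i s)
    = \prod_(i <- undup s) gmoment (count_mem i s).
  rewrite [RHS]big_uniq ?undup_uniq // [LHS](bigID (mem (undup s))) /=.
  rewrite [X in _ * X]big1 ?mulr1 // => i hi.
  rewrite -[X in gmoment X]/(count_mem i s).
  have -> : count_mem i s = 0%N by apply/count_memPn; rewrite -mem_undup.
  exact: gmoment0.
rewrite {}/s.
have g1 := @gmoment_odd R 1 isT; have g3 := @gmoment_odd R 3 isT.
have g2 := @gmoment2 R; have g4 := @gmoment4 R.
have ne (x y : I) : x != y -> ((x == y) = false) * ((y == x) = false).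
  by move=> xy; rewrite (eq_sym y) (negbTE xy).
have sums := (add0r, addr0, big_cons, big_nil, mulr1, mulr0, mul0r, g1, g2, g3, g4).
have [<-{b}|/ne ab] := eqVneq a b; have [<-{c}|/ne ac] := eqVneq a c;
  have [<-{e}|/ne ae] := eqVneq a e; rewrite /= ?inE ?eqxx ?orbT /=.
- by rewrite ?(sums, eqxx) /= ?sums; ring.
- by rewrite ?(sums, ae, eqxx) /= ?(sums, ae, eqxx) /= ?sums.
- by rewrite ?(sums, ac, eqxx) /= ?(sums, ac, eqxx) /= ?sums.
- have [<-|/ne ce] := eqVneq c e;
    [by rewrite ?(sums, ac, ae, eqxx) /= ?(sums, ac, ae, eqxx) /= ?sums|by rewrite ?(sums, ac, ae, ce, eqxx) /= ?(sums, ac, ae, ce, eqxx) /= ?sums].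
- by rewrite ?(sums, ab, eqxx) /= ?(sums, ab, eqxx) /= ?sums.
- have [<-|/ne be] := eqVneq b e;
    [by rewrite ?(sums, ab, ae, eqxx) /= ?(sums, ab, ae, eqxx) /= ?sums|by rewrite ?(sums, ab, ae, be, eqxx) /= ?(sums, ab, ae, be, eqxx) /= ?sums].
- have [<-|/ne bc] := eqVneq b c;
    [by rewrite ?(sums, ab, ac, eqxx) /= ?(sums, ab, ac, eqxx) /= ?sums|by rewrite ?(sums, ab, ac, bc, eqxx) /= ?(sums, ab, ac, bc, eqxx) /= ?sums].
- by rewrite !(ab, ac, ae) /= big_cons eqxx !(ab, ac, ae) /= g1 mul0r !addr0.
Qed.

End wick.

(** * Homogeneous polynomials in Gaussian variables and traces of words *)

Section homogeneous.
Context d (T : measurableType d) (R : realType) (P : probability T R).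
Context (I : finType) (Z : I -> {RV P >-> R}).

(** Monomials are sequences of indices with repetition, so degrees add up by
    concatenation. *)
Definition hompoly (k : nat) (f : T -> R) := exists L : seq (R * seq I),
  all (fun m => size m.2 == k) L /\
  forall w, f w = \sum_(m <- L) m.1 * \prod_(i <- m.2) Z i w.

Lemma hompolyD k f g : hompoly k f -> hompoly k g -> hompoly k (fun w => f w + g w).
Proof.
move=> [L [hL fL]] [K [hK gK]]; exists (L ++ K); rewrite all_cat hL hK.
by split=> // w; rewrite big_cat /= fL gK.
Qed.

Lemma hompoly_cst c : hompoly 0 (fun=> c).
Proof. by exists [:: (c, [::])]; split=> // w; rewrite big_seq1 big_nil mulr1. Qed.

Lemma hompoly0 k : hompoly k (fun=> 0).
Proof. by exists [::]; split=> // w; rewrite big_nil. Qed.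

Lemma hompolyZ k c f : hompoly k f -> hompoly k (fun w => c * f w).
Proof.
move=> [L [hL fL]]; exists [seq (c * m.1, m.2) | m <- L]; split.
  by rewrite all_map; apply: sub_all hL.
by move=> w; rewrite big_map fL mulr_sumr; apply: eq_bigr => m _; rewrite mulrA.
Qed.

Lemma hompolyM k l f g : hompoly k f -> hompoly l g -> hompoly (k + l) (fun w => f w * g w).
Proof.
move=> [L [hL fL]] [K [hK gK]].
exists [seq (m.1 * q.1, m.2 ++ q.2) | m <- L, q <- K]; split.
  apply/allP => _ /allpairsP[[m q] /= [mL qK ->]] /=.
  by rewrite size_cat (eqP (allP hL _ mL)) (eqP (allP hK _ qK)).
move=> w; rewrite big_allpairs_dep fL gK mulr_suml; apply: eq_bigr => m _.
by rewrite mulr_sumr; apply: eq_bigr => q _ /=; rewrite big_cat /=; ring.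
Qed.

Lemma hompoly_sum (J : finType) k (F : J -> T -> R) :
  (forall j, hompoly k (F j)) -> hompoly k (fun w => \sum_j F j w).
Proof.
move=> hF; elim: (index_enum J) => [|j s IH].
  by under eq_fun do rewrite big_nil; exact: hompoly0.
by under eq_fun do rewrite big_cons; exact: hompolyD.
Qed.

Lemma hompoly_var i : hompoly 1 (Z i).
Proof. by exists [:: (1, [:: i])]; split=> // w; rewrite !big_seq1 mul1r. Qed.

Definition hommx m n (k : nat) (F : T -> 'M[R]_(m, n)) :=
  forall i j, hompoly k (fun w => F w i j).

Lemma hommx_cst m n (A : 'M[R]_(m, n)) : hommx 0 (fun=> A).
Proof. by move=> i j; exact: hompoly_cst. Qed.

Lemma hommxD m n k (F G : T -> 'M[R]_(m, n)) :
  hommx k F -> hommx k G -> hommx k (fun w => F w + G w).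
Proof.
by move=> hF hG i j; under eq_fun do rewrite mxE; exact: hompolyD.
Qed.

Lemma hommxN m n k (F : T -> 'M[R]_(m, n)) : hommx k F -> hommx k (fun w => - F w).
Proof.
move=> hF i j; under eq_fun do rewrite mxE -mulN1r.
exact: hompolyZ.
Qed.

Lemma hommxB m n k (F G : T -> 'M[R]_(m, n)) :
  hommx k F -> hommx k G -> hommx k (fun w => F w - G w).
Proof. by move=> hF hG; apply: hommxD => //; exact: hommxN. Qed.

Lemma hommxT m n k (F : T -> 'M[R]_(m, n)) : hommx k F -> hommx k (fun w => (F w)^T).
Proof. by move=> hF i j; under eq_fun do rewrite mxE; exact: hF. Qed.

Lemma hommxM m n p k l (F : T -> 'M[R]_(m, n)) (G : T -> 'M[R]_(n, p)) :
  hommx k F -> hommx l G -> hommx (k + l) (fun w => F w *m G w).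
Proof.
move=> hF hG i j; under eq_fun do rewrite mxE.
by apply: hompoly_sum => u; exact: hompolyM.
Qed.

Lemma hompoly_tr n k (F : T -> 'M[R]_n) : hommx k F -> hompoly k (fun w => \tr (F w)).
Proof. by move=> hF; rewrite /mxtrace; apply: hompoly_sum => i; exact: hF. Qed.

Hypothesis indep : mutually_independent Z.
Hypothesis law : forall i B, measurable B ->
  distribution P (Z i) B = normal_prob 0 1 B.

Lemma hompoly_odd k f : odd k -> hompoly k f -> has_mean P f 0.
Proof.
move=> ok [L [hL fL]]; rewrite (funext fL) {f fL}.
elim: L hL => [_|m L IH /= /andP[mk hL]].
  by apply: has_mean_eq (has_mean_cst P 0) => // w; rewrite big_nil.
have hm : has_mean P (fun w => \prod_(i <- m.2) Z i w) 0.
  by apply: has_mean_odd_monomial => //; rewrite (eqP mk).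
apply: has_mean_eq (has_meanD (has_meanZ m.1 hm) (IH hL)) => [w|].
  by rewrite big_cons.
by rewrite mulr0 addr0.
Qed.

Section matrix_wick.
Variables (n : nat) (E : I -> 'M[R]_n).

(** A Gaussian random matrix with independent coordinates along the directions
    [E a]. *)
Definition gmx w : 'M[R]_n := \sum_a Z a w *: E a.
(** The mean of [X *m B *m X] for [X] the random matrix [gmx]. *)
Definition mxcov (B : 'M[R]_n) : 'M[R]_n := \sum_a E a *m B *m E a.

Lemma hommx_gmx : hommx 1 gmx.
Proof.
move=> i j; rewrite /gmx; under eq_fun do rewrite summxE.
apply: hompoly_sum => a; under eq_fun do rewrite mxE mulrC.
by apply: hompolyZ; exact: hompoly_var.
Qed.

Lemma mxcovE_tr (A B : 'M[R]_n) : \tr (A *m mxcov B) = \sum_a \tr (A *m E a *m B *m E a).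
Proof.
rewrite /mxcov mulmx_sumr raddf_sum; apply: eq_bigr => a _ /=.
by rewrite !mulmxA.
Qed.

Lemma expand_gmx w (A B : 'M[R]_n) :
  \tr (A *m gmx w *m B) = \sum_a Z a w * \tr (A *m E a *m B).
Proof.
rewrite /gmx mulmx_sumr mulmx_suml raddf_sum; apply: eq_bigr => a _ /=.
by rewrite -scalemxAr -scalemxAl mxtraceZ.
Qed.

Lemma delta_sum (a : I) (F : I -> R) : \sum_b (a == b)%:R * F b = F a.
Proof.
rewrite (bigD1 a) //= eqxx mul1r big1 ?addr0 // => b ba.
by rewrite eq_sym (negbTE ba) mul0r.
Qed.

Lemma has_mean_tr2 (A0 A1 : 'M[R]_n) :
  has_mean P (fun w => \tr (A0 *m gmx w *m A1 *m gmx w)) (\tr (A0 *m mxcov A1)).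
Proof.
apply: (@has_mean_eq _ _ _ P (fun w => \sum_a \sum_b
    (\tr (A0 *m E a *m A1 *m E b)) * (Z a w * Z b w))
  _ (\sum_a \sum_b (\tr (A0 *m E a *m A1 *m E b)) * (a == b)%:R)).
- move=> w; rewrite -mulmxA expand_gmx; apply: eq_bigr => a _.
  rewrite mulmxA -[X in \tr X]mulmx1 expand_gmx mulr_sumr; apply: eq_bigr => b _.
  by rewrite mulmx1; ring.
- rewrite mxcovE_tr; apply: eq_bigr => a _.
  by under eq_bigr do rewrite mulrC; rewrite delta_sum.
by do 2![apply: has_mean_sum => ?]; apply: has_meanZ; exact: has_mean_wick2.
Qed.

(** The three terms are the pairings 12|34, 13|24 and 14|23 of the four
    factors [gmx]. In the crossing pairing 13|24 one pair of directions [E b]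
    stays outside of [mxcov]. *)
Lemma has_mean_tr4 (A0 A1 A2 A3 : 'M[R]_n) :
  has_mean P
    (fun w => \tr (A0 *m gmx w *m A1 *m gmx w *m A2 *m gmx w *m A3 *m gmx w))
    (\tr (A0 *m mxcov A1 *m A2 *m mxcov A3)
     + \sum_b \tr (A0 *m mxcov (A1 *m E b *m A2) *m A3 *m E b)
     + \tr (A0 *m mxcov (A1 *m mxcov A2 *m A3))).
Proof.
pose t a b c e := \tr (A0 *m E a *m A1 *m E b *m A2 *m E c *m A3 *m E e).
apply: (@has_mean_eq _ _ _ P (fun w => \sum_a \sum_b \sum_c \sum_e
    t a b c e * (Z a w * Z b w * Z c w * Z e w))
  _ (\sum_a \sum_b \sum_c \sum_e t a b c e *
  (((a == b) && (c == e))%:R + ((a == c) && (b == e))%:R + ((a == e) && (b == c))%:R))).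
- move=> w.
  rewrite -!(mulmxA (A0 *m gmx w)) expand_gmx; apply: eq_bigr => a _.
  rewrite !mulmxA -!(mulmxA (A0 *m E a *m A1 *m gmx w)) expand_gmx mulr_sumr.
  apply: eq_bigr => b _.
  rewrite !mulmxA -!(mulmxA (A0 *m E a *m A1 *m E b *m A2 *m gmx w)) expand_gmx.
  rewrite !mulr_sumr; apply: eq_bigr => c _.
  rewrite !mulmxA -[X in \tr X]mulmx1 expand_gmx !mulr_sumr; apply: eq_bigr => e _.
  by rewrite mulmx1 /t; ring.
- transitivity (\sum_a \sum_c t a a c c + \sum_b \sum_a t a b a b + \sum_a \sum_b t a b b a).
    rewrite [\sum_b \sum_a t a b a b]exchange_big /= -!big_split /=.
    apply: eq_bigr => a _; rewrite -(delta_sum a (fun b => \sum_c t a b c c)) -!big_split /=.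
    apply: eq_bigr => b _.
    rewrite -(delta_sum a (fun c => t a b c b)) -(delta_sum b (fun c => t a b c a)).
    rewrite mulr_sumr -!big_split /=; apply: eq_bigr => c _.
    rewrite -(delta_sum c (fun e => t a b c e)) -(delta_sum b (fun e => t a b c e)).
    rewrite -(delta_sum a (fun e => t a b c e)) !mulr_sumr -!big_split /=.
    by apply: eq_bigr => e _; rewrite -!mulnb !natrM; ring.
  congr (_ + _ + _).
  + rewrite [A0 *m mxcov A1]mulmx_sumr !mulmx_suml raddf_sum.
    apply: eq_bigr => a _ /=; rewrite mxcovE_tr; apply: eq_bigr => c _.
    by rewrite /t !mulmxA.
  + apply: eq_bigr => b _; rewrite [A0 *m mxcov _]mulmx_sumr !mulmx_suml raddf_sum.
    by apply: eq_bigr => a _ /=; rewrite /t !mulmxA.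
  + rewrite mxcovE_tr; apply: eq_bigr => a _.
    rewrite /mxcov !(mulmx_suml, mulmx_sumr) raddf_sum.
    by apply: eq_bigr => b _ /=; rewrite /t !mulmxA.
by do 4![apply: has_mean_sum => ?]; apply: has_meanZ; exact: has_mean_wick4.
Qed.

End matrix_wick.

End homogeneous.

(** * Operator norm bounds *)

Section operator_bound.
Context {R : realType}.

Definition dotv n (x y : 'cV[R]_n) : R := \sum_i x i 0 * y i 0.
Definition sqn n (x : 'cV[R]_n) : R := dotv x x.

Lemma dotvE n (x y : 'cV[R]_n) : dotv x y = (x^T *m y) 0 0.
Proof. by rewrite mxE; apply: eq_bigr => i _; rewrite mxE. Qed.

Lemma dotvC n (x y : 'cV[R]_n) : dotv x y = dotv y x.
Proof. by apply: eq_bigr => i _; rewrite mulrC. Qed.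

Lemma dotvDl n (x y z : 'cV[R]_n) : dotv (x + y) z = dotv x z + dotv y z.
Proof. by rewrite -big_split; apply: eq_bigr => i _; rewrite mxE mulrDl. Qed.

Lemma dotvDr n (x y z : 'cV[R]_n) : dotv z (x + y) = dotv z x + dotv z y.
Proof. by rewrite ![dotv z _]dotvC dotvDl. Qed.

Lemma dotvZl n c (x y : 'cV[R]_n) : dotv (c *: x) y = c * dotv x y.
Proof. by rewrite mulr_sumr; apply: eq_bigr => i _; rewrite mxE mulrA. Qed.

Lemma dotvZr n c (x y : 'cV[R]_n) : dotv x (c *: y) = c * dotv x y.
Proof. by rewrite dotvC dotvZl dotvC. Qed.

Lemma dotvM m n (A : 'M[R]_(m, n)) x y : dotv (A *m x) y = dotv x (A^T *m y).
Proof. by rewrite !dotvE trmx_mul mulmxA. Qed.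

Lemma dotv_col m n (x x' : 'cV[R]_m) (y y' : 'cV[R]_n) :
  dotv (col_mx x y) (col_mx x' y') = dotv x x' + dotv y y'.
Proof.
rewrite /dotv big_split_ord /=; congr (_ + _); apply: eq_bigr => i _.
  by rewrite !col_mxEu.
by rewrite !col_mxEd.
Qed.

Lemma sqn_ge0 n (x : 'cV[R]_n) : 0 <= sqn x.
Proof. by apply: sumr_ge0 => i _; rewrite -expr2 sqr_ge0. Qed.

Lemma sqn_eq0 n (x : 'cV[R]_n) : (sqn x == 0) = (x == 0).
Proof.
apply/eqP/eqP => [h|->]; last by rewrite /sqn /dotv big1 // => i _; rewrite mxE mulr0.
apply/colP => i; rewrite mxE; apply/eqP; rewrite -sqrf_eq0 expr2.
apply/eqP; apply: (psumr_eq0P _ h) => // j _.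
by rewrite -expr2 sqr_ge0.
Qed.

Lemma sqnD n (x y : 'cV[R]_n) : sqn (x + y) = sqn x + 2 * dotv x y + sqn y.
Proof. by rewrite /sqn dotvDl !dotvDr (dotvC y x); ring. Qed.

Lemma sqnZ n c (x : 'cV[R]_n) : sqn (c *: x) = c ^+ 2 * sqn x.
Proof. by rewrite /sqn dotvZl dotvZr mulrA. Qed.

(** Lagrange's identity: twice the difference of the two sides is the sum of
    the squares of [x_i y_j - x_j y_i]. *)
Lemma cauchy_schwarz n (x y : 'cV[R]_n) : dotv x y ^+ 2 <= sqn x * sqn y.
Proof.
have h : 0 <= \sum_i \sum_j (x i 0 * y j 0 - x j 0 * y i 0) ^+ 2.
  by apply: sumr_ge0 => i _; apply: sumr_ge0 => j _; exact: sqr_ge0.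
have e : \sum_i \sum_j (x i 0 * y j 0 - x j 0 * y i 0) ^+ 2
    = sqn x * sqn y + sqn y * sqn x - 2 * (dotv x y * dotv x y).
  rewrite /sqn /dotv !mulr_suml mulr_sumr -sumrN -!big_split /=; apply: eq_bigr => i _.
  rewrite !mulr_sumr -sumrN -!big_split /=; apply: eq_bigr => j _; ring.
by rewrite expr2; move: h; rewrite e [sqn y * _]mulrC; lra.
Qed.

Lemma dotv_le n (x y : 'cV[R]_n) p q : 0 <= p -> 0 <= q ->
  sqn x <= p ^+ 2 -> sqn y <= q ^+ 2 -> `|dotv x y| <= p * q.
Proof.
move=> p0 q0 xp yq; have pq : 0 <= p * q by exact: mulr_ge0.
rewrite -ler_sqr ?nnegrE // real_normK ?num_real //.
rewrite exprMn; apply: le_trans (cauchy_schwarz x y) _.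
by apply: ler_pM => //; exact: sqn_ge0.
Qed.

Lemma sqnD_le n (x y : 'cV[R]_n) p q : 0 <= p -> 0 <= q ->
  sqn x <= p ^+ 2 -> sqn y <= q ^+ 2 -> sqn (x + y) <= (p + q) ^+ 2.
Proof.
move=> p0 q0 xp yq; rewrite sqnD.
by have := dotv_le p0 q0 xp yq; rewrite ler_norml => /andP[_ h]; rewrite sqrrD; lra.
Qed.

(** The operator norm of [A] is at most [c]. Avoiding the supremum reduces all
    norm estimates to the rules of composition below. *)
Definition opb m n (c : R) (A : 'M[R]_(m, n)) :=
  0 <= c /\ forall x, sqn (A *m x) <= c ^+ 2 * sqn x.

Lemma opb_le m n c c' (A : 'M[R]_(m, n)) : c <= c' -> opb c A -> opb c' A.
Proof.
move=> cc [c0 hA]; have c'0 := le_trans c0 cc; split=> // x.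
apply: le_trans (hA x) _; apply: ler_wpM2r; first exact: sqn_ge0.
by rewrite ler_sqr ?nnegrE.
Qed.

Lemma opbD m n a b (A B : 'M[R]_(m, n)) : opb a A -> opb b B -> opb (a + b) (A + B).
Proof.
move=> [a0 hA] [b0 hB]; split=> [|x]; first exact: addr_ge0.
rewrite mulmxDl -(sqr_sqrtr (sqn_ge0 x)) -exprMn mulrDl.
have s0 := sqrtr_ge0 (sqn x).
apply: sqnD_le; rewrite ?mulr_ge0 // exprMn sqr_sqrtr ?sqn_ge0 //.
Qed.

Lemma opbN m n a (A : 'M[R]_(m, n)) : opb a A -> opb a (- A).
Proof.
move=> [a0 hA]; split=> // x; rewrite mulNmx -scaleN1r sqnZ sqrrN expr1n mul1r.
exact: hA.
Qed.

Lemma opbB m n a b (A B : 'M[R]_(m, n)) : opb a A -> opb b B -> opb (a + b) (A - B).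
Proof. by move=> hA /opbN; exact: opbD. Qed.

Lemma opbM m n p a b (A : 'M[R]_(m, n)) (B : 'M[R]_(n, p)) :
  opb a A -> opb b B -> opb (a * b) (A *m B).
Proof.
move=> [a0 hA] [b0 hB]; split=> [|x]; first exact: mulr_ge0.
rewrite -mulmxA exprMn -mulrA; apply: le_trans (hA _) _.
by apply: ler_wpM2l => //; exact: sqr_ge0.
Qed.

(** If [s] is the squared norm of [A^T x], then [s = <x, A A^T x>], so
    [s ^ 2 <= |x|^2 a^2 s] by Cauchy-Schwarz. *)
Lemma opbT m n a (A : 'M[R]_(m, n)) : opb a A -> opb a A^T.
Proof.
move=> [a0 hA]; split=> // x; set s := sqn _.
have [s0|s0] := leP s 0; first by rewrite (le_trans s0) // mulr_ge0 ?sqr_ge0 ?sqn_ge0.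
have : s ^+ 2 <= sqn x * (a ^+ 2 * s).
  have -> : s ^+ 2 = dotv x (A *m (A^T *m x)) ^+ 2.
    by rewrite /s /sqn dotvM trmxK.
  apply: le_trans (cauchy_schwarz _ _) _.
  by apply: ler_wpM2l; [exact: sqn_ge0 | exact: hA].
by rewrite expr2 mulrA ler_pM2r // mulrC.
Qed.

Lemma opb1 n : opb 1 (1%:M : 'M[R]_n).
Proof. by split=> // x; rewrite mul1mx expr1n mul1r. Qed.

Lemma sqr_form n (A : 'M[R]_n) (x : 'cV[R]_n) : A^T = A -> A *m A = A ->
  dotv x (A *m x) = sqn (A *m x).
Proof. by move=> At AA; rewrite /sqn dotvM At mulmxA AA. Qed.

(** The difference of the squared norms of [x] and [A x] is the squared norm
    of [x - A x]. *)
Lemma opb_proj n (A : 'M[R]_n) : A^T = A -> A *m A = A -> opb 1 A.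
Proof.
move=> At AA; split=> // x; rewrite expr1n mul1r.
set B := 1%:M - A.
have Bt : B^T = B by rewrite /B linearB /= trmx1 At.
have BB : B *m B = B.
  by rewrite /B mulmxBl !mulmxBr !mul1mx mulmx1 AA subrr subr0.
rewrite -(sqr_form x At AA) -subr_ge0.
have -> : sqn x - dotv x (A *m x) = sqn (B *m x).
  rewrite -(sqr_form x Bt BB) /B mulmxBl mul1mx.
  by rewrite -[- (A *m x)]scaleN1r dotvDr dotvZr mulN1r.
exact: sqn_ge0.
Qed.

End operator_bound.

(** * Order by order expansion of a perturbed projection *)

Lemma addmxE (R : realType) m n (A B : 'M[R]_(m, n)) i j : (A + B) i j = A i j + B i j.
Proof. by rewrite mxE. Qed.
Lemma oppmxE (R : realType) m n (A : 'M[R]_(m, n)) i j : (- A) i j = - A i j.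
Proof. by rewrite mxE. Qed.
Lemma trmxD (R : realType) m n (A B : 'M[R]_(m, n)) : (A + B)^T = A^T + B^T.
Proof. by rewrite linearD. Qed.
Lemma trmxN (R : realType) m n (A : 'M[R]_(m, n)) : (- A)^T = - A^T.
Proof. by rewrite linearN. Qed.

Lemma mx0E (R : realType) m n i j : (0 : 'M[R]_(m, n)) i j = 0.
Proof. by rewrite mxE. Qed.

(** Matrix identities that hold by distributivity: after expansion the
    products of matrices are atoms, and [ring] concludes entry by entry. *)
Ltac mxlin := apply/matrixP => ? ?;
  rewrite ?(trmxD, trmxN, mulmxDl, mulmxDr, mulNmx, mulmxN, mul0mx, mulmx0);
  rewrite ?(addmxE, oppmxE, mx0E); ring.

Lemma gram_split (R : realType) n (E S r : 'M[R]_n) : E = S + r ->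
  E^T *m E = S^T *m S + (r^T *m E + S^T *m r).
Proof. by move=> ->; mxlin. Qed.

Lemma sqr_split (R : realType) n (G S r : 'M[R]_n) : G = S + r ->
  G *m G = S *m S + (r *m G + S *m r).
Proof. by move=> ->; mxlin. Qed.

Lemma gram4 (R : realType) n (a b c e : 'M[R]_n) :
  (a + b + c + e)^T *m (a + b + c + e) =
  (a^T *m a) + (a^T *m b + b^T *m a) + (a^T *m c + b^T *m b + c^T *m a)
  + (a^T *m e + b^T *m c + c^T *m b + e^T *m a)
  + (b^T *m e + c^T *m c + e^T *m b + c^T *m e + e^T *m c + e^T *m e).
Proof. by mxlin. Qed.

Lemma sqr2 (R : realType) n (a b : 'M[R]_n) :
  (a + b) *m (a + b) = a *m a + a *m b + b *m a + b *m b.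
Proof. by mxlin. Qed.

(** If [a], [b], [c], [e] have orders 1 to 4 and approximate [E], and [g2],
    [g3] have orders 2 and 3 and approximate [G], the parenthesis on the right
    collects the terms of order at most 5 of [E^T *m E + G *m G]; every term
    on the left has order at least 6. *)
Lemma gram_remainder (R : realType) n (E G a b c e g2 g3 : 'M[R]_n) :
  G = E^T *m E + G *m G -> g2 = a^T *m a -> g3 = a^T *m b + b^T *m a ->
  b^T *m e + c^T *m c + e^T *m b + c^T *m e + e^T *m c + e^T *m e
  + (E - a - b - c - e)^T *m E + (a + b + c + e)^T *m (E - a - b - c - e)
  + g3 *m g3 + (G - g2 - g3) *m G + (g2 + g3) *m (G - g2 - g3)
  = G - (g2 + g3 + (a^T *m c + b^T *m b + c^T *m a + g2 *m g2)
    + (a^T *m e + b^T *m c + c^T *m b + e^T *m a + g2 *m g3 + g3 *m g2)).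
Proof.
move=> eqG e2 e3.
have eE : E = (a + b + c + e) + (E - a - b - c - e) by mxlin.
have eG : G = (g2 + g3) + (G - g2 - g3) by mxlin.
rewrite [in RHS]eqG (gram_split eE) (sqr_split eG) (gram4 a b c e) (sqr2 g2 g3).
rewrite -e2 -e3; move: (E - _ - _ - _ - _) (G - _ - _) => r rG.
by apply/matrixP => i j; rewrite !(addmxE, oppmxE); ring.
Qed.

Section expansion_terms.
Context {R : realType} {n : nat}.
Implicit Types (W P X Y g h : 'M[R]_n).

(** The terms of the equation [proj_eqE] for [W Ph Pi] that come after
    [W X P]; each has one factor [X] more than its argument. *)
Definition pstep W P X Y g h : 'M[R]_n :=
  W *m X *m Y *m P - W *m X *m g *m P - Y *m X *m P - h *m X *m P.

(** In the next definitions [pEk], [pGk], [pHk] are the parts of degree [k] in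
    [X] of the formal solution of [proj_eqE], [proj_eqG], [proj_eqH]. [E]
    starts in degree 1, [G] and [H] in degree 2. *)
Definition pE1 W P X := W *m X *m P.
Definition pE2 W P X := W *m X *m pE1 W P X *m P - pE1 W P X *m X *m P.
Definition pG2 W P X := (pE1 W P X)^T *m pE1 W P X.
Definition pH2 W P X := pE1 W P X *m (pE1 W P X)^T.
Definition pE3 W P X := pstep W P X (pE2 W P X) (pG2 W P X) (pH2 W P X).
Definition pG3 W P X := (pE1 W P X)^T *m pE2 W P X + (pE2 W P X)^T *m pE1 W P X.
Definition pH3 W P X := pE1 W P X *m (pE2 W P X)^T + pE2 W P X *m (pE1 W P X)^T.
Definition pE4 W P X := pstep W P X (pE3 W P X) (pG3 W P X) (pH3 W P X).
Definition pG4 W P X := (pE1 W P X)^T *m pE3 W P X + (pE2 W P X)^T *m pE2 W P X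
  + (pE3 W P X)^T *m pE1 W P X + pG2 W P X *m pG2 W P X.
Definition pG5 W P X := (pE1 W P X)^T *m pE4 W P X + (pE2 W P X)^T *m pE3 W P X
  + (pE3 W P X)^T *m pE2 W P X + (pE4 W P X)^T *m pE1 W P X
  + pG2 W P X *m pG3 W P X + pG3 W P X *m pG2 W P X.

End expansion_terms.

Section expansion.
Context {R : realType} {n : nat}.
Variables (W P X : 'M[R]_n) (e : R).
Hypotheses (e0 : 0 <= e).
Hypothesis stepl : forall c (Y : 'M[R]_n), opb c Y -> opb (c * e) (W *m X *m Y *m P).
Hypothesis stepr : forall c (Y : 'M[R]_n), opb c Y -> opb (c * e) (Y *m X *m P).

(** Order [k] in the small parameter [e], with an explicit constant. *)
Definition ordb (c : R) (k : nat) (A : 'M[R]_n) := opb (c * e ^+ k) A.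

Lemma ordb_eq c c' k A A' : A = A' -> c = c' -> ordb c k A -> ordb c' k A'.
Proof. by move=> -> ->. Qed.

Lemma ordb_le c c' k A : c <= c' -> ordb c k A -> ordb c' k A.
Proof. by move=> cc; apply: opb_le; rewrite ler_wpM2r // exprn_ge0. Qed.

Lemma ordbD a b k A B : ordb a k A -> ordb b k B -> ordb (a + b) k (A + B).
Proof. by rewrite /ordb mulrDl; exact: opbD. Qed.

Lemma ordbM a b k l A B : ordb a k A -> ordb b l B -> ordb (a * b) (k + l) (A *m B).
Proof. by move=> hA hB; have := opbM hA hB; rewrite mulrACA -exprD. Qed.

Lemma ordbT a k A : ordb a k A -> ordb a k A^T.
Proof. exact: opbT. Qed.

Lemma ordb_step a b c k Y g h : ordb a k Y -> ordb b k g -> ordb c k h ->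
  ordb (a + b + a + c) k.+1 (pstep W P X Y g h).
Proof.
rewrite /ordb !exprSr => hY hg hh; rewrite !mulrDl !mulrA.
by do !apply: opbB; rewrite ?(stepl, stepr) //; [exact: stepl|exact: stepl|exact: stepr|exact: stepr].
Qed.

Let E1 := pE1 W P X. Let E2 := pE2 W P X. Let E3 := pE3 W P X. Let E4 := pE4 W P X.
Let G2 := pG2 W P X. Let G3 := pG3 W P X. Let G4 := pG4 W P X. Let G5 := pG5 W P X.
Let H2 := pH2 W P X. Let H3 := pH3 W P X.

Lemma ordb_E1 : ordb 1 1 E1.
Proof. by have := stepl (opb1 n); rewrite /E1 /pE1 mulmx1 /ordb expr1. Qed.

Lemma ordb_E2 : ordb 2 2 E2.
Proof.
have h := ordb_E1; rewrite /ordb expr1 in h.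
by apply: opb_le (opbB (stepl h) (stepr h)); rewrite expr2; lra.
Qed.

Lemma ordb_G2 : ordb 1 2 G2.
Proof. by have h := ordb_E1; apply: ordb_eq (ordbM (ordbT h) h); rewrite ?mulr1. Qed.

Lemma ordb_H2 : ordb 1 2 H2.
Proof. by have h := ordb_E1; apply: ordb_eq (ordbM h (ordbT h)); rewrite ?mulr1. Qed.

Lemma ordb_E3 : ordb 6 3 E3.
Proof. by apply: ordb_eq (ordb_step ordb_E2 ordb_G2 ordb_H2) => //; ring. Qed.

Lemma ordb_G3 : ordb 4 3 G3.
Proof.
apply: ordb_eq (ordbD (ordbM (ordbT ordb_E1) ordb_E2) (ordbM (ordbT ordb_E2) ordb_E1)) => //.
by ring.
Qed.

Lemma ordb_H3 : ordb 4 3 H3.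
Proof.
apply: ordb_eq (ordbD (ordbM ordb_E1 (ordbT ordb_E2)) (ordbM ordb_E2 (ordbT ordb_E1))) => //.
by ring.
Qed.

Lemma ordb_E4 : ordb 20 4 E4.
Proof. by apply: ordb_eq (ordb_step ordb_E3 ordb_G3 ordb_H3) => //; ring. Qed.

Lemma ordb_G4 : ordb 17 4 G4.
Proof.
apply: ordb_eq (ordbD (ordbD (ordbD (ordbM (ordbT ordb_E1) ordb_E3)
  (ordbM (ordbT ordb_E2) ordb_E2)) (ordbM (ordbT ordb_E3) ordb_E1)) (ordbM ordb_G2 ordb_G2)) => //.
by ring.
Qed.

Lemma ordb_G5 : ordb 72 5 G5.
Proof.
apply: ordb_eq (ordbD (ordbD (ordbD (ordbD (ordbD (ordbM (ordbT ordb_E1) ordb_E4)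
  (ordbM (ordbT ordb_E2) ordb_E3)) (ordbM (ordbT ordb_E3) ordb_E2))
  (ordbM (ordbT ordb_E4) ordb_E1)) (ordbM ordb_G2 ordb_G3)) (ordbM ordb_G3 ordb_G2)) => //.
by ring.
Qed.

(** Bootstrap: bounds on the remainders of [E], [G], [H] at one order,
    substituted in the equations, give bounds on the remainders at the next
    order, because [pstep] gains a factor [e] and the other terms are
    quadratic. Each constant is the sum of those of the terms. *)
Section remainder.
Hypothesis e1 : e <= 1.

Lemma ordb_weaken a k l A : 0 <= a -> (l <= k)%N -> ordb a k A -> ordb a l A.
Proof.
by move=> a0 lk; apply: opb_le; rewrite ler_wpM2l // ler_wiXn2l.
Qed.

Variables (E G H : 'M[R]_n).
Hypotheses (OE : ordb 2 1 E) (OG : ordb 4 2 G) (OH : ordb 4 2 H).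
Hypothesis eqE : E = E1 + pstep W P X E G H.
Hypothesis eqG : G = E^T *m E + G *m G.
Hypothesis eqH : H = E *m E^T + H *m H.

Lemma rest_E1 : ordb 12 2 (E - E1).
Proof.
have OG1 : ordb 4 1 G by apply: ordb_weaken OG.
have OH1 : ordb 4 1 H by apply: ordb_weaken OH.
apply: ordb_eq (ordb_step OE OG1 OH1) => //; last by ring.
by rewrite {2}eqE addrC addKr.
Qed.

Lemma pstepB Y Y' g g' h h' :
  pstep W P X Y g h - pstep W P X Y' g' h' = pstep W P X (Y - Y') (g - g') (h - h').
Proof. by rewrite /pstep; mxlin. Qed.

Lemma rest_G2 : ordb 52 3 (G - G2).
Proof.
have O3 : ordb 16 3 (G *m G).
  by apply: ordb_weaken (isT : (3 <= 4)%N) _ => //; apply: ordb_eq (ordbM OG OG) => //; ring.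
have h := ordbD O3
  (ordbD (ordbM (ordbT rest_E1) OE) (ordbM (ordbT ordb_E1) rest_E1)).
apply: ordb_eq h => //; last by ring.
by rewrite [in RHS]eqG /G2 /pG2 -/E1; mxlin.
Qed.

Lemma rest_H2 : ordb 52 3 (H - H2).
Proof.
have O3 : ordb 16 3 (H *m H).
  by apply: ordb_weaken (isT : (3 <= 4)%N) _ => //; apply: ordb_eq (ordbM OH OH) => //; ring.
have h := ordbD O3
  (ordbD (ordbM rest_E1 (ordbT OE)) (ordbM ordb_E1 (ordbT rest_E1))).
apply: ordb_eq h => //; last by ring.
by rewrite [in RHS]eqH /H2 /pH2 -/E1; mxlin.
Qed.

Lemma rest_E2 : ordb 32 3 (E - E1 - E2).
Proof.
apply: ordb_eq (ordb_step rest_E1 OG OH) => //; last by ring.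
rewrite {2}eqE [E1 + _]addrC addrK.
have -> : E2 = pstep W P X E1 0 0 by rewrite /pstep /E2 /pE2 -/E1; mxlin.
by rewrite pstepB !subr0.
Qed.

Lemma rest_E3 : ordb 168 4 (E - E1 - E2 - E3).
Proof.
apply: ordb_eq (ordb_step rest_E2 rest_G2 rest_H2) => //; last by ring.
rewrite -[in RHS]addrA -opprD [in RHS]eqE [E1 + _ - _]addrAC subrr add0r.
have -> : E2 = pstep W P X E1 0 0 by rewrite /pstep /E2 /pE2 -/E1; mxlin.
rewrite /E3 /pE3 -/E2 -/G2 -/H2.
rewrite opprD addrA pstepB pstepB !subr0.
have -> // : E2 = pstep W P X E1 0 0 by rewrite /pstep /E2 /pE2 -/E1; mxlin.
Qed.

Lemma ordb_E12 : ordb 3 1 (E1 + E2).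
Proof.
have h2 : ordb 2 1 E2 by apply: ordb_weaken ordb_E2.
by apply: ordb_eq (ordbD ordb_E1 h2) => //; ring.
Qed.

Lemma rest_G3 : ordb 180 4 (G - G2 - G3).
Proof.
have h := ordbD (ordbM OG OG) (ordbD (ordbM (ordbT ordb_E2) ordb_E2)
  (ordbD (ordbM (ordbT rest_E2) OE) (ordbM (ordbT ordb_E12) rest_E2))).
apply: ordb_eq h => //; last by ring.
by rewrite [in RHS]eqG /G2 /pG2 /G3 /pG3 -/E1 -/E2; mxlin.
Qed.

Lemma rest_H3 : ordb 180 4 (H - H2 - H3).
Proof.
have h := ordbD (ordbM OH OH) (ordbD (ordbM ordb_E2 (ordbT ordb_E2))
  (ordbD (ordbM rest_E2 (ordbT OE)) (ordbM ordb_E12 (ordbT rest_E2)))).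
apply: ordb_eq h => //; last by ring.
by rewrite [in RHS]eqH /H2 /pH2 /H3 /pH3 -/E1 -/E2; mxlin.
Qed.

Lemma rest_E4 : ordb 696 5 (E - E1 - E2 - E3 - E4).
Proof.
apply: ordb_eq (ordb_step rest_E3 rest_G3 rest_H3) => //; last by ring.
have e2 : E2 = pstep W P X E1 0 0 by rewrite /pstep /E2 /pE2 -/E1; mxlin.
have e3 : E3 = pstep W P X E2 G2 H2 by [].
have e4 : E4 = pstep W P X E3 G3 H3 by [].
have -> : E - E1 - E2 - E3 - E4 = pstep W P X E G H - pstep W P X E1 0 0
    - pstep W P X E2 G2 H2 - pstep W P X E3 G3 H3.
  by rewrite -e2 -e3 -e4 -[pstep _ _ _ _ _ _](addKr E1) -eqE; mxlin.
by rewrite !pstepB !subr0.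
Qed.

(** The part of [G] of degree at most 5. *)
Definition pG W P X : 'M[R]_n := pG2 W P X + pG3 W P X + pG4 W P X + pG5 W P X.

Lemma rest_G5 : ordb (240 * 100) 6 (G - pG W P X).
Proof.
have h34 : ordb 20 4 E4 by exact: ordb_E4.
have w k l c A : 0 <= c -> (l <= k)%N -> ordb c k A -> ordb c l A by exact: ordb_weaken.
have OS : ordb 29 1 (E1 + E2 + E3 + E4).
  have h2 : ordb 2 1 E2 by apply: w ordb_E2.
  have h3 : ordb 6 1 E3 by apply: w ordb_E3.
  have h4 : ordb 20 1 E4 by apply: w ordb_E4.
  by apply: ordb_eq (ordbD (ordbD (ordbD ordb_E1 h2) h3) h4) => //; ring.
have OG23 : ordb 5 2 (G2 + G3).
  have h3 : ordb 4 2 G3 by apply: w ordb_G3.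
  by apply: ordb_eq (ordbD ordb_G2 h3) => //; ring.
have t1 := ordbM (ordbT ordb_E2) ordb_E4.
have t2 := ordbM (ordbT ordb_E3) ordb_E3.
have t3 := ordbM (ordbT ordb_E4) ordb_E2.
have t4 : ordb (6 * 20) 6 (E3^T *m E4).
  by apply: (w 7%N) (ordbM (ordbT ordb_E3) ordb_E4); rewrite ?mulr_ge0.
have t5 : ordb (20 * 6) 6 (E4^T *m E3).
  by apply: (w 7%N) (ordbM (ordbT ordb_E4) ordb_E3); rewrite ?mulr_ge0.
have t6 : ordb (20 * 20) 6 (E4^T *m E4).
  by apply: (w 8%N) (ordbM (ordbT ordb_E4) ordb_E4); rewrite ?mulr_ge0.
have t7 := ordbM (ordbT rest_E4) OE.
have t8 := ordbM (ordbT OS) rest_E4.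
have t9 := ordbM ordb_G3 ordb_G3.
have t10 := ordbM rest_G3 OG.
have t11 := ordbM OG23 rest_G3.
have h := ordbD (ordbD (ordbD (ordbD (ordbD (ordbD (ordbD (ordbD (ordbD (ordbD
  t1 t2) t3) t4) t5) t6) t7) t8) t9) t10) t11.
(* The eleven constants add up to 23968. *)
apply: ordb_le (ordb_eq _ erefl h); first by lra.
exact: gram_remainder.
Qed.

End remainder.
End expansion.

(** * Spectral calculus of the symmetrized signal *)

Lemma trmxZ (R : realType) m n (c : R) (A : 'M[R]_(m, n)) : (c *: A)^T = c *: A^T.
Proof. by rewrite linearZ. Qed.

Lemma sum_block_mx (R : realType) m1 m2 n1 n2 (I : Type) (s : seq I)
  (A : I -> 'M[R]_(m1, n1)) (B : I -> 'M[R]_(m1, n2)) (C : I -> 'M[R]_(m2, n1))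
  (D : I -> 'M[R]_(m2, n2)) :
  \sum_(i <- s) block_mx (A i) (B i) (C i) (D i)
  = block_mx (\sum_(i <- s) A i) (\sum_(i <- s) B i) (\sum_(i <- s) C i) (\sum_(i <- s) D i).
Proof.
elim: s => [|i s IH]; first by rewrite !big_nil block_mx0.
by rewrite !big_cons IH add_block_mx.
Qed.

Section signal.
Context {R : realType} {d1 d2 r : nat}.
Variables (U : 'M[R]_(d1, r)) (lam : 'rV[R]_r) (V : 'M[R]_(d2, r)).
Hypotheses (UU : U^T *m U = 1%:M) (VV : V^T *m V = 1%:M).
Local Notation n := (d1 + d2)%N.

(** The matrices that are diagonal in the orthonormal system [theta]. The
    signal, the projection [Theta Theta^T] and all [frakP k.+1] are of this
    form, and their products, traces and norms are read off from [f]. *)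
Definition spec (f : bool -> 'I_r -> R) : 'M[R]_n :=
  \sum_(b : bool) \sum_(i < r) f b i *: (theta U V b i *m (theta U V b i)^T).

(** The symmetry that exchanges [theta_i] and [theta_{-i}]: it commutes with
    the even functions of the signal and anticommutes with the odd ones. *)
Definition flip : 'M[R]_n := block_mx 1%:M 0 0 (- 1%:M).

Lemma gram_col m (A : 'M[R]_(m, r)) i j : A^T *m A = 1%:M ->
  (col i A)^T *m col j A = (i == j)%:R%:M.
Proof.
move=> AA; have := congr1 (fun M : 'M[R]_r => M i j) AA; rewrite !mxE => <-.
by apply/matrixP => a b; rewrite !ord1 !mxE; apply: eq_bigr => k _; rewrite !mxE.
Qed.

Lemma sqrt2V2 : (Num.sqrt 2)^-1 * (Num.sqrt 2)^-1 = 2^-1 :> R.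
Proof. by rewrite -invfM -expr2 sqr_sqrtr. Qed.

Lemma theta_dot b i c j :
  (theta U V b i)^T *m theta U V c j = ((b == c) && (i == j))%:R%:M.
Proof.
rewrite /theta trmxZ tr_col_mx trmxZ -scalemxAl -scalemxAr scalerA sqrt2V2.
rewrite mul_row_col -scalemxAl -scalemxAr !gram_col // scalerA.
apply/matrixP => x y; rewrite !ord1 !mxE /= !mulr1n.
by case: b; case: c; case: (i == j); rewrite /= ?expr1 ?expr0; field.
Qed.

Lemma specM f g : spec f *m spec g = spec (fun b i => f b i * g b i).
Proof.
rewrite /spec mulmx_suml; apply: eq_bigr => b _; rewrite mulmx_suml; apply: eq_bigr => i _.
rewrite mulmx_sumr (bigD1 b) //= [X in _ + X]big1 ?addr0 => [|c cb].
  rewrite mulmx_sumr (bigD1 i) //= big1 ?addr0 => [|j ji].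
    rewrite -scalemxAl -scalemxAr scalerA mulmxA -(mulmxA (theta _ _ _ _)) theta_dot.
    by rewrite !eqxx mulmx1.
  rewrite -scalemxAl -scalemxAr mulmxA -(mulmxA (theta _ _ _ _)) theta_dot.
  by rewrite eqxx (eq_sym i) (negbTE ji) mul_mx_scalar scale0r mul0mx !scaler0.
rewrite mulmx_sumr big1 // => j _.
rewrite -scalemxAl -scalemxAr mulmxA -(mulmxA (theta _ _ _ _)) theta_dot.
by rewrite (eq_sym b) (negbTE cb) mul_mx_scalar scale0r mul0mx !scaler0.
Qed.

Lemma eq_spec f g : (forall b i, f b i = g b i) -> spec f = spec g.
Proof. by move=> fg; apply: eq_bigr => b _; apply: eq_bigr => i _; rewrite fg. Qed.

Lemma specT f : (spec f)^T = spec f.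
Proof.
rewrite /spec linear_sum; apply: eq_bigr => b _; rewrite linear_sum; apply: eq_bigr => i _.
by rewrite /= trmxZ trmx_mul trmxK.
Qed.

Lemma tr_spec f : \tr (spec f) = \sum_(b : bool) \sum_(i < r) f b i.
Proof.
rewrite /spec raddf_sum; apply: eq_bigr => b _; rewrite raddf_sum; apply: eq_bigr => i _ /=.
by rewrite mxtraceZ mxtrace_mulC theta_dot !eqxx mxtrace1 mulr1.
Qed.

Lemma flip_theta b i : flip *m theta U V b i = theta U V (~~ b) i.
Proof.
rewrite /flip /theta -scalemxAr mul_block_col !mul0mx addr0 add0r mul1mx mulNmx mul1mx.
by congr (_ *: col_mx _ _); rewrite -scaleNr; case: b; rewrite /= ?expr1 ?expr0 ?opprK.
Qed.

Lemma flipT : flip^T = flip.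
Proof. by rewrite /flip tr_block_mx !trmx0 linearN /= !trmx1. Qed.

Lemma flipK : flip *m flip = 1%:M.
Proof.
rewrite /flip mulmx_block !mul0mx !mulmx0 !addr0 add0r mulmx1 mulNmx mulmxN mulmx1 opprK.
by rewrite -scalar_mx_block.
Qed.

Lemma flip_spec f : flip *m spec f *m flip = spec (fun b i => f (~~ b) i).
Proof.
transitivity (\sum_(b : bool) \sum_(i < r) f b i *:
  (theta U V (~~ b) i *m (theta U V (~~ b) i)^T)).
  rewrite /spec mulmx_sumr mulmx_suml; apply: eq_bigr => b _.
  rewrite mulmx_sumr mulmx_suml; apply: eq_bigr => i _.
  by rewrite -scalemxAr -scalemxAl -flip_theta trmx_mul flipT !mulmxA.
by rewrite /spec !big_bool /= addrC.
Qed.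

(** [flip] maps each [theta] to an orthogonal one. *)
Lemma tr_flip_spec f : \tr (flip *m spec f) = 0.
Proof.
rewrite /spec mulmx_sumr raddf_sum big1 // => b _.
rewrite /= mulmx_sumr raddf_sum big1 // => i _ /=.
rewrite -scalemxAr mxtraceZ mulmxA flip_theta mxtrace_mulC theta_dot.
by rewrite mxtrace_scalar; case: b; rewrite /= mulr0.
Qed.

Lemma theta_outer b i : theta U V b i *m (theta U V b i)^T
 = 2^-1 *: block_mx (col i U *m (col i U)^T) ((-1) ^+ b *: (col i U *m (col i V)^T))
     ((-1) ^+ b *: (col i V *m (col i U)^T)) (col i V *m (col i V)^T).
Proof.
rewrite /theta trmxZ -scalemxAl -scalemxAr scalerA sqrt2V2; congr (_ *: _).
rewrite tr_col_mx mul_col_row trmxZ -!scalemxAr -!scalemxAl scalerA.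
by case: b; rewrite /= ?expr1 ?expr0 ?mulrNN ?mulr1 ?scale1r.
Qed.

Lemma sum_outer m k (A : 'M[R]_(m, r)) (B : 'M[R]_(k, r)) (c : 'rV[R]_r) :
  \sum_(i < r) c 0 i *: (col i A *m (col i B)^T) = A *m diag_mx c *m B^T.
Proof.
apply/matrixP => i j; rewrite summxE mxE; apply: eq_bigr => a _.
rewrite mul_mx_diag !mxE big_ord1 !mxE; ring.
Qed.

Lemma spec_block f : spec f =
  let p := \row_i ((f false i + f true i) / 2) in
  let q := \row_i ((f false i - f true i) / 2) in
  block_mx (U *m diag_mx p *m U^T) (U *m diag_mx q *m V^T)
           (V *m diag_mx q *m U^T) (V *m diag_mx p *m V^T).
Proof.
cbv zeta; rewrite -!sum_outer /spec big_bool -big_split /=.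
rewrite -sum_block_mx; apply: eq_bigr => i _; rewrite !theta_outer !scale_block_mx add_block_mx.
rewrite !scalerA -!scalerDl !mxE /= expr1 expr0.
by congr block_mx; congr (_ *: _); rewrite /GRing.scale /=; field.
Qed.

(** By [specM] the squared norm of [spec f x] is the sum of the
    [f ^ 2 <theta, x> ^ 2]; bounding [f ^ 2] by [c ^ 2] leaves the squared
    norm of the projection of [x]. *)
Lemma opb_spec f c : 0 <= c -> (forall b i, `|f b i| <= c) -> opb c (spec f).
Proof.
move=> c0 fc; split=> // x.
have form g : dotv x (spec g *m x) = \sum_(b : bool) \sum_(i < r) g b i * dotv (theta U V b i) x ^+ 2.
  rewrite dotvE /spec mulmx_suml mulmx_sumr summxE; apply: eq_bigr => b _.
  rewrite mulmx_suml mulmx_sumr summxE; apply: eq_bigr => i _.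
  rewrite -scalemxAl -scalemxAr mxE -mulmxA (mulmxA x^T) [X in _ * X]mxE big_ord1.
  by rewrite -!dotvE dotvC expr2.
rewrite {1}/sqn dotvM specT mulmxA specM form.
apply: (@le_trans _ _ (c ^+ 2 * dotv x (spec (fun _ _ => 1) *m x))).
  rewrite form mulr_sumr; apply: ler_sum => b _; rewrite mulr_sumr; apply: ler_sum => i _.
  rewrite mul1r ler_wpM2r ?sqr_ge0 // -expr2 -real_normK ?num_real //.
  by rewrite ler_sqr ?nnegrE.
rewrite ler_wpM2l ?sqr_ge0 // sqr_form ?specT //; last first.
  by rewrite specM; apply: eq_spec => b i; rewrite mulr1.
have [] := opb_proj (specT (fun _ _ => 1)); last by move=> _ /(_ x); rewrite expr1n mul1r.
by rewrite specM; apply: eq_spec => b i; rewrite mulr1.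
Qed.

(** The trace is the sum of the [2 r] diagonal coefficients of [B] in the
    system [theta]. *)
Lemma tr_spec1_le (B : 'M[R]_n) c : opb c B ->
  `|\tr (spec (fun _ _ => 1) *m B)| <= 2 * r%:R * c.
Proof.
move=> [c0 hB].
have -> : \tr (spec (fun _ _ => 1) *m B)
   = \sum_(b : bool) \sum_(i < r) dotv (theta U V b i) (B *m theta U V b i).
  rewrite /spec mulmx_suml raddf_sum; apply: eq_bigr => b _ /=.
  rewrite mulmx_suml raddf_sum; apply: eq_bigr => i _ /=.
  by rewrite scale1r -mulmxA mxtrace_mulC dotvE -mulmxA /mxtrace big_ord1.
have th b i : `|dotv (theta U V b i) (B *m theta U V b i)| <= c.
  have s1 : sqn (theta U V b i) = 1 by rewrite /sqn dotvE theta_dot !eqxx mxE.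
  rewrite -[c]mul1r; apply: dotv_le => //; first by rewrite s1 expr1n.
  by apply: le_trans (hB _) _; rewrite s1 mulr1.
rewrite big_bool /=; apply: le_trans (ler_normD _ _) _.
have one b : `|\sum_(i < r) dotv (theta U V b i) (B *m theta U V b i)| <= r%:R * c.
  apply: le_trans (ler_norm_sum _ _ _) _.
  apply: le_trans (ler_sum _ (fun i _ => th b i)) _.
  by rewrite sumr_const card_ord mulr_natl.
by rewrite -mulrA mulr2n mulrDl mul1r; apply: lerD.
Qed.

End signal.

(** * Covariance of the noise and algebra of the reduced resolvents *)

Lemma delta_mulmx_delta (R : realType) m n p q (A : 'M[R]_(n, p)) (i : 'I_m) j k (l : 'I_q) :
  delta_mx i j *m A *m delta_mx k l = A j k *: delta_mx i l.
Proof.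
have -> : delta_mx i j = (delta_mx i 0 : 'M[R]_(m, 1)) *m delta_mx 0 j by rewrite mul_delta_mx.
have -> : delta_mx k l = (delta_mx k 0 : 'M[R]_(p, 1)) *m delta_mx 0 l by rewrite mul_delta_mx.
rewrite -(mulmxA _ (delta_mx 0 j)) -rowE mulmxA -(mulmxA _ (row j A)) -colE.
have -> : col k (row j A) = (A j k)%:M :> 'M[R]_1.
  by apply/matrixP => a b; rewrite !ord1 !mxE eqxx mulr1n.
by rewrite mul_mx_scalar -scalemxAl mul_delta_mx.
Qed.

Section noise_covariance.
Context {R : realType} {d1 d2 : nat}.
Local Notation n := (d1 + d2)%N.

(** The directions along which the symmetrized noise has independent standard
    coordinates. *)
Definition symdelta (ij : 'I_d1 * 'I_d2) : 'M[R]_n := symmetrize (delta_mx ij.1 ij.2).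

Lemma symdeltaT ij : (symdelta ij)^T = symdelta ij.
Proof. by rewrite /symdelta /symmetrize tr_block_mx !trmx0 trmxK. Qed.

(** A product [e_i e_j^T B e_k e_l^T] extracts one entry of the block [B];
    summation over the index pairs produces transposes off the diagonal and
    traces on it. *)
Lemma mxcov_block A B C D :
  mxcov symdelta (block_mx A B C D) = block_mx (\tr D)%:M C^T B^T (\tr A)%:M.
Proof.
rewrite /mxcov /symdelta.
transitivity (\sum_(ij : 'I_d1 * 'I_d2) block_mx
   (D ij.2 ij.2 *: delta_mx ij.1 ij.1) (C ij.2 ij.1 *: delta_mx ij.1 ij.2)
   (B ij.1 ij.2 *: delta_mx ij.2 ij.1) (A ij.1 ij.1 *: (delta_mx ij.2 ij.2 : 'M[R]_d2))).
  apply: eq_bigr => ij _; rewrite /symmetrize trmx_delta !mulmx_block.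
  by rewrite !(mul0mx, mulmx0, add0r, addr0, delta_mulmx_delta).
rewrite sum_block_mx; congr block_mx.
- rewrite -(pair_bigA _ (fun i j => D j j *: delta_mx i i)) /= -scalemx1 mx1_sum_delta scaler_sumr.
  by apply: eq_bigr => i _; rewrite -scaler_suml.
- rewrite -(pair_bigA _ (fun i j => C j i *: delta_mx i j)) /= [RHS]matrix_sum_delta.
  by apply: eq_bigr => i _; apply: eq_bigr => j _; rewrite mxE.
- rewrite -(pair_bigA _ (fun i j => B i j *: delta_mx j i)) /= exchange_big [RHS]matrix_sum_delta.
  by apply: eq_bigr => i _; apply: eq_bigr => j _; rewrite mxE.
- rewrite -(pair_bigA _ (fun i j => A i i *: delta_mx j j)) /= exchange_big -scalemx1 mx1_sum_delta.
  by rewrite scaler_sumr; apply: eq_bigr => i _; rewrite -scaler_suml.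
Qed.

(** The block formula in terms of [flip]. In this form the covariance of [X]
    can be combined with the commutation rules of [flip], [frakP 0] and
    [frakP 1]. *)
Lemma symdelta_covE (B : 'M[R]_n) : mxcov symdelta B =
  2^-1 *: (B^T - flip *m B^T *m flip + (\tr B)%:M - \tr (flip *m B) *: flip).
Proof.
rewrite -[B]submxK; move: (ulsubmx B) (ursubmx B) (dlsubmx B) (drsubmx B) => A1 A2 A3 A4.
rewrite mxcov_block /flip tr_block_mx mxtrace_block !mulmx_block.
rewrite !(mul1mx, mul0mx, mulmx1, mulmx0, addr0, add0r, mulNmx, mulmxN, opprK).
rewrite mxtrace_block raddfN /= [(_ + _)%:M]scalar_mx_block.
rewrite !(scale_block_mx, opp_block_mx, add_block_mx).
by congr block_mx; apply/matrixP => i j; rewrite !mxE; try case: (i == j);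
  rewrite /= ?mulr1n ?mulr0n; field.
Qed.

End noise_covariance.

Section concrete_signal.
Context {R : realType} {d1 d2 r : nat}.
Variables (U : 'M[R]_(d1, r)) (lam : 'rV[R]_r) (V : 'M[R]_(d2, r)) (r_gt0 : (0 < r)%N).
Hypothesis svd : compact_svd U lam V.
Local Notation n := (d1 + d2)%N.
Local Notation S := (spec U V).
Let UU : U^T *m U = 1%:M. Proof. by case: svd. Qed.
Let VV : V^T *m V = 1%:M. Proof. by case: svd. Qed.
Let lam_gt0 i : 0 < lam 0 i. Proof. by case: svd. Qed.

Local Notation Pi := (Theta U V *m (Theta U V)^T).
Local Notation FP := (frakP U lam V).

Lemma Pi_spec : Pi = S (fun _ _ => 1).
Proof.
rewrite /Theta tr_row_mx mul_row_col /spec big_bool /= addrC.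
have col_sum m (A : 'M[R]_(m, r)) : A *m A^T = \sum_i col i A *m (col i A)^T.
  apply/matrixP => a b; rewrite summxE mxE; apply: eq_bigr => i _.
  by rewrite !mxE big_ord1 !mxE.
congr (_ + _); rewrite col_sum; last first.
  rewrite (reindex_inj rev_ord_inj) /=; apply: eq_bigr => i _; rewrite scale1r.
  have -> : theta U V true i = col (rev_ord i) (\matrix_(k, i0) theta U V true (rev_ord i0) k 0).
    by apply/colP => k; rewrite !mxE rev_ordK.
  by [].
apply: eq_bigr => i _; rewrite scale1r.
have -> : theta U V false i = col i (\matrix_(k, i0) theta U V false i0 k 0).
  by apply/colP => k; rewrite !mxE.
by [].
Qed.

Lemma frakP_spec k : FP k.+1 = S (fun b i => slam lam b i ^- k.+1).
Proof. by []. Qed.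

Lemma frakPD k l : FP k.+1 *m FP l.+1 = FP (k + l).+2.
Proof.
rewrite !frakP_spec specM //; apply: eq_spec => b i.
by rewrite -invfM -exprD addSn addnS.
Qed.

Lemma frakP_T k : (FP k)^T = FP k.
Proof.
case: k => [|k]; last exact: specT.
by rewrite /= Pi_spec linearB /= trmx1 specT.
Qed.

Lemma PiP k : Pi *m FP k.+1 = FP k.+1.
Proof. by rewrite Pi_spec specM //; apply: eq_spec => b i; rewrite mul1r. Qed.

Lemma PiPi : Pi *m Pi = Pi.
Proof. by rewrite Pi_spec specM //; apply: eq_spec => b i; rewrite mul1r. Qed.

Lemma frakPW k : FP 0 *m FP k.+1 = 0.
Proof. by rewrite [FP 0]/= mulmxBl mul1mx PiP subrr. Qed.

Lemma frakWP k : FP k.+1 *m FP 0 = 0.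
Proof. by apply: trmx_inj; rewrite trmx_mul !frakP_T frakPW trmx0. Qed.

Lemma frakWW : FP 0 *m FP 0 = FP 0.
Proof.
by rewrite /= mulmxBl mul1mx mulmxBr mulmx1 PiPi subrr subr0.
Qed.

Lemma slamN b i : slam lam (~~ b) i = - slam lam b i.
Proof. by rewrite /slam; case: b; rewrite /= ?expr1 ?expr0; ring. Qed.

Lemma slam_neq0 b i : slam lam b i != 0.
Proof. by rewrite /slam mulf_neq0 ?signr_eq0 // gt_eqF. Qed.

(** [flip] changes the sign of all the [slam b i]. *)
Lemma flip_frakP k : flip *m FP k.+1 *m flip = (-1) ^+ k.+1 *: FP k.+1.
Proof.
rewrite frakP_spec flip_spec.
rewrite /spec scaler_sumr; apply: eq_bigr => b _; rewrite scaler_sumr; apply: eq_bigr => i _.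
rewrite scalerA slamN [(- slam _ _ _) ^+ _]exprNn invfM; congr (_ *: _); congr (_ * _).
by rewrite -signr_odd; case: odd; rewrite ?expr0 ?expr1 ?invrN ?invr1.
Qed.

Lemma flip_P1 : flip *m FP 1 = - (FP 1 *m flip).
Proof.
have := flip_frakP 0; rewrite expr1 scaleN1r => h.
by rewrite -mulNmx -h -(mulmxA _ flip flip) flipK mulmx1.
Qed.

Lemma flip_W : flip *m FP 0 = FP 0 *m flip.
Proof.
have h : flip *m Pi *m flip = Pi by rewrite Pi_spec flip_spec.
have {}h : flip *m Pi = Pi *m flip by rewrite -{2}h -(mulmxA _ flip flip) flipK mulmx1.
by rewrite [FP 0]/= mulmxBr mulmxBl h mulmx1 mul1mx.
Qed.

Lemma tr_flip_frakP k : \tr (flip *m FP k.+1) = 0.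
Proof. exact: tr_flip_spec. Qed.

(** The eigenvalues [slam] come in opposite pairs, so odd powers have trace
    zero. *)
Lemma tr_frakP k : \tr (FP k.+1) = (1 + (-1) ^+ k.+1) * \sum_i lam 0 i ^- k.+1.
Proof.
rewrite frakP_spec tr_spec // big_bool /= mulrDl mul1r mulr_sumr addrC; congr (_ + _).
  by apply: eq_bigr => i _; rewrite /slam expr0 mul1r.
apply: eq_bigr => i _; rewrite /slam expr1 mulN1r [(- lam _ _) ^+ _]exprNn invfM; congr (_ * _).
by rewrite -signr_odd; case: odd; rewrite ?expr0 ?expr1 ?invrN ?invr1.
Qed.

Lemma tr_Pi : \tr Pi = 2 * r%:R.
Proof.
rewrite Pi_spec tr_spec // big_bool /= !sumr_const card_ord; ring.
Qed.

Lemma tr_W : \tr (FP 0) = d1%:R + d2%:R - 2 * r%:R.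
Proof. by rewrite /= raddfB /= mxtrace1 tr_Pi natrD. Qed.

Lemma tr_flip_W : \tr (flip *m FP 0) = d1%:R - d2%:R.
Proof.
rewrite /= mulmxBr mulmx1 raddfB /= Pi_spec tr_flip_spec // subr0 /flip mxtrace_block.
by rewrite raddfN /= !mxtrace1.
Qed.

Lemma signal_spec : symmetrize (U *m diag_mx lam *m V^T) = S (slam lam).
Proof.
rewrite spec_block /symmetrize !trmx_mul trmxK tr_diag_mx mulmxA.
have -> : \row_i ((slam lam false i + slam lam true i) / 2) = 0.
  by apply/rowP => i; rewrite !mxE /slam /=; ring.
have -> : \row_i ((slam lam false i - slam lam true i) / 2) = lam.
  by apply/rowP => i; rewrite !mxE /slam /=; field.
by rewrite raddf0 !mulmx0 !mul0mx.
Qed.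

Lemma signal_P : symmetrize (U *m diag_mx lam *m V^T) *m FP 1 = Pi.
Proof.
rewrite signal_spec frakP_spec specM // Pi_spec; apply: eq_spec => b i.
by rewrite expr1 mulfV // slam_neq0.
Qed.

Lemma signal_W : FP 0 *m symmetrize (U *m diag_mx lam *m V^T) = 0.
Proof.
rewrite signal_spec [FP 0]/= mulmxBl mul1mx Pi_spec specM //.
by rewrite [X in _ - X](_ : _ = S (slam lam)) ?subrr //; apply: eq_spec => b i; rewrite mul1r.
Qed.

Lemma Pi_block : Pi = block_mx (U *m U^T) 0 0 (V *m V^T).
Proof.
rewrite Pi_spec spec_block; cbv zeta.
have -> : \row_i ((1 + 1) / 2) = const_mx 1 :> 'rV[R]_r.
  by apply/rowP => i; rewrite !mxE; field.
have -> : \row_i ((1 - 1) / 2) = 0 :> 'rV[R]_r.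
  by apply/rowP => i; rewrite !mxE; field.
by rewrite diag_const_mx raddf0 !mulmx1 !mulmx0 !mul0mx.
Qed.

Let lamr := lam 0 (last_ord r_gt0).

Lemma lamr_gt0 : 0 < lamr. Proof. exact: lam_gt0. Qed.

Lemma lamr_le i : lamr <= lam 0 i.
Proof.
case: svd => _ _ mono _; apply: mono => /=.
by rewrite -ltnS prednK.
Qed.

Lemma opb_P1 : opb lamr^-1 (FP 1).
Proof.
rewrite frakP_spec; apply: opb_spec => //; first by rewrite invr_ge0 ltW // lamr_gt0.
move=> b i; rewrite expr1 normrV ?unitfE ?slam_neq0 // /slam normrMsign gtr0_norm //.
by rewrite lef_pV2 ?posrE ?lamr_gt0 // lamr_le.
Qed.

Lemma opb_W : opb 1 (FP 0).
Proof. by apply: opb_proj; [exact: frakP_T | exact: frakWW]. Qed.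

Lemma opb_Pi : opb 1 Pi.
Proof. by apply: opb_proj; [rewrite Pi_spec specT | exact: PiPi]. Qed.

Lemma tr_Pi_le (B : 'M[R]_n) c : opb c B -> `|\tr (Pi *m B)| <= 2 * r%:R * c.
Proof. by rewrite Pi_spec; exact: tr_spec1_le. Qed.

Lemma frobenius_sq m k (B : 'M[R]_(m, k)) : frobenius B ^+ 2 = \sum_i \sum_j B i j ^+ 2.
Proof.
by rewrite /frobenius sqr_sqrtr //; apply: sumr_ge0 => i _; apply: sumr_ge0 => j _; exact: sqr_ge0.
Qed.

Lemma frobenius_diag (c : 'rV[R]_r) : frobenius (diag_mx c) ^+ 2 = \sum_i c 0 i ^+ 2.
Proof.
rewrite frobenius_sq; apply: eq_bigr => i _; rewrite (bigD1 i) //= big1 ?addr0.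
  by rewrite mxE eqxx mulr1n.
by move=> j ji; rewrite mxE eq_sym (negbTE ji) mulr0n expr0n.
Qed.

Lemma invmx_Lambda : invmx (diag_mx lam) = diag_mx (\row_i (lam 0 i)^-1).
Proof.
have h : diag_mx lam *m diag_mx (\row_i (lam 0 i)^-1) = 1%:M.
  rewrite mulmx_diag -diag_const_mx; congr diag_mx; apply/rowP => i.
  by rewrite !mxE mulfV // gt_eqF.
have [u _] := mulmx1_unit h.
by rewrite -[RHS](mulKmx u) h mulmx1.
Qed.

Lemma frob_inv : frobenius (invmx (diag_mx lam)) ^+ 2 = \sum_i lam 0 i ^- 2.
Proof.
rewrite invmx_Lambda frobenius_diag; apply: eq_bigr => i _.
by rewrite mxE exprVn.
Qed.

Lemma frob_inv2 :
  frobenius (invmx (diag_mx lam) *m invmx (diag_mx lam)) ^+ 2 = \sum_i lam 0 i ^- 4.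
Proof.
rewrite invmx_Lambda mulmx_diag frobenius_diag; apply: eq_bigr => i _.
by rewrite !mxE -expr2 -exprM exprVn.
Qed.

Lemma frob_inv2_le : \sum_i lam 0 i ^- 4 <= r%:R / lamr ^+ 4.
Proof.
apply: (@le_trans _ _ (\sum_(i < r) lamr ^- 4)).
  apply: ler_sum => i _.
  rewrite lef_pV2 ?posrE ?exprn_gt0 ?lam_gt0 ?lamr_gt0 //.
  by rewrite ler_pXn2r ?nnegrE ?lamr_le // ltW // ?lam_gt0 ?lamr_gt0.
by rewrite sumr_const card_ord mulr_natl.
Qed.

End concrete_signal.

(** * Means of the fourth-order traces *)

Lemma scalemxE (R : realType) m n c (A : 'M[R]_(m, n)) i j : (c *: A) i j = c * A i j.
Proof. by rewrite mxE. Qed.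

(** All the means are consequences of the formula for [cov], of the
    commutation relations of [J], [W], [P], and of the traces of these
    matrices. [s], [dlt], [l2] and [l4] stand for [dstar], [Delta] and twice
    the sums of the inverse squares and fourth powers of the singular
    values. *)
Section chain_means.
Context {R : realType} {n : nat} {I : finType}.
Variables (E : I -> 'M[R]_n) (J W P : 'M[R]_n) (s dlt l2 l4 : R).
Local Notation cov := (mxcov E).
Hypothesis covE : forall B, cov B =
  2^-1 *: (B^T - J *m B^T *m J + (\tr B)%:M - \tr (J *m B) *: J).
Hypotheses (WT : W^T = W) (PT : P^T = P) (JT : J^T = J) (JJ : J *m J = 1%:M).
Hypotheses (WW : W *m W = W) (WP : W *m P = 0) (PW : P *m W = 0).
Hypotheses (JW : J *m W = W *m J) (JP : J *m P = - (P *m J)).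
Hypotheses (trP : \tr P = 0) (trJP : \tr (J *m P) = 0).
Hypotheses (trW : \tr W = s) (trJW : \tr (J *m W) = dlt).
Variables (P2 P3 P4 : 'M[R]_n).
Hypotheses (P2E : P2 = P *m P) (P3E : P3 = P2 *m P) (P4E : P4 = P3 *m P).
Hypotheses (trP2 : \tr P2 = l2) (trJP2 : \tr (J *m P2) = 0).
Hypotheses (trP4 : \tr P4 = l4) (trJP4 : \tr (J *m P4) = 0).

Let D : 'M[R]_n := (s / 2)%:M - (dlt / 2) *: J.

(** The value given by [has_mean_tr4]. *)
Definition wick4 A0 A1 A2 A3 : R :=
  \tr (A0 *m cov A1 *m A2 *m cov A3)
  + \sum_b \tr (A0 *m cov (A1 *m E b *m A2) *m A3 *m E b)
  + \tr (A0 *m cov (A1 *m cov A2 *m A3)).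

Hypothesis ET : forall a, (E a)^T = E a.

(** The crossing pairing. The formula for [cov] replaces [cov (A1 E_b A2)] by
    transposes, which lead to [cov] of a product, and by traces, which leave
    sums of products of two traces. *)
Lemma cov_sum4 A0 A1 A2 A3 :
  \sum_b \tr (A0 *m cov (A1 *m E b *m A2) *m A3 *m E b)
  = 2^-1 * (\tr (A0 *m A2^T *m cov (A1^T *m A3)) - \tr (A0 *m J *m A2^T *m cov (A1^T *m J *m A3))
    + \sum_b \tr (A2 *m A1 *m E b) * \tr (A0 *m A3 *m E b)
    - \sum_b \tr (A2 *m J *m A1 *m E b) * \tr (A0 *m J *m A3 *m E b)).
Proof.
rewrite !mxcovE_tr -!sumrN -!big_split /= mulr_sumr; apply: eq_bigr => b _.
rewrite covE -scalemxAr -!scalemxAl mxtraceZ; congr (_ * _).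
rewrite !trmx_mul ET !(mulmxBr, mulmxDr, mulmxBl, mulmxDl).
rewrite !(raddfB, raddfD, mulNmx, raddfN) /=; congr (_ - _ + _ - _); rewrite ?mulmxA //.
- rewrite mul_mx_scalar -!scalemxAl mxtraceZ; congr (_ * _).
  by rewrite mxtrace_mulC mulmxA.
- rewrite -scalemxAr -!scalemxAl mxtraceZ; congr (_ * _).
  by rewrite mxtrace_mulC !mulmxA.
Qed.

Lemma covZ c B : cov (c *: B) = c *: cov B.
Proof.
rewrite /mxcov scaler_sumr; apply: eq_bigr => a _.
by rewrite -scalemxAr -scalemxAl.
Qed.

Lemma covD A B : cov (A + B) = cov A + cov B.
Proof.
by rewrite /mxcov -big_split; apply: eq_bigr => a _; rewrite mulmxDr mulmxDl.
Qed.

Lemma cov0 : cov 0 = 0.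
Proof. by rewrite /mxcov big1 // => a _; rewrite mulmx0 mul0mx. Qed.

Lemma JPJ : J *m P *m J = - P.
Proof. by rewrite JP mulNmx -mulmxA JJ mulmx1. Qed.

Lemma JWJ : J *m W *m J = W.
Proof. by rewrite JW -mulmxA JJ mulmx1. Qed.

Lemma JP2 : J *m P2 = P2 *m J.
Proof. by rewrite P2E mulmxA JP mulNmx -(mulmxA P J P) JP mulmxN opprK mulmxA. Qed.

Lemma covW : cov W = D.
Proof.
rewrite covE WT JWJ subrr add0r trW trJW /D scalerBr scale_scalar_mx scalerA.
by congr (_%:M - _ *: _); rewrite mulrC.
Qed.

Lemma covJW : cov (J *m W) = - (J *m D).
Proof.
have e1 : J *m (W *m J) *m J = W *m J by rewrite -!mulmxA JJ mulmx1 JW.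
have e2 : J *m (J *m W) = W by rewrite mulmxA JJ mul1mx.
rewrite covE trmx_mul WT JT trJW e1 e2 subrr add0r trW.
rewrite /D mulmxBr -scalemxAr JJ mul_mx_scalar opprB scalerBr scale_scalar_mx scalerA.
by rewrite scalemx1; congr (_%:M - _ *: _); rewrite mulrC.
Qed.

Lemma covP : cov P = P.
Proof.
rewrite covE PT JPJ opprK trP trJP raddf0 scale0r addr0 subr0.
by apply/matrixP => i j; rewrite !mxE; field.
Qed.

Lemma P2T : P2^T = P2. Proof. by rewrite P2E trmx_mul PT. Qed.

Lemma covP2 : cov P2 = (l2 / 2)%:M.
Proof.
rewrite covE P2T trP2 trJP2 JP2 -mulmxA JJ mulmx1 subrr add0r scale0r subr0.
by rewrite scale_scalar_mx mulrC.
Qed.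

Lemma covJP2 : cov (J *m P2) = - (l2 / 2) *: J.
Proof.
have e1 : J *m (P2 *m J) *m J = P2 *m J by rewrite -!mulmxA JJ mulmx1 JP2.
have e2 : J *m (J *m P2) = P2 by rewrite mulmxA JJ mul1mx.
rewrite covE trmx_mul P2T JT trJP2 e1 e2 raddf0 addr0 subrr add0r trP2.
by apply/matrixP => i j; rewrite !mxE; field.
Qed.

Lemma DW : D *m W = W *m D.
Proof. by rewrite /D mulmxBl mulmxBr -scalemxAl -scalemxAr JW mul_scalar_mx mul_mx_scalar. Qed.

Lemma trP2J : \tr (P2 *m J) = 0. Proof. by rewrite mxtrace_mulC. Qed.
Lemma trP4J : \tr (P4 *m J) = 0. Proof. by rewrite mxtrace_mulC. Qed.

Lemma trP4D : \tr (P4 *m D) = s * l4 / 2.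
Proof.
rewrite /D mulmxBr raddfB /= mul_mx_scalar -scalemxAr !mxtraceZ trP4 trP4J.
by field.
Qed.

Lemma covWDW : cov (W *m D *m W) = ((s ^+ 2 - dlt ^+ 2) / 4)%:M.
Proof.
rewrite -DW -mulmxA WW /D mulmxBl mul_scalar_mx -scalemxAl.
rewrite -scaleNr covD !covZ covW covJW /D mulmxBr -scalemxAr JJ mul_mx_scalar.
apply/matrixP => i j; rewrite !mxE; case: (i == j); rewrite /= ?mulr1n ?mulr0n; by field.
Qed.

Lemma PD : P *m D = (s / 2) *: P - (dlt / 2) *: (P *m J).
Proof. by rewrite /D mulmxBr mul_mx_scalar -scalemxAr. Qed.

Lemma DP : D *m P = (s / 2) *: P + (dlt / 2) *: (P *m J).
Proof. by rewrite /D mulmxBl mul_scalar_mx -scalemxAl JP scalerN opprK. Qed.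

Lemma P2D : D *m P2 = P2 *m D.
Proof. by rewrite /D mulmxBl mulmxBr -scalemxAl -scalemxAr JP2 mul_scalar_mx mul_mx_scalar. Qed.

Lemma trP4DD : \tr (P4 *m D *m D) = l4 * (s ^+ 2 + dlt ^+ 2) / 4.
Proof.
have -> : P4 *m D *m D = ((s ^+ 2 + dlt ^+ 2) / 4) *: P4 - (s * dlt / 2) *: (P4 *m J).
  rewrite -mulmxA.
  have -> : D *m D = ((s ^+ 2 + dlt ^+ 2) / 4)%:M - (s * dlt / 2) *: J.
    rewrite {1}/D mulmxBl mul_scalar_mx -scalemxAl /D mulmxBr -scalemxAr JJ mul_mx_scalar.
    apply/matrixP => i j; rewrite !mxE; case: (i == j); rewrite /= ?mulr1n ?mulr0n; by field.
  by rewrite mulmxBr mul_mx_scalar -scalemxAr.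
rewrite raddfB /= !mxtraceZ trP4 trP4J; by field.
Qed.

Lemma trP3DPD : \tr (P3 *m D *m P *m D) = l4 * (s ^+ 2 - dlt ^+ 2) / 4.
Proof.
have JD : J *m D = (s / 2) *: J - (dlt / 2)%:M.
  by rewrite /D mulmxBr mul_mx_scalar -scalemxAr JJ scalemx1.
have DPD : D *m P *m D = ((s ^+ 2 - dlt ^+ 2) / 4) *: P.
  rewrite DP mulmxDl -!scalemxAl -mulmxA JD PD mulmxBr mul_mx_scalar -scalemxAr.
  by apply/matrixP => i j; rewrite !(addmxE, oppmxE, scalemxE); field.
by rewrite -(mulmxA P3) -(mulmxA P3) DPD -scalemxAr mxtraceZ -P4E trP4; ring.
Qed.

(** If the last two letters are [W] and the first is a power of [P], each term
    of [cov_sum4] contains the product of a power of [P] and [W], possibly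
    separated by [J], which is zero. *)
Lemma cross_WW A0 A1 : A0 *m W = 0 ->
  \sum_b \tr (A0 *m cov (A1 *m E b *m W) *m W *m E b) = 0.
Proof.
move=> A0W; rewrite cov_sum4 WT A0W -(mulmxA A0) JW mulmxA A0W !mul0mx.
rewrite mxtrace0 subr0 add0r !big1 ?subrr ?mulr0 // => b _;
  by rewrite ?mul0mx ?mxtrace0 mulr0.
Qed.

Lemma cross_W A0 A1 A2 : A0 *m W = 0 ->
  \sum_b \tr (A0 *m cov (A1 *m E b *m A2) *m W *m E b)
  = 2^-1 * (\tr (A0 *m A2^T *m cov (A1^T *m W))
            - \tr (A0 *m J *m A2^T *m cov (A1^T *m J *m W))).
Proof.
move=> A0W; rewrite cov_sum4 -[A0 *m J *m W](mulmxA A0) JW mulmxA A0W !mul0mx.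
rewrite [X in _ + X - _]big1 => [|b _]; last by rewrite mul0mx mxtrace0 mulr0.
by rewrite [X in _ - X]big1 ?addr0 ?subr0 // => b _; rewrite !mul0mx mxtrace0 mulr0.
Qed.

Let P2W : P2 *m W = 0. Proof. by rewrite P2E -mulmxA PW mulmx0. Qed.
Let P3W : P3 *m W = 0. Proof. by rewrite P3E -mulmxA PW mulmx0. Qed.
Let P4W : P4 *m W = 0. Proof. by rewrite P4E -mulmxA PW mulmx0. Qed.

Lemma wick_WWW : wick4 P4 W W W = l4 * (s ^+ 2 - dlt ^+ 2) / 4.
Proof.
rewrite /wick4 cross_WW // covW covWDW mul_mx_scalar mxtraceZ trP4.
by rewrite -(mulmxA P4) DW mulmxA P4W !mul0mx mxtrace0; ring.
Qed.

Lemma wick_PWW : wick4 P3 P W W = 0.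
Proof.
rewrite /wick4 cross_WW // covW covP -(mulmxA P3) PW mulmx0 mul0mx mxtrace0.
by rewrite -mulmxA DW mulmxA PW mul0mx cov0 mulmx0 mxtrace0 !addr0.
Qed.

Lemma wick_WPW : wick4 P3 W P W = l4 * (s ^+ 2 - dlt ^+ 2) / 4.
Proof.
rewrite /wick4 cross_W // covW covP WP mul0mx cov0 mulmx0 mxtrace0 addr0 trP3DPD.
rewrite PT WT WW covW -P4E -JW -(mulmxA J) WW covJW.
rewrite -(mulmxA P3 J P) JP !(mulmxN, mulNmx) opprK (mulmxA P3 P J) -P4E.
by rewrite mulmxA -(mulmxA P4) JJ mulmx1 subrr mulr0 addr0.
Qed.

Lemma wick_P2WW : wick4 P2 P2 W W = 0.
Proof.
rewrite /wick4 cross_WW // covW covP2 mul_mx_scalar -!scalemxAl P2W mul0mx scaler0 mxtrace0.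
by rewrite -mulmxA DW mulmxA P2W mul0mx cov0 mulmx0 mxtrace0 !addr0.
Qed.

Lemma P4E2 : P4 = P2 *m P2. Proof. by rewrite P4E P3E P2E !mulmxA. Qed.

Lemma trP2D : \tr (P2 *m D) = s * l2 / 2.
Proof.
rewrite /D mulmxBr raddfB /= mul_mx_scalar -scalemxAr !mxtraceZ trP2 trP2J.
by field.
Qed.

Lemma wick_WP2W : wick4 P2 W P2 W
  = l4 * (s ^+ 2 + dlt ^+ 2) / 4 + s * l2 ^+ 2 / 4 + s * l4 / 2.
Proof.
rewrite /wick4 cross_W // covW covP2 mul_mx_scalar -scalemxAl WW covZ covW.
rewrite -(mulmxA P2 D) P2D mulmxA -P4E2 trP4DD -scalemxAr mxtraceZ trP2D.
rewrite P2T WT WW covW -P4E2 trP4D -JW -(mulmxA J) WW covJW.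
rewrite -(mulmxA P2) JP2 mulmxA -P4E2 mulmxN raddfN /= opprK.
rewrite mulmxA -(mulmxA P4) JJ mulmx1 trP4D; by field.
Qed.

Lemma wick_PPW : wick4 P2 P P W = s * l4 / 2.
Proof.
rewrite /wick4 cross_W // covW covP PT PW -(mulmxA P J) JW mulmxA PW mul0mx cov0 !mulmx0 mxtrace0.
rewrite subr0 mulr0 -[P *m P *m W]mulmxA PW mulmx0 cov0 mulmx0 mxtrace0 !addr0.
by rewrite -(mulmxA P2 P P) -P2E -P4E2 trP4D.
Qed.

Lemma wick_PWP : wick4 P2 P W P = s * l2 ^+ 2 / 4.
Proof.
have h1 : P2 *m J *m W = 0 by rewrite -mulmxA JW mulmxA P2W mul0mx.
have h2 : W *m J *m P = 0 by rewrite -mulmxA JP mulmxN mulmxA WP mul0mx oppr0.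
have h3 : P2 *m P *m W = 0 by rewrite -mulmxA PW mulmx0.
rewrite /wick4 cov_sum4 covP WT P2W h1 h2 h3 WP !mul0mx mxtrace0 subr0 !add0r.
rewrite big1 => [|b _]; last by rewrite mul0mx mxtrace0 mul0r.
rewrite big1 => [|b _]; last by rewrite mul0mx mxtrace0 mul0r.
rewrite subr0 mulr0 add0r.
rewrite covW.
have -> : P *m D *m P = (s / 2) *: P2 - (dlt / 2) *: (- (J *m P2)).
  rewrite -mulmxA DP mulmxDr -!scalemxAr -P2E mulmxA -P2E JP2 scalerN opprK //.
rewrite scalerN opprK covD !covZ covP2 covJP2 mulmxDr -!scalemxAr mul_mx_scalar.
rewrite raddfD /= !mxtraceZ trP2 trP2J; by field.
Qed.

(** The coefficients are those of [fourth]. The contributions in [l4 s^2] and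
    [s l2^2] cancel; this is why the bias is [dlt ^+ 2] up to a term that is
    only linear in the dimensions. *)
Lemma wick_fourth :
  3 * wick4 P4 W W W - 4 * wick4 P3 P W W - 2 * wick4 P3 W P W - 2 * wick4 P2 P2 W W
  - wick4 P2 W P2 W + 2 * wick4 P2 P P W + wick4 P2 P W P = l4 / 2 * (s - dlt ^+ 2).
Proof.
rewrite wick_WWW wick_PWW wick_WPW wick_P2WW wick_WP2W wick_PPW wick_PWP.
by field.
Qed.

End chain_means.

(** * The fourth-order term of the expansion *)

Section chains.
Context {R : realType} {n : nat}.
Implicit Types (A B C D W P X : 'M[R]_n).

Definition chain X A B C D : R :=
  \tr (A *m X *m B *m X *m C *m X *m D *m X).

(** Transposition reverses the word, and the trace is cyclic. *)
Lemma chainC X A B C D : X^T = X -> A^T = A -> B^T = B -> C^T = C -> D^T = D ->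
  chain X A B C D = chain X A D C B.
Proof.
move=> XT AT BT CT DT; rewrite /chain -[LHS]mxtrace_tr !trmx_mul XT AT BT CT DT.
by rewrite !mulmxA mxtrace_mulC !mulmxA.
Qed.

(** The combination of words to which both the trace of [pG4] and the
    fourth-order term [S_{A,4}] reduce, up to reversal of the words. The
    exponents of [P] add up to 4 in each of them. *)
Definition fourth W P P2 P3 P4 X : R :=
  3 * chain X P4 W W W - 4 * chain X P3 P W W - 2 * chain X P3 W P W
  - 2 * chain X P2 P2 W W - chain X P2 W P2 W + 2 * chain X P2 P P W
  + chain X P2 P W P.

(** Expansion of the products, with [W W = W], cyclicity of the trace to bring
    all outer factors [P] to the front, and [chainC] to identify a word with
    its reverse. *)
Lemma tr_pG4 W P P2 P3 P4 X : W^T = W -> P^T = P -> X^T = X -> W *m W = W ->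
  P2 = P *m P -> P3 = P2 *m P -> P4 = P3 *m P ->
  \tr (pG4 W P X) = fourth W P P2 P3 P4 X.
Proof.
move=> WT PT XT WW e2 e3 e4.
have P2T : P2^T = P2 by rewrite e2 trmx_mul PT.
have P3T : P3^T = P3 by rewrite e3 e2 !trmx_mul PT !mulmxA.
rewrite /fourth.
have WWr (A : 'M[R]_n) : A *m W *m W = A *m W by rewrite -mulmxA WW.
have rotP (A : 'M[R]_n) : \tr (A *m P) = \tr (P *m A) by exact: mxtrace_mulC.
have E1T : (pE1 W P X)^T = P *m X *m W by rewrite /pE1 !trmx_mul PT XT WT mulmxA.
have E2T : (pE2 W P X)^T = P *m P *m X *m W *m X *m W - P *m X *m P *m X *m W.
  by rewrite /pE2 /pE1 trmxD trmxN !trmx_mul PT XT WT !mulmxA.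
have E2E : pE2 W P X = W *m X *m W *m X *m P *m P - W *m X *m P *m X *m P.
  by rewrite /pE2 /pE1 !mulmxA.
have G2E : pG2 W P X = P *m X *m W *m X *m P.
  by rewrite /pG2 E1T /pE1 !mulmxA WWr.
have H2E : pH2 W P X = W *m X *m P *m P *m X *m W.
  by rewrite /pH2 E1T /pE1 !mulmxA.
have tE : \tr ((pE1 W P X)^T *m pE3 W P X) = chain X P4 W W W - chain X P3 W W P
   - chain X P3 W P W - chain X P2 W W P2 + chain X P2 W P P - chain X P2 W P2 W.
  rewrite E1T /pE3 /pstep E2E G2E H2E !(mulmxBr, mulmxBl) !mulmxA !WWr.
  rewrite !(raddfB, raddfD) /=.
  do 4![rewrite ?rotP ?mulmxA].
  by rewrite /chain e4 e3 e2 !mulmxA; ring.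
have tE' : \tr ((pE3 W P X)^T *m pE1 W P X) = \tr ((pE1 W P X)^T *m pE3 W P X).
  by rewrite -mxtrace_tr trmx_mul trmxK.
have t22 : \tr ((pE2 W P X)^T *m pE2 W P X)
   = chain X P4 W W W - chain X P3 W W P - chain X P3 P W W + chain X P2 P W P.
  rewrite E2T E2E !(mulmxBr, mulmxBl) !mulmxA !WWr !(raddfB, raddfD) /=.
  do 4![rewrite ?rotP ?mulmxA].
  by rewrite /chain e4 e3 e2 ?mulmxA; ring.
have tG : \tr (pG2 W P X *m pG2 W P X) = chain X P2 W P2 W.
  rewrite G2E !mulmxA; do 4![rewrite ?rotP ?mulmxA].
  by rewrite /chain e2 ?mulmxA.
rewrite /pG4 3!mxtraceD tE' tE t22 tG.
rewrite (chainC (A := P3) XT _ WT WT PT) // (chainC (A := P2) XT _ WT WT P2T) //.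
rewrite (chainC (A := P2) XT _ WT PT PT) //; ring.
Qed.

End chains.

Section tuples_of_sum.

(** An enumeration that evaluates: the tuples of [m] natural numbers with sum
    [k]. *)
Fixpoint comps (m k : nat) : seq (seq nat) :=
  if m is m'.+1 then flatten [seq [seq a :: l | l <- comps m' (k - a)] | a <- iota 0 k.+1]
  else if k is 0 then [:: [::]] else [::].

Lemma mem_comps m k l : (l \in comps m k) = (size l == m) && (sumn l == k).
Proof.
elim: m k l => [|m IH] k l; first by case: l => [|a l]; case: k.
rewrite -[comps m.+1 k]/(flatten [seq [seq a :: l | l <- comps m (k - a)] | a <- iota 0 k.+1]).
apply/flatten_mapP/andP => [[a]|].
  rewrite mem_iota add0n ltnS => ak /mapP[l' hl' ->] /=.
  by move: hl'; rewrite IH => /andP[/eqP <- /eqP ->]; rewrite subnKC // !eqxx.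
case: l => [[] //|a l] [/eqP [sl] /eqP sk]; exists a.
  by rewrite mem_iota add0n ltnS /= -sk leq_addr.
by apply: map_f; rewrite IH sl eqxx -sk addKn eqxx.
Qed.

Lemma big_ffun_comps (R : realType) m k (F : seq nat -> R) : uniq (comps m k.+1) ->
  \sum_(s : {ffun 'I_m -> 'I_k.+2} | (\sum_j s j == k.+1)%N) F [seq nat_of_ord (s j) | j <- fintype.enum 'I_m]
  = \sum_(l <- comps m k.+1) F l.
Proof.
move=> uc; set tol := fun s : {ffun 'I_m -> 'I_k.+2} => [seq nat_of_ord (s j) | j <- fintype.enum 'I_m].
have tol_inj : injective tol.
  move=> s t st; apply/ffunP => j; apply: val_inj.
  by move/eq_in_map: st => /(_ j); rewrite mem_enum => /(_ isT).
have tol_sum s : sumn (tol s) = (\sum_j s j)%N.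
  by rewrite sumnE big_map big_enum.
rewrite -big_filter -(big_map tol xpredT F); apply: perm_big; apply: uniq_perm => //.
  by rewrite map_inj_uniq // filter_uniq // index_enum_uniq.
move=> l; rewrite mem_comps; apply/mapP/andP.
  move=> [s]; rewrite mem_filter => /andP[/eqP hs _] ->.
  by rewrite size_map size_enum_ord tol_sum hs.
move=> [/eqP sl /eqP hl].
have le_l j : (nth 0%N l j < k.+2)%N.
  rewrite ltnS -hl; elim: (l) j {sl hl} => [|a l' IH] [|j] //=.
    exact: leq_addr.
  by apply: leq_trans (IH j) _; exact: leq_addl.
have e : l = tol [ffun j : 'I_m => Ordinal (le_l j)].
  rewrite -[LHS](mkseq_nth 0%N) sl /mkseq -val_enum_ord -map_comp.
  by apply: eq_map => j; rewrite ffunE.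
exists [ffun j : 'I_m => Ordinal (le_l j)] => //.
by rewrite mem_filter mem_index_enum andbT -tol_sum -e hl.
Qed.

End tuples_of_sum.

Section fourth_order_term.
Context {R : realType} {d1 d2 r : nat}.
Variables (U : 'M[R]_(d1, r)) (lam : 'rV[R]_r) (V : 'M[R]_(d2, r)).
Hypothesis svd : compact_svd U lam V.
Local Notation Pi := (Theta U V *m (Theta U V)^T).
Local Notation FP := (frakP U lam V).
Variable X : 'M[R]_(d1 + d2).
Hypothesis XT : X^T = X.

Definition sa_term (l : seq nat) : R :=
  (-1) ^+ (1 + count (fun x => (0 < x)%N) l) *
  \tr (Pi *m (FP (nth 0%N l 0) *m X *m FP (nth 0%N l 1) *m X *m FP (nth 0%N l 2)
    *m X *m FP (nth 0%N l 3) *m X *m FP (nth 0%N l 4))).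

Lemma sa_sum : mxdot Pi (SA U lam V 4 X) = \sum_(l <- comps 5 4) sa_term l.
Proof.
rewrite -big_ffun_comps; last by [].
rewrite /mxdot.
have -> : Pi^T = Pi by rewrite Pi_spec specT.
rewrite /SA mulmx_sumr raddf_sum; apply: eq_bigr => s _ /=.
rewrite -scalemxAr mxtraceZ /sa_term.
have nthE (i : 'I_5) : nth 0%N [seq nat_of_ord (s j) | j <- enum 'I_5] i = s i.
  rewrite (nth_map i) ?size_enum_ord //; congr (nat_of_ord (s _)).
  by apply: val_inj; rewrite /= nth_enum_ord.
congr ((-1) ^+ (1 + _) * \tr (Pi *m _)).
  by rewrite count_map cardE /enum_mem size_filter count_filter; apply: eq_count => j; rewrite /= andbT.
rewrite !big_ord_recl big_ord0 mulmx1 !mulmxA.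
rewrite -(nthE ord0) -(nthE (lift ord0 ord0)) -(nthE (lift ord0 (lift ord0 ord0))).
rewrite -(nthE (lift ord0 (lift ord0 (lift ord0 ord0)))).
rewrite -(nthE (lift ord0 (lift ord0 (lift ord0 (lift ord0 ord0))))).
by [].
Qed.

(** A word whose first or last letter is [W = 1 - Pi] is killed by the factor
    [Pi] under the trace. *)
Lemma sa_term0 l : (nth 0%N l 0 == 0%N) || (nth 0%N l 4 == 0%N) -> sa_term l = 0.
Proof.
move=> h; rewrite /sa_term; suff -> : \tr (Pi *m (FP (nth 0%N l 0) *m X *m FP (nth 0%N l 1) *m X *m FP (nth 0%N l 2)
    *m X *m FP (nth 0%N l 3) *m X *m FP (nth 0%N l 4))) = 0 by rewrite mulr0.
case/orP: h => /eqP ->.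
  by rewrite !mulmxA [Pi *m FP 0]/= mulmxBr mulmx1 (PiPi svd) subrr !mul0mx mxtrace0.
have -> : FP 0 = 1%:M - Pi by [].
move: (PiPi svd); move: Pi => p pp.
by rewrite mulmxA mxtrace_mulC mulmxA mulmxBl mul1mx !mulmxA pp subrr mxtrace0.
Qed.

(** Under the trace the last letter moves to the front, where it merges with
    the first one. *)
Lemma sa_termS a b c d e : sa_term [:: a.+1; b; c; d; e.+1] =
  (-1) ^+ (1 + count (fun x => (0 < x)%N) [:: a.+1; b; c; d; e.+1]) *
  chain X (FP (e + a).+2) (FP b) (FP c) (FP d).
Proof.
rewrite /sa_term; congr (_ * _).
rewrite [nth _ _ 0]/= [nth _ _ 1]/= [nth _ _ 2]/= [nth _ _ 3]/= [nth _ _ 4]/= !mulmxA PiP //.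
by rewrite mxtrace_mulC !mulmxA frakPD.
Qed.

(** Of the 70 tuples with sum 4 there remain the 15 that begin and end with a
    positive entry; they are grouped with the help of [chainC]. *)
Lemma tr_SA4 : mxdot Pi (SA U lam V 4 X) =
  - fourth (FP 0) (FP 1) (FP 2) (FP 3) (FP 4) X.
Proof.
rewrite sa_sum (bigID (fun l => (0 < nth 0%N l 0)%N && (0 < nth 0%N l 4)%N)) /=.
rewrite [X in _ + X]big1 ?addr0; last first.
  by move=> l; rewrite negb_and -!eqn0Ngt => /sa_term0.
rewrite -big_filter.
have -> : [seq l <- comps 5 4 | (0 < nth 0%N l 0)%N && (0 < nth 0%N l 4)%N] =
  [:: [:: 1; 0; 0; 0; 3]; [:: 1; 0; 0; 1; 2]; [:: 1; 0; 0; 2; 1]; [:: 1; 0; 1; 0; 2];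
      [:: 1; 0; 1; 1; 1]; [:: 1; 0; 2; 0; 1]; [:: 1; 1; 0; 0; 2]; [:: 1; 1; 0; 1; 1];
      [:: 1; 1; 1; 0; 1]; [:: 1; 2; 0; 0; 1];
      [:: 2; 0; 0; 0; 2]; [:: 2; 0; 0; 1; 1]; [:: 2; 0; 1; 0; 1]; [:: 2; 1; 0; 0; 1];
      [:: 3; 0; 0; 0; 1]]%N by [].
rewrite !big_cons big_nil !sa_termS.
pose ch a b c d := chain X (FP a) (FP b) (FP c) (FP d).
have chC a b c d : ch a b c d = ch a d c b.
  by apply: chainC => //; exact: frakP_T.
have chE a b c d : chain X (FP a) (FP b) (FP c) (FP d) = ch a b c d by [].
rewrite /fourth !chE; move: ch chC {chE} => ch chC.
rewrite /= !addn0 !add0n !(exprS, expr0).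
rewrite (chC _ 0%N 0%N 1%N) (chC _ 0%N 0%N 2%N) (chC _ 0%N 1%N 1%N); ring.
Qed.

End fourth_order_term.

(** * Weyl inequalities and the empirical projection *)

Section weyl.
Context {R : realType}.

Lemma exists_kernel m n (A : 'M[R]_(m, n)) : (m < n)%N ->
  exists2 x : 'cV[R]_n, x != 0 & A *m x = 0.
Proof.
move=> mn; have : kermx A^T != 0.
  rewrite -mxrank_eq0 mxrank_ker -lt0n subn_gt0.
  exact: leq_ltn_trans (rank_leq_col _) mn.
case/rowV0Pn => v /sub_kermxP vA v0; exists v^T.
  by apply: contraNneq v0 => h; rewrite -[v]trmxK h trmx0.
by apply: trmx_inj; rewrite trmx_mul trmxK vA trmx0.
Qed.

Lemma sqn_isometry m n (A : 'M[R]_(m, n)) x : A^T *m A = 1%:M -> sqn (A *m x) = sqn x.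
Proof. by move=> AA; rewrite /sqn dotvM mulmxA AA mul1mx. Qed.

Lemma opb_isometry m n (A : 'M[R]_(m, n)) : A^T *m A = 1%:M -> opb 1 A.
Proof. by move=> AA; split=> // x; rewrite sqn_isometry // expr1n mul1r. Qed.

Lemma diag_mulE n (c : 'rV[R]_n) (x : 'cV[R]_n) i : (diag_mx c *m x) i 0 = c 0 i * x i 0.
Proof. by rewrite mul_diag_mx mxE. Qed.

Lemma sqn_diag n (c : 'rV[R]_n) (x : 'cV[R]_n) :
  sqn (diag_mx c *m x) = \sum_i c 0 i ^+ 2 * x i 0 ^+ 2.
Proof. by apply: eq_bigr => i _; rewrite !diag_mulE; ring. Qed.

Lemma sqnE n (x : 'cV[R]_n) : sqn x = \sum_i x i 0 ^+ 2.
Proof. by apply: eq_bigr => i _; rewrite expr2. Qed.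

Lemma opb_diag n (c : 'rV[R]_n) a : 0 <= a -> (forall i, `|c 0 i| <= a) -> opb a (diag_mx c).
Proof.
move=> a0 ca; split=> // x; rewrite sqn_diag sqnE mulr_sumr; apply: ler_sum => i _.
rewrite ler_wpM2r ?sqr_ge0 // -real_normK ?num_real //.
by rewrite ler_sqr ?nnegrE.
Qed.

Lemma opb_symmetrize m n (A : 'M[R]_(m, n)) a : opb a A -> opb a (symmetrize A).
Proof.
move=> hA; have [a0 hA2] := opbT hA; case: (hA) => _ hA1; split=> // x.
rewrite -[x]vsubmxK /symmetrize mul_block_col !mul0mx add0r addr0.
rewrite /sqn !dotv_col mulrDr addrC; apply: lerD; [exact: hA2 | exact: hA1].
Qed.

Lemma symmetrizeT m n (A : 'M[R]_(m, n)) : (symmetrize A)^T = symmetrize A.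
Proof. by rewrite /symmetrize tr_block_mx !trmx0 trmxK. Qed.

Lemma symmetrizeD m n (A B : 'M[R]_(m, n)) : symmetrize (A + B) = symmetrize A + symmetrize B.
Proof. by rewrite /symmetrize add_block_mx !addr0 linearD. Qed.

Section svd.
Variables (d1 d2 m : nat) (P : 'M[R]_(d1, m)) (sigma : 'rV[R]_m) (Q : 'M[R]_(d2, m)).
Hypotheses (PP : P^T *m P = 1%:M) (QQ : Q^T *m Q = 1%:M).
Hypothesis mono : forall i j : 'I_m, (i <= j)%N -> sigma 0 j <= sigma 0 i.
Hypothesis sigma_ge0 : forall i, 0 <= sigma 0 i.
Let B := P *m diag_mx sigma *m Q^T.

(** The first [r - 1] columns of [Q] impose [r - 1] linear conditions on the
    [r]-dimensional range of [V], so some vector of norm one of this range is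
    orthogonal to them; [B] stretches it by at most [sigma_r] and, by
    hypothesis, by at least [l]. *)
Lemma weyl_lower r (i : 'I_m) (V : 'M[R]_(d2, r)) l : (0 < r)%N -> i = r.-1 :> nat ->
  V^T *m V = 1%:M -> 0 <= l ->
  (forall c, l ^+ 2 * sqn c <= sqn (B *m (V *m c))) -> l <= sigma 0 i.
Proof.
move=> r0 ir VV l0 hl.
have rm : (r.-1 <= m)%N by rewrite -ir ltnW.
pose C := rowsub (widen_ord rm) (Q^T *m V).
have [c c0 Cc] := exists_kernel C (etrans (ltn_predL r) r0).
pose z := Q^T *m (V *m c).
have z0 (j : 'I_m) : (j < r.-1)%N -> z j 0 = 0.
  move=> jr; have wj : widen_ord rm (Ordinal jr) = j by apply: val_inj.
  have -> : z j 0 = (C *m c) (Ordinal jr) 0 by rewrite /C mul_rowsub_mx [RHS]mxE wj /z mulmxA.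
  by rewrite Cc mxE.
have hz : sqn z <= sqn c.
  rewrite -(sqn_isometry c VV) /z.
  by have [_ h] := opbT (opb_isometry QQ); have := h (V *m c); rewrite expr1n mul1r.
have hB : sqn (B *m (V *m c)) <= sigma 0 i ^+ 2 * sqn c.
  rewrite /B -mulmxA -mulmxA sqn_isometry // sqn_diag -/z.
  apply: (@le_trans _ _ (sigma 0 i ^+ 2 * sqn z)); last by rewrite ler_wpM2l ?sqr_ge0.
  rewrite sqnE mulr_sumr; apply: ler_sum => j _.
  have [jr|rj] := ltnP j r.-1; first by rewrite z0 // expr0n !mulr0.
  have le_ji : sigma 0 j <= sigma 0 i by apply: mono; rewrite ir.
  by rewrite ler_wpM2r ?sqr_ge0 // !expr2 ler_pM.
have c1 : 0 < sqn c by rewrite lt_def sqn_eq0 c0 sqn_ge0.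
have := le_trans (hl c) hB; rewrite ler_pM2r // ler_sqr ?nnegrE //.
Qed.

(** The span of the first [r + 1] columns of [Q] contains a nonzero vector of
    the kernel of [V^T]; [B] stretches it by at least [sigma_(r + 1)] and, by
    hypothesis, by at most [N]. *)
Lemma weyl_upper r (i : 'I_m) (V : 'M[R]_(d2, r)) N : i = r :> nat -> 0 <= N ->
  (forall y, V^T *m y = 0 -> sqn (B *m y) <= N ^+ 2 * sqn y) -> sigma 0 i <= N.
Proof.
move=> ir N0 hN.
have rm : (r.+1 <= m)%N by rewrite -ir.
pose w := colsub (widen_ord rm) (1%:M : 'M[R]_m).
have [c c0 Cc] := exists_kernel (V^T *m Q *m w) (ltnSn r).
pose e := w *m c.
have ww : w^T *m w = 1%:M.
  apply/matrixP => a b; rewrite !mxE (bigD1 (widen_ord rm a)) //= big1 => [|j ja].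
    by rewrite !mxE eqxx mul1r addr0.
  by rewrite !mxE (negbTE ja) mul0r.
have e0 (j : 'I_m) : (r < j)%N -> e j 0 = 0.
  move=> rj; rewrite /e mxE big1 // => k _; rewrite !mxE.
  have -> : (j == widen_ord rm k) = false.
    by apply/negbTE; rewrite -val_eqE /= neq_ltn (leq_trans (ltn_ord k) rj) orbT.
  by rewrite mul0r.
have VQe : V^T *m (Q *m e) = 0 by rewrite /e !mulmxA.
have h := hN _ VQe; rewrite (sqn_isometry e QQ) in h.
have hB : sigma 0 i ^+ 2 * sqn e <= sqn (B *m (Q *m e)).
  rewrite /B -!mulmxA sqn_isometry // (mulmxA Q^T) QQ mul1mx sqn_diag sqnE mulr_sumr.
  apply: ler_sum => j _; have [jr|rj] := leqP j r; last by rewrite e0 // expr0n !mulr0.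
  have le_ij : sigma 0 i <= sigma 0 j by apply: mono; rewrite ir.
  by rewrite ler_wpM2r ?sqr_ge0 // !expr2 ler_pM.
have c1 : 0 < sqn e by rewrite /e sqn_isometry // lt_def sqn_eq0 c0 sqn_ge0.
by have := le_trans hB h; rewrite ler_pM2r // ler_sqr ?nnegrE.
Qed.

End svd.
End weyl.

Section empirical_projector.
Context {R : realType} {d1 d2 r : nat}.
Variables (U : 'M[R]_(d1, r)) (lam : 'rV[R]_r) (V : 'M[R]_(d2, r)) (r_gt0 : (0 < r)%N).
Hypothesis svd : compact_svd U lam V.
Local Notation n := (d1 + d2)%N.
Let lamr := lam 0 (last_ord r_gt0).
Variables (Z : 'M[R]_(d1, d2)) (N : R).
Hypothesis hZ : opb N Z.
Variables (Uh : 'M[R]_(d1, r)) (Vh : 'M[R]_(d2, r)).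
Let B := U *m diag_mx lam *m V^T + Z.
Hypothesis htop : top_singular_vectors B Uh Vh.

Definition eproj : 'M[R]_n := block_mx (Uh *m Uh^T) 0 0 (Vh *m Vh^T).

Lemma gram_colsub m k (P : 'M[R]_(k, m)) (hr : (r <= m)%N) :
  colsub (widen_ord hr) P *m (colsub (widen_ord hr) P)^T
  = P *m diag_mx (\row_(i < m) (i < r)%:R) *m P^T.
Proof.
apply/matrixP => i j; rewrite !mxE.
transitivity (\sum_(a < m | (a < r)%N) P i a * P j a).
  by rewrite (big_ord_narrow hr); apply: eq_bigr => a _; rewrite !mxE.
rewrite big_mkcond; apply: eq_bigr => a _; rewrite mul_mx_diag !mxE.
by case: ifP; rewrite ?mulr1 // mulr0 mul0r.
Qed.

Lemma signal_bound c : lamr ^+ 2 * sqn c <= sqn (U *m diag_mx lam *m V^T *m (V *m c)).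
Proof.
case: (svd) => UU VV _ l0.
rewrite -[_ *m V^T *m _]mulmxA (mulmxA V^T) VV mul1mx -mulmxA sqn_isometry //.
rewrite sqn_diag sqnE mulr_sumr; apply: ler_sum => i _.
by rewrite ler_wpM2r ?sqr_ge0 // !expr2 ler_pM ?(ltW (l0 _)) // (lamr_le _ svd).
Qed.

(** The first [r] singular values of the perturbed matrix are at least
    [lamr - N] and the others at most [N], by the two Weyl inequalities. The
    perturbed matrix and both empirical projections are all of the form
    [P diag Q^T], so the identities below reduce to identities between
    diagonals. *)
Lemma empirical_svd : exists (m : nat) (P : 'M[R]_(d1, m)) (sigma : 'rV[R]_m) (Q : 'M[R]_(d2, m)),
  [/\ P^T *m P = 1%:M, Q^T *m Q = 1%:M, B = P *m diag_mx sigma *m Q^T,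
    Uh *m Uh^T = P *m diag_mx (\row_(i < m) (i < r)%:R) *m P^T /\
    Vh *m Vh^T = Q *m diag_mx (\row_(i < m) (i < r)%:R) *m Q^T &
   [/\ (forall i : 'I_m, (i < r)%N -> lamr - N <= sigma 0 i),
       (forall i : 'I_m, (r <= i)%N -> 0 <= sigma 0 i <= N) & (r <= m)%N ]].
Proof.
case: htop => P [sigma [Q [hr [[PP QQ mono s0] BE -> ->]]]].
exists _, P, sigma, Q; rewrite !gram_colsub; split=> //.
case: (svd) => UU VV _ l0; case: (hZ) => N0 hZ2.
split=> //.
- move=> i ir.
  have [l_neg|l_pos] := ltP (lamr - N) 0; first by apply: ltW; apply: lt_le_trans l_neg _.
  have im : (r.-1 < minn d1 d2)%N by rewrite prednK.
  apply: (@le_trans _ _ (sigma 0 (Ordinal im))); last first.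
    by apply: mono; rewrite /= -ltnS prednK.
  apply: (@weyl_lower _ _ _ _ P sigma Q PP QQ mono s0 r (Ordinal im) V) => // c.
  rewrite -BE; set q := sqn c.
  have hM := signal_bound c; have hZc := hZ2 (V *m c).
  rewrite (sqn_isometry c VV) in hZc.
  have sq : Num.sqrt q ^+ 2 = q by rewrite sqr_sqrtr // sqn_ge0.
  have sq0 := sqrtr_ge0 q.
  have b0 := sqrtr_ge0 (sqn (B *m (V *m c))).
  have bE : Num.sqrt (sqn (B *m (V *m c))) ^+ 2 = sqn (B *m (V *m c)) by rewrite sqr_sqrtr // sqn_ge0.
  (* Triangle inequality for the signal, written as the perturbed matrix
     minus the noise. *)
  have tri : sqn (U *m diag_mx lam *m V^T *m (V *m c))
      <= (Num.sqrt (sqn (B *m (V *m c))) + N * Num.sqrt q) ^+ 2.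
    have -> : U *m diag_mx lam *m V^T *m (V *m c) = B *m (V *m c) + (- Z) *m (V *m c).
      by rewrite -mulmxDl /B addrK.
    apply: sqnD_le; rewrite ?bE // ?mulr_ge0 // exprMn sq.
    by rewrite mulNmx -scaleN1r sqnZ sqrrN expr1n mul1r.
  have h : lamr * Num.sqrt q <= Num.sqrt (sqn (B *m (V *m c))) + N * Num.sqrt q.
    rewrite -ler_sqr ?nnegrE ?addr_ge0 ?mulr_ge0 // ?(ltW (l0 _)) //.
    by rewrite exprMn sq; exact: le_trans tri.
  rewrite -bE -sq -exprMn ler_sqr ?nnegrE ?mulr_ge0 //.
  by rewrite mulrBl lerBlDr.
- move=> i ri; rewrite s0 /=.
  have im : (r < minn d1 d2)%N by apply: leq_ltn_trans (ltn_ord i).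
  apply: (@le_trans _ _ (sigma 0 (Ordinal im))); first exact: mono.
  apply: (@weyl_upper _ _ _ _ P sigma Q PP QQ mono s0 r (Ordinal im) V) => // y Vy.
  by rewrite -BE /B mulmxDl -(mulmxA _ V^T) Vy mulmx0 add0r.
Qed.

Lemma eprojT : eproj^T = eproj.
Proof. by rewrite /eproj tr_block_mx !trmx0 !trmx_mul !trmxK. Qed.

Lemma diag_form_mul k1 k2 k3 m (P : 'M[R]_(k1, m)) (Q : 'M[R]_(k2, m)) (S : 'M[R]_(k3, m))
    (a b : 'rV[R]_m) : Q^T *m Q = 1%:M ->
  (P *m diag_mx a *m Q^T) *m (Q *m diag_mx b *m S^T)
  = P *m diag_mx (\row_i (a 0 i * b 0 i)) *m S^T.
Proof.
move=> QQ; rewrite -!mulmxA (mulmxA Q^T) QQ mul1mx (mulmxA (diag_mx a)).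
by rewrite mulmx_diag.
Qed.

Lemma diag_formT k1 k2 m (P : 'M[R]_(k1, m)) (Q : 'M[R]_(k2, m)) (a : 'rV[R]_m) :
  (P *m diag_mx a *m Q^T)^T = Q *m diag_mx a *m P^T.
Proof. by rewrite !trmx_mul trmxK tr_diag_mx mulmxA. Qed.

Lemma eproj_idem : eproj *m eproj = eproj.
Proof.
have [m [P [sigma [Q [PP QQ BE [UE VE] _]]]]] := empirical_svd.
rewrite /eproj mulmx_block !mul0mx !mulmx0 !addr0 add0r UE VE !diag_form_mul //.
have -> : \row_i ((\row_(i0 < m) (i0 < r)%:R) 0 i * (\row_(i0 < m) (i0 < r)%:R) 0 i)
   = \row_(i0 < m) (i0 < r)%:R :> 'rV[R]_m.
  by apply/rowP => i; rewrite !mxE; case: (_ < _)%N; rewrite ?mulr1 ?mulr0.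
by [].
Qed.

Lemma tr_eproj : \tr eproj = 2 * r%:R.
Proof.
have [m [P [sigma [Q [PP QQ BE [UE VE] [_ _ rm]]]]]] := empirical_svd.
have h k (S : 'M[R]_(k, m)) : S^T *m S = 1%:M ->
    \tr (S *m diag_mx (\row_(i < m) (i < r)%:R) *m S^T) = r%:R.
  move=> SS; rewrite -mulmxA mxtrace_mulC -mulmxA SS mulmx1 mxtrace_diag.
  transitivity (\sum_(i < m | (i < r)%N) 1 : R).
    by rewrite [RHS]big_mkcond; apply: eq_bigr => i _; rewrite mxE; case: ifP.
  by rewrite (big_ord_narrow rm) sumr_const card_ord.
rewrite /eproj mxtrace_block UE VE !h //; ring.
Qed.

Lemma eproj_comm : eproj *m symmetrize B = symmetrize B *m eproj.
Proof.
have [m [P [sigma [Q [PP QQ BE [UE VE] _]]]]] := empirical_svd.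
rewrite /eproj /symmetrize !mulmx_block !mul0mx !mulmx0 !addr0 !add0r UE VE BE.
rewrite diag_formT !diag_form_mul //.
by congr block_mx; congr (_ *m diag_mx _ *m _); apply/rowP => i; rewrite !mxE mulrC.
Qed.

Lemma opb_rest : opb N ((1%:M - eproj) *m symmetrize B).
Proof.
have [m [P [sigma [Q [PP QQ BE [UE VE] [_ hs _]]]]]] := empirical_svd.
have -> : (1%:M - eproj) *m symmetrize B
   = symmetrize (P *m diag_mx (\row_i (sigma 0 i * (r <= i)%:R)) *m Q^T).
  rewrite mulmxBl mul1mx /eproj /symmetrize !mulmx_block !mul0mx !mulmx0 !addr0 !add0r UE VE BE.
  rewrite !diag_formT !diag_form_mul // opp_block_mx add_block_mx !subr0.
  have sub k1 k2 (S1 : 'M[R]_(k1, m)) (S2 : 'M[R]_(k2, m)) :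
      S1 *m diag_mx sigma *m S2^T
      - S1 *m diag_mx (\row_i ((\row_(i0 < m) (i0 < r)%:R) 0 i * sigma 0 i)) *m S2^T
      = S1 *m diag_mx (\row_i (sigma 0 i * (r <= i)%:R)) *m S2^T.
    rewrite -mulmxBl -mulmxBr -raddfB; congr (_ *m diag_mx _ *m _).
    by apply/rowP => i; rewrite !mxE ltnNge; case: (r <= i)%N; rewrite /= ?mul0r ?mul1r ?mulr1 ?mulr0 ?subr0 ?subrr.
  by rewrite !sub.
apply: opb_symmetrize; case: (hZ) => N0 _.
have hd : opb N (diag_mx (\row_i (sigma 0 i * (r <= i)%:R))).
  apply: opb_diag => // i; rewrite mxE; case: leqP => ri; last by rewrite mulr0 normr0.
  by rewrite mulr1; have /andP[a b] := hs i ri; rewrite ger0_norm.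
have := opbM (opbM (opb_isometry PP) hd) (opbT (opb_isometry QQ)).
by rewrite mul1r mulr1.
Qed.

(** [K] inverts the [r] leading singular values and vanishes on the other
    singular directions. *)
Lemma eproj_inverse : N < lamr ->
  exists2 K : 'M[R]_n, opb (lamr - N)^-1 K & symmetrize B *m K = eproj.
Proof.
move=> Nl; have d0 : 0 < lamr - N by rewrite subr_gt0.
have [m [P [sigma [Q [PP QQ BE [UE VE] [hs _ _]]]]]] := empirical_svd.
pose k : 'rV[R]_m := \row_i ((i < r)%:R / sigma 0 i).
exists (symmetrize (P *m diag_mx k *m Q^T)).
  apply: opb_symmetrize.
  have hd : opb (lamr - N)^-1 (diag_mx k).
    apply: opb_diag => [|i]; first by rewrite invr_ge0 ltW.
    rewrite mxE; case: ltnP => ri; last by rewrite mul0r normr0 invr_ge0 ltW.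
    have si := hs i ri; have s0 := lt_le_trans d0 si.
    by rewrite mul1r ger0_norm ?invr_ge0 ?(ltW s0) // lef_pV2 ?posrE.
  have := opbM (opbM (opb_isometry PP) hd) (opbT (opb_isometry QQ)).
  by rewrite mul1r mulr1.
rewrite /eproj /symmetrize mulmx_block !mul0mx !mulmx0 !addr0 !add0r UE VE BE.
rewrite !diag_formT !diag_form_mul //.
by congr block_mx; congr (_ *m diag_mx _ *m _); apply/rowP => i; rewrite !mxE;
  case: ltnP => ri; rewrite ?mul0r ?mulr0 // mul1r mulfV // gt_eqF //;
  exact: lt_le_trans d0 (hs i ri).
Qed.

End empirical_projector.

(** * Deterministic expansion of the distance *)

Section projector_equations.
Context {R : realType} {n : nat}.
Variables (Pi W Ph P A X G E H : 'M[R]_n).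
Hypotheses (WE : W = 1%:M - Pi) (PiPi : Pi *m Pi = Pi) (PiT : Pi^T = Pi) (PhT : Ph^T = Ph).
Hypotheses (PiP : Pi *m P = P) (AP : A *m P = Pi) (WA : W *m A = 0).
Hypotheses (PhPh : Ph *m Ph = Ph) (comm : Ph *m (A + X) = (A + X) *m Ph).
Hypotheses (GE : G = Pi - Pi *m Ph *m Pi) (EE : E = W *m Ph *m Pi) (HE : H = W *m Ph *m W).

Let WT : W^T = W. Proof. by rewrite WE linearB /= trmx1 PiT. Qed.
Let WW : W *m W = W.
Proof. by rewrite {1}WE mulmxBl mul1mx WE mulmxBr mulmx1 PiPi subrr subr0. Qed.

Let PW1 : Pi + W = 1%:M. Proof. by rewrite WE addrC subrK. Qed.

(** Multiply the relation [Ph (A + X) = (A + X) Ph] by [W] on the left and by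
    [P] on the right. The signal disappears because [W A = 0] and [A P = Pi];
    writing [Ph P] and [W Ph] in terms of [E], [G], [H] gives the equation. *)
Lemma proj_eqE : E = pE1 W P X + pstep W P X E G H.
Proof.
have key : W *m X *m Ph *m P = E + W *m Ph *m X *m P.
  have h1 : W *m X = W *m (A + X) by rewrite mulmxDr WA add0r.
  by rewrite h1 -(mulmxA W) -comm -!mulmxA mulmxDl AP !mulmxDr EE !mulmxA.
have PhPi : Ph *m Pi = Pi - G + E.
  by rewrite GE EE WE !mulmxBl mul1mx opprB; mxlin.
have h2 : Ph *m P = P - G *m P + E *m P by rewrite -{1}PiP mulmxA PhPi mulmxDl mulmxBl PiP.
have h3 : W *m Ph = E + H by rewrite EE HE -mulmxDr PW1 mulmx1.
have h4 : E = W *m X *m (Ph *m P) - (E + H) *m X *m P by rewrite -h3 mulmxA key addrK.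
rewrite [LHS]h4 h2 /pE1 /pstep; move: E G H => E' G' H'.
rewrite !(mulmxDr, mulmxDl, mulmxN, mulNmx) !mulmxA.
by apply/matrixP => i j; rewrite !(addmxE, oppmxE); ring.
Qed.

Lemma proj_split (L : 'M[R]_n) : L *m Ph *m L = L *m Ph *m W *m Ph *m L + L *m Ph *m Pi *m Ph *m L.
Proof.
have -> : L *m Ph *m W *m Ph *m L + L *m Ph *m Pi *m Ph *m L = L *m Ph *m (Pi + W) *m Ph *m L.
  by rewrite mulmxDr !mulmxDl addrC.
by rewrite PW1 mulmx1 -(mulmxA L Ph Ph) PhPh.
Qed.

(** The relation [Ph ^ 2 = Ph] compressed to the range of [Pi]. *)
Lemma proj_eqG : G = E^T *m E + G *m G.
Proof.
have ET : E^T = Pi *m Ph *m W by rewrite EE !trmx_mul PiT PhT WT mulmxA.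
have EtE : E^T *m E = Pi *m Ph *m W *m Ph *m Pi by rewrite ET EE !mulmxA -(mulmxA _ W W) WW.
have s := proj_split Pi; rewrite -EtE in s.
have q : Pi *m Ph *m Pi *m Ph *m Pi = (Pi - G) *m (Pi - G).
  by rewrite GE opprB addrC subrK !mulmxA -(mulmxA _ Pi Pi) PiPi.
have PiG : Pi *m G = G by rewrite GE mulmxBr !mulmxA PiPi.
have GPi : G *m Pi = G by rewrite GE mulmxBl -!mulmxA PiPi.
rewrite q mulmxBl !mulmxBr PiPi PiG GPi in s.
have t : Pi *m Ph *m Pi = Pi - G by rewrite GE opprB addrC subrK.
rewrite t in s; apply/matrixP => i j.
have := congr1 (fun M : 'M[R]_n => M i j) s; rewrite !(addmxE, oppmxE) => h.
by lra.
Qed.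

(** The relation [Ph ^ 2 = Ph] compressed to the range of [W]. *)
Lemma proj_eqH : H = E *m E^T + H *m H.
Proof.
have ET : E^T = Pi *m Ph *m W by rewrite EE !trmx_mul PiT PhT WT mulmxA.
rewrite ET EE HE !mulmxA -(mulmxA _ Pi Pi) PiPi -(mulmxA _ W W) WW addrC.
exact: proj_split.
Qed.

End projector_equations.

(** The expansion has rank at most that of [Pi], as does [G] itself; this
    turns operator norm bounds into trace bounds with a factor [2 r]. *)
Lemma pG_range (R : realType) n (Pi W P X : 'M[R]_n) : Pi^T = Pi -> P *m Pi = P ->
  Pi *m pG W P X = pG W P X.
Proof.
move=> PiT PPi.
have s Y g h : pstep W P X Y g h *m Pi = pstep W P X Y g h.
  by rewrite /pstep !mulmxBl -!(mulmxA _ P Pi) PPi.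
have h1 : pE1 W P X *m Pi = pE1 W P X by rewrite /pE1 -mulmxA PPi.
have h2 : pE2 W P X *m Pi = pE2 W P X by rewrite /pE2 mulmxBl -!(mulmxA _ P Pi) PPi.
have h3 : pE3 W P X *m Pi = pE3 W P X by exact: s.
have h4 : pE4 W P X *m Pi = pE4 W P X by exact: s.
have t (Y B : 'M[R]_n) : Y *m Pi = Y -> Pi *m (Y^T *m B) = Y^T *m B.
  by move=> hY; rewrite mulmxA -{1}PiT -trmx_mul hY.
have g2 : Pi *m pG2 W P X = pG2 W P X by exact: t h1.
have g3 : Pi *m pG3 W P X = pG3 W P X by rewrite /pG3 mulmxDr (t _ _ h1) (t _ _ h2).
have u (Y B : 'M[R]_n) : Pi *m Y = Y -> Pi *m (Y *m B) = Y *m B by move=> hY; rewrite mulmxA hY.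
have g4 : Pi *m pG4 W P X = pG4 W P X.
  by rewrite /pG4 3!mulmxDr (t _ _ h1) (t _ _ h2) (t _ _ h3) (u _ _ g2).
have g5 : Pi *m pG5 W P X = pG5 W P X.
  by rewrite /pG5 5!mulmxDr (t _ _ h1) (t _ _ h2) (t _ _ h3) (t _ _ h4) (u _ _ g2) (u _ _ g3).
by rewrite /pG 3!mulmxDr g2 g3 g4 g5.
Qed.

Section deterministic_bound.
Context {R : realType} {d1 d2 r : nat}.
Variables (U : 'M[R]_(d1, r)) (lam : 'rV[R]_r) (V : 'M[R]_(d2, r)) (r_gt0 : (0 < r)%N).
Hypothesis svd : compact_svd U lam V.
Local Notation n := (d1 + d2)%N.
Let lamr := lam 0 (last_ord r_gt0).
Variables (Z : 'M[R]_(d1, d2)) (N : R).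
Hypothesis hZ : opb N Z.
Variables (Uh : 'M[R]_(d1, r)) (Vh : 'M[R]_(d2, r)).
Local Notation A := (symmetrize (U *m diag_mx lam *m V^T)).
Local Notation B := (U *m diag_mx lam *m V^T + Z).
Hypothesis htop : top_singular_vectors B Uh Vh.

Local Notation X := (symmetrize Z).
Local Notation Ph := (eproj Uh Vh).
Let Pi := Theta U V *m (Theta U V)^T.
Let W := frakP U lam V 0.
Let P := frakP U lam V 1.
Let e := N / lamr.

Let lamr_gt0 : 0 < lamr. Proof. exact: (lamr_gt0 r_gt0 svd). Qed.
Let N0 : 0 <= N. Proof. by case: hZ. Qed.
Let e0 : 0 <= e. Proof. by rewrite /e divr_ge0 // ltW. Qed.
Let WE : W = 1%:M - Pi. Proof. by []. Qed.
Let PiPi : Pi *m Pi = Pi. Proof. exact: PiPi svd. Qed.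
Let PiT : Pi^T = Pi. Proof. by rewrite /Pi Pi_spec specT. Qed.
Let PT : P^T = P. Proof. exact: frakP_T. Qed.
Let WT : W^T = W. Proof. exact: frakP_T. Qed.
Let WW : W *m W = W. Proof. exact: frakWW svd. Qed.
Let PiP : Pi *m P = P. Proof. exact: PiP svd 0. Qed.
Let PPi : P *m Pi = P. Proof. by apply: trmx_inj; rewrite trmx_mul PiT PT PiP. Qed.
Let AP : A *m P = Pi. Proof. exact: signal_P svd. Qed.
Let WA : W *m A = 0. Proof. exact: signal_W svd. Qed.
Let XT : X^T = X. Proof. exact: symmetrizeT. Qed.
Let hX : opb N X. Proof. exact: opb_symmetrize. Qed.
Let hW : opb 1 W. Proof. exact: opb_W svd. Qed.
Let hPi : opb 1 Pi. Proof. exact: opb_Pi svd. Qed.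
Let hP : opb lamr^-1 P. Proof. exact: opb_P1 svd. Qed.
Let BE : symmetrize B = A + X. Proof. exact: symmetrizeD. Qed.
Let PhT : Ph^T = Ph. Proof. exact: eprojT. Qed.
Let PhPh : Ph *m Ph = Ph. Proof. exact: (eproj_idem r_gt0 svd hZ htop). Qed.
Let comm : Ph *m (A + X) = (A + X) *m Ph. Proof. by rewrite -BE; exact: (eproj_comm r_gt0 svd hZ htop). Qed.

Let G := Pi - Pi *m Ph *m Pi.
Let E := W *m Ph *m Pi.
Let H := W *m Ph *m W.

(** The distance is the squared Frobenius norm of [Ph - Pi], that is
    [tr Ph + tr Pi - 2 tr (Pi Ph)], and both projections have trace [2 r]. *)
Lemma dist2_trG : dist2 Uh Vh U V = 2 * \tr G.
Proof.
have tG : \tr G = 2 * r%:R - \tr (Pi *m Ph).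
  by rewrite /G raddfB /= (tr_Pi svd) mxtrace_mulC mulmxA PiPi.
have tt : \tr ((Ph - Pi) *m (Ph - Pi)) = 2 * \tr G.
  rewrite tG mulmxBl !mulmxBr PhPh PiPi !raddfB /= (tr_eproj r_gt0 svd hZ htop) (tr_Pi svd).
  by rewrite [\tr (Ph *m Pi)]mxtrace_mulC; ring.
rewrite -tt /dist2 !frobenius_sq.
have fro k (S : 'M[R]_k) : S^T = S -> \sum_i \sum_j S i j ^+ 2 = \tr (S *m S).
  move=> ST; apply: eq_bigr => i _; rewrite mxE; apply: eq_bigr => j _.
  by rewrite -{3}ST mxE expr2.
have -> : Ph - Pi = block_mx (Uh *m Uh^T - U *m U^T) 0 0 (Vh *m Vh^T - V *m V^T).
  by rewrite /eproj /Pi Pi_block opp_block_mx add_block_mx !subr0.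
rewrite mulmx_block !mul0mx !mulmx0 !addr0 add0r mxtrace_block !fro //.
- by rewrite linearB /= !trmx_mul !trmxK.
- by rewrite linearB /= !trmx_mul !trmxK.
Qed.

Let eqE : E = pE1 W P X + pstep W P X E G H.
Proof. exact: (proj_eqE WE PiP AP WA comm). Qed.
Let eqG : G = E^T *m E + G *m G.
Proof. exact: (proj_eqG WE PiPi PiT PhT PhPh). Qed.
Let eqH : H = E *m E^T + H *m H.
Proof. exact: (proj_eqH WE PiPi PiT PhT PhPh). Qed.

Let stepl c (Y : 'M[R]_n) : opb c Y -> opb (c * e) (W *m X *m Y *m P).
Proof.
move=> hY; have := opbM (opbM (opbM hW hX) hY) hP.
by rewrite mul1r /e (mulrC N c) mulrA.
Qed.

Let stepr c (Y : 'M[R]_n) : opb c Y -> opb (c * e) (Y *m X *m P).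
Proof.
move=> hY; have := opbM (opbM hY hX) hP.
by rewrite /e mulrA.
Qed.

Let GE2 : G = ((1%:M - Ph) *m Pi)^T *m ((1%:M - Ph) *m Pi).
Proof.
have CT : (1%:M - Ph)^T = 1%:M - Ph by rewrite linearB /= trmx1 PhT.
have CC : (1%:M - Ph) *m (1%:M - Ph) = 1%:M - Ph.
  by rewrite mulmxBl mul1mx mulmxBr mulmx1 PhPh subrr subr0.
rewrite trmx_mul CT PiT mulmxA -(mulmxA Pi) CC mulmxBr mulmx1 mulmxBl PiPi.
by [].
Qed.

Let opb_G1 : opb 1 G.
Proof.
have CT : (1%:M - Ph)^T = 1%:M - Ph by rewrite linearB /= trmx1 PhT.
have CC : (1%:M - Ph) *m (1%:M - Ph) = 1%:M - Ph.
  by rewrite mulmxBl mul1mx mulmxBr mulmx1 PhPh subrr subr0.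
have h := opbM (opb_proj CT CC) hPi; rewrite mulr1 in h.
by rewrite GE2; have := opbM (opbT h) h; rewrite mulr1.
Qed.

Let Pi_pG : Pi *m pG W P X = pG W P X.
Proof. exact: pG_range. Qed.

Let Pi_G : Pi *m G = G.
Proof. by rewrite /G mulmxBr (mulmxA Pi (Pi *m Ph)) (mulmxA Pi Pi Ph) PiPi. Qed.

(** [W Ph] is of first order because [Ph = (A + X) K] and [W A = 0];
    [(1 - Ph) Pi] is of first order because [Pi = A P] and [(1 - Ph) (A + X)]
    is bounded by the small singular values, [(1 - Ph) X] by the noise. [G]
    and [H] are squares of these, hence of second order. *)
Let apriori : e <= 8^-1 -> [/\ ordb e 2 1 E, ordb e 4 2 G & ordb e 4 2 H].
Proof.
move=> e8; have Nl : N <= lamr / 8.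
  by move: e8; rewrite /e ler_pdivrMr // mulrC.
have Nlt : N < lamr by apply: le_lt_trans Nl _; move: lamr_gt0; lra.
have [K hK KE] := eproj_inverse svd hZ htop Nlt.
have hWPh : opb (2 * e) (W *m Ph).
  have -> : W *m Ph = W *m X *m K by rewrite -KE BE mulmxA mulmxDr WA add0r.
  have := opbM (opbM hW hX) hK; apply: opb_le.
  rewrite mul1r /e mulrCA ler_wpM2l // -[X in X <= _]mul1r ler_pdivrMr ?subr_gt0 //.
  by rewrite mulrAC ler_pdivlMr // mul1r -/lamr; move: lamr_gt0 Nl; lra.
have hC : opb (2 * e) ((1%:M - Ph) *m Pi).
  have CT : (1%:M - Ph)^T = 1%:M - Ph by rewrite linearB /= trmx1 PhT.
  have CC : (1%:M - Ph) *m (1%:M - Ph) = 1%:M - Ph.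
    by rewrite mulmxBl mul1mx mulmxBr mulmx1 PhPh subrr subr0.
  have -> : (1%:M - Ph) *m Pi = ((1%:M - Ph) *m (A + X) - (1%:M - Ph) *m X) *m P.
    by rewrite -mulmxBr addrK -(mulmxA _ A P) AP.
  have hr := opb_rest r_gt0 svd hZ htop; rewrite BE in hr.
  have := opbM (opbB hr (opbM (opb_proj CT CC) hX)) hP; apply: opb_le.
  by rewrite /e; lra.
split; rewrite /ordb ?expr1.
- by have := opbM hWPh hPi; rewrite mulr1.
- rewrite GE2; have := opbM (opbT hC) hC; apply: opb_le.
  by rewrite expr2; lra.
- have -> : H = (W *m Ph) *m (W *m Ph)^T.
    by rewrite /H trmx_mul PhT WT mulmxA -(mulmxA W Ph Ph) PhPh.
  have := opbM hWPh (opbT hWPh); apply: opb_le.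
  by rewrite expr2; lra.
Qed.

(** For [e <= 1 / 8] this is the bootstrap estimate [rest_G5] times the rank
    [2 r]. For larger [e] all traces are at most multiples of [r (8 e) ^ 6],
    because [8 e >= 1]. *)
Lemma dist2_expansion :
  `|dist2 Uh Vh U V - 2 * \tr (pG W P X)| <= (4 * (240 * 100) + 12 * 8 ^+ 6) * r%:R * e ^+ 6.
Proof.
rewrite dist2_trG -mulrBr normrM ger0_norm //.
have e6 : 0 <= e ^+ 6 by exact: exprn_ge0.
have r0 : 0 <= r%:R :> R by [].
have re0 : 0 <= r%:R * e ^+ 6 by exact: mulr_ge0.
have trB c (Y : 'M[R]_n) : Pi *m Y = Y -> opb c Y -> `|\tr Y| <= 2 * r%:R * c.
  by move=> hPY hY; rewrite -hPY; apply: (tr_Pi_le svd hY).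
have [e8|e8] := leP e 8^-1.
  have e1 : e <= 1 by apply: le_trans e8 _; lra.
  have [OE OG OH] := apriori e8.
  have h := rest_G5 e0 stepl stepr e1 OE OG OH eqE eqG eqH.
  have := trB _ _ _ h; rewrite mulmxBr Pi_G Pi_pG => /(_ erefl).
  rewrite raddfB /= => hh; apply: le_trans (ler_wpM2l _ hh) _ => //.
  have -> : 2 * (2 * r%:R * (240 * 100 * e ^+ 6)) = (4 * (240 * 100)) * (r%:R * e ^+ 6) by ring.
  rewrite -[X in _ <= X]mulrA ler_wpM2r // lerDl mulr_ge0 // exprn_ge0 //.
set t := 8 * e; have t1 : 1 <= t by rewrite /t; lra.
have et : e = t / 8 by rewrite /t; field.
have tG : `|\tr G| <= 2 * r%:R * 1 by exact: trB.
have tpG : `|\tr (pG W P X)| <= 2 * r%:R * (1 * e ^+ 2 + 4 * e ^+ 3 + 17 * e ^+ 4 + 72 * e ^+ 5).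
  apply: trB => //; rewrite /pG.
  by do ![apply: opbD]; [exact: ordb_G2|exact: ordb_G3|exact: ordb_G4|exact: ordb_G5].
have tk k : (k <= 6)%N -> t ^+ k <= t ^+ 6 by move=> k6; rewrite ler_weXn2l.
have s : 1 * e ^+ 2 + 4 * e ^+ 3 + 17 * e ^+ 4 + 72 * e ^+ 5 <= 2 * t ^+ 6.
  rewrite et !expr_div_n.
  have := tk 2%N isT; have := tk 3%N isT; have := tk 4%N isT; have := tk 5%N isT.
  have := tk 0%N isT; rewrite expr0.
  move: (t ^+ 2) (t ^+ 3) (t ^+ 4) (t ^+ 5) (t ^+ 6) => a b c d f.
  rewrite !(exprS, expr0); lra.
have t6 : 1 <= t ^+ 6 by have := tk 0%N isT; rewrite expr0.
have -> : (4 * (240 * 100) + 12 * 8 ^+ 6) * r%:R * e ^+ 6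
  = 4 * (240 * 100) * (r%:R * e ^+ 6) + 12 * (r%:R * t ^+ 6).
  have -> : t ^+ 6 = 8 ^+ 6 * e ^+ 6 by exact: exprMn.
  by move: (8 ^+ 6 : R) (e ^+ 6) => a b; ring.
apply: ler_wpDl; first by apply: mulr_ge0 => //; rewrite !mulr_ge0 ?ler0n.
apply: (@le_trans _ _ (2 * (2 * r%:R * 1 + 2 * r%:R * (2 * t ^+ 6)))).
  rewrite ler_wpM2l //; apply: le_trans (ler_normB _ _) _; apply: lerD => //.
  by apply: le_trans tpG _; rewrite ler_wpM2l // mulr_ge0.
have : r%:R * 1 <= r%:R * t ^+ 6 by rewrite ler_wpM2l.
lra.
Qed.

End deterministic_bound.

(** * Sixth moment of the operator norm of the noise *)

Section net.
Context {R : realType}.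
Variable D : nat.
Hypothesis D0 : (0 < D)%N.

(** Grid points of [netpt]: each coordinate has a sign and an absolute value
    [k / mesh] with [k <= 4 * D], which reaches at least 1. *)
Definition netidx d := {ffun 'I_d -> bool * 'I_(4 * D).+1}.
(** The inverse of the grid step, chosen so that a rounding error of one step
    in each of at most [D] coordinates has norm at most [1 / 4]. *)
Definition mesh : R := 4 * Num.sqrt D%:R.
Definition netpt d (a : netidx d) : 'cV[R]_d :=
  \col_i ((-1) ^+ (a i).1 * (a i).2%:R / mesh).

Let sD : 0 < Num.sqrt D%:R :> R. Proof. by rewrite sqrtr_gt0 ltr0n. Qed.
Let mesh_gt0 : 0 < mesh. Proof. by rewrite /mesh mulr_gt0. Qed.
Let mesh2 : mesh ^+ 2 = 16 * D%:R.
Proof. by rewrite /mesh exprMn sqr_sqrtr // -natrX. Qed.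

Lemma netptE d (a : netidx d) i : netpt a i 0 ^+ 2 = (a i).2%:R ^+ 2 / (16 * D%:R).
Proof. by rewrite mxE !exprMn sqrr_sign mul1r exprVn mesh2. Qed.

(** An integer is at most its square, and the squares add up to at most
    [mesh ^+ 2]. This bounds from below the weights used in [net_exp]. *)
Lemma net_sum_le d (a : netidx d) : sqn (netpt a) <= 1 ->
  (\sum_i (a i).2 : nat)%:R <= 16 * D%:R :> R.
Proof.
rewrite sqnE => h; have m0 : 0 < 16 * D%:R :> R by rewrite mulr_gt0 // ltr0n.
rewrite natr_sum; apply: (@le_trans _ _ (\sum_i (a i).2%:R ^+ 2)).
  apply: ler_sum => i _; rewrite -natrX ler_nat.
  by case: (nat_of_ord _) => // k; rewrite expnS expn1 leq_pmulr.
rewrite -[X in _ <= X]mul1r -ler_pdivrMr //; apply: le_trans h.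
by rewrite mulr_suml; apply: ler_sum => i _; rewrite netptE.
Qed.

(** Rounding the coordinates towards zero does not increase the norm. *)
Lemma net_approx d (u : 'cV[R]_d) : (d <= D)%N -> sqn u <= 1 ->
  exists2 a : netidx d, sqn (netpt a) <= 1 & sqn (u - netpt a) <= (1 / 4) ^+ 2.
Proof.
move=> dD u1.
pose k i := Num.truncn (mesh * `|u i 0|).
have ki i : (k i)%:R <= mesh * `|u i 0| < (k i).+1%:R.
  by apply: truncn_itv; rewrite mulr_ge0 // ltW.
have ui i : `|u i 0| <= 1.
  rewrite -(ler_pXn2r (n := 2)) ?nnegrE // expr1n real_normK ?num_real //.
  apply: le_trans u1; rewrite sqnE (bigD1 i) //= lerDl.
  by apply: sumr_ge0 => j _; exact: sqr_ge0.
have kD i : (k i < (4 * D).+1)%N.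
  rewrite ltnS -(ler_nat R); have /andP[h _] := ki i; apply: (le_trans h).
  apply: (@le_trans _ _ mesh); first by rewrite ler_piMr // ltW.
  rewrite /mesh natrM ler_wpM2l //.
  rewrite -(ler_pXn2r (n := 2)) ?nnegrE // sqr_sqrtr // -natrX ler_nat.
  by rewrite expnS expn1 leq_pmulr.
pose a : netidx d := [ffun i => (u i 0 < 0, Ordinal (kD i))].
have ai i : netpt a i 0 = (-1) ^+ (u i 0 < 0)%R * ((k i)%:R / mesh).
  by rewrite mxE /a ffunE /= mulrA.
have ku i : (k i)%:R / mesh <= `|u i 0|.
  by rewrite ler_pdivrMr // mulrC; have /andP[] := ki i.
have ku' i : `|u i 0| - (k i)%:R / mesh <= mesh^-1.
  have /andP[_ h] := ki i.
  rewrite lerBlDr; apply: (@le_trans _ _ ((k i).+1%:R / mesh)).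
    by rewrite ler_pdivlMr // mulrC ltW.
  by rewrite -natr1 mulrDl mul1r addrC.
have k0 i : 0 <= (k i)%:R / mesh by rewrite divr_ge0 // ltW.
have uE i : u i 0 = (-1) ^+ (u i 0 < 0)%R * `|u i 0|.
  by rewrite -realEsign ?num_real.
exists a.
  apply: le_trans u1; rewrite !sqnE; apply: ler_sum => i _.
  rewrite ai exprMn sqrr_sign mul1r -[u i 0 ^+ 2]real_normK ?num_real //.
  by rewrite ler_pXn2r ?nnegrE.
apply: (@le_trans _ _ (\sum_(i < d) mesh ^- 2)).
  rewrite sqnE; apply: ler_sum => i _.
  have -> : (u - netpt a) i 0 = (-1) ^+ (u i 0 < 0)%R * (`|u i 0| - (k i)%:R / mesh).
    by rewrite mxE [X in _ + X]mxE ai {1}uE mulrBr.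
  rewrite exprMn sqrr_sign mul1r -exprVn ler_pXn2r ?nnegrE ?invr_ge0 ?subr_ge0 //.
  exact: ltW.
rewrite sumr_const card_ord mesh2 -[_ *+ d]mulr_natl.
have Dr : 0 < D%:R :> R by rewrite ltr0n.
rewrite ler_pdivrMr ?mulr_gt0 // expr_div_n expr1n.
have : d%:R <= D%:R :> R by rewrite ler_nat.
by rewrite (_ : 4 ^+ 2 = 16) //; [lra | rewrite -natrX].
Qed.

Lemma opb_exists m n (A : 'M[R]_(m, n)) : exists c, opb c A.
Proof.
pose S := \sum_i \sum_j A i j ^+ 2.
have S0 : 0 <= S by apply: sumr_ge0 => i _; apply: sumr_ge0 => j _; exact: sqr_ge0.
exists (Num.sqrt S); split; first exact: sqrtr_ge0.
move=> x; rewrite sqr_sqrtr // [sqn (A *m x)]sqnE /S mulr_suml; apply: ler_sum => i _.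
have -> : (A *m x) i 0 = dotv (row i A)^T x.
  by rewrite mxE /dotv; apply: eq_bigr => j _; rewrite !mxE.
have -> : \sum_j A i j ^+ 2 = sqn (row i A)^T by rewrite sqnE; apply: eq_bigr => j _; rewrite !mxE.
exact: cauchy_schwarz.
Qed.

Lemma opb_of_form m n (A : 'M[R]_(m, n)) c : 0 <= c ->
  (forall u v, sqn u <= 1 -> sqn v <= 1 -> dotv u (A *m v) <= c) -> opb c A.
Proof.
move=> c0 h; split=> // x.
have q0 := sqn_ge0 x; have p0 := sqn_ge0 (A *m x).
have [/eqP xz|xnz] := boolP (x == 0).
  by rewrite xz mulmx0 /sqn /dotv !big1 ?mulr0 // => i _; rewrite mxE mulr0.
have [/eqP az|anz] := boolP (A *m x == 0).
  by rewrite az [X in X <= _](_ : _ = 0) ?mulr_ge0 ?sqr_ge0 //; apply/eqP; rewrite sqn_eq0.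
have qp : 0 < sqn x by rewrite lt_def sqn_eq0 xnz.
have pp : 0 < sqn (A *m x) by rewrite lt_def sqn_eq0 anz.
have sq : 0 < Num.sqrt (sqn x) by rewrite sqrtr_gt0.
have sp : 0 < Num.sqrt (sqn (A *m x)) by rewrite sqrtr_gt0.
have := h ((Num.sqrt (sqn (A *m x)))^-1 *: (A *m x)) ((Num.sqrt (sqn x))^-1 *: x).
rewrite !sqnZ !exprVn !sqr_sqrtr // !mulVf ?gt_eqF // lexx => /(_ isT isT).
rewrite -scalemxAr dotvZl dotvZr -/(sqn _).
rewrite -[X in _ * (_ * X)](sqr_sqrtr p0).
set p := Num.sqrt (sqn (A *m x)) in sp *; set q := Num.sqrt (sqn x) in sq *.
have -> : p^-1 * (q^-1 * p ^+ 2) = p / q by field; rewrite ?gt_eqF.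
rewrite ler_pdivrMr // => hh.
rewrite -(sqr_sqrtr p0) -[in X in _ <= X](sqr_sqrtr q0) -exprMn.
by rewrite ler_pXn2r ?nnegrE ?mulr_ge0 ?(ltW sp) ?(ltW sq).
Qed.

(** Let [S] denote the supremum of the form over the unit balls. Replacing
    both arguments by grid points at distance at most [1 / 4] changes the form
    by at most [S / 4 + S / 4], so [S <= tau + S / 2]. *)
Lemma net_bound d1 d2 (A : 'M[R]_(d1, d2)) tau : (d1 <= D)%N -> (d2 <= D)%N ->
  (forall (a : netidx d1) (b : netidx d2), sqn (netpt a) <= 1 -> sqn (netpt b) <= 1 ->
     dotv (netpt a) (A *m netpt b) <= tau) ->
  0 <= tau -> opb (2 * tau) A.
Proof.
move=> d1D d2D hnet tau0.
pose S : set R := [set x | exists u v, [/\ sqn u <= 1, sqn v <= 1 & x = dotv u (A *m v)]].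
have [c [c0 hc]] := opb_exists A.
have S0 : S !=set0.
  by exists 0; exists 0, 0; rewrite mulmx0 /sqn /dotv !big1 // => i _; rewrite mxE mulr0.
have Sub : has_ubound S.
  exists (1 * c) => _ [u [v [u1 v1 ->]]].
  apply: le_trans (ler_norm _) _; apply: dotv_le => //; first by rewrite expr1n.
  by apply: le_trans (hc v) _; rewrite -[X in _ <= X]mulr1 ler_wpM2l ?sqr_ge0.
have Sle u v : sqn u <= 1 -> sqn v <= 1 -> dotv u (A *m v) <= sup S.
  by move=> u1 v1; apply: ub_le_sup => //; exists u, v.
have quarter d (x : 'cV[R]_d) : sqn x <= (1 / 4) ^+ 2 -> sqn (4 *: x) <= 1.
  by rewrite sqnZ; lra.
have half : sup S <= tau + sup S / 2.
  apply: ge_sup => // _ [u [v [u1 v1 ->]]].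
  have [a a1 ua] := net_approx d1D u1; have [b b1 vb] := net_approx d2D v1.
  have h1 := Sle _ _ (quarter _ _ ua) v1; rewrite dotvZl in h1.
  have h2 := Sle _ _ a1 (quarter _ _ vb); rewrite -scalemxAr dotvZr in h2.
  have h3 := hnet _ _ a1 b1.
  have -> : dotv u (A *m v) = dotv (netpt a) (A *m netpt b)
      + dotv (u - netpt a) (A *m v) + dotv (netpt a) (A *m (v - netpt b)).
    rewrite mulmxBr -[- (A *m _)]scaleN1r -[- netpt a]scaleN1r dotvDr dotvDl dotvZr dotvZl; ring.
  lra.
apply: opb_of_form; first by rewrite mulr_ge0.
by move=> u v u1 v1; have := Sle u v u1 v1; lra.
Qed.

End net.

Section random_norm.
Context {R : realType}.

Let q : R := expR (- 1).
Let q0 : 0 < q. Proof. exact: expR_gt0. Qed.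

Lemma expR1_ge2 : 2 <= expR 1 :> R.
Proof. by have := expR_ge1Dx (1 : R); rewrite -(natrD R 1 1). Qed.

Let q_half : q <= 2^-1.
Proof. by rewrite /q expRN lef_pV2 ?posrE ?expR_gt0 // expR1_ge2. Qed.

Let qX n : q ^+ n = expR (- n%:R).
Proof. by rewrite /q -expRM_natr mulN1r. Qed.

Lemma geom_le2 K : \sum_(k < K) q ^+ k <= 2.
Proof.
suff : \sum_(k < K) q ^+ k <= 2 - 2 * q ^+ K.
  by move/le_trans; apply; rewrite gerBl mulr_ge0 // exprn_ge0 // ltW.
elim: K => [|K IH]; first by rewrite big_ord0 expr0; lra.
rewrite big_ord_recr /= exprS; have h : q * q ^+ K <= 2^-1 * q ^+ K.
  by rewrite ler_wpM2r // exprn_ge0 // ltW.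
by lra.
Qed.

(** Each coordinate contributes two geometric sums of ratio [expR (- 1)], one
    for each sign. *)
Lemma weight_sum D d : \sum_(a : netidx D d) \prod_i q ^+ (a i).2 <= 4 ^+ d.
Proof.
rewrite -(bigA_distr_bigA (fun (i : 'I_d) (j : bool * 'I_(4 * D).+1) => q ^+ j.2)) /=.
rewrite prodr_const card_ord; apply: lerXn2r; rewrite ?nnegrE //.
  by apply: sumr_ge0 => j _; rewrite exprn_ge0 // ltW.
rewrite -(pair_bigA _ (fun (b : bool) (k : 'I_(4 * D).+1) => q ^+ k)) /= big_bool /=.
by have := geom_le2 (4 * D).+1; lra.
Qed.

Context d (T : measurableType d) (P : probability T R) (d1 d2 : nat).
Variable (Z : 'I_d1 * 'I_d2 -> {RV P >-> R}).
Hypothesis iid : iid_std_normal Z.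
Let D := maxn d1 d2.
Hypothesis D0 : (0 < D)%N.
Let s : R := Num.sqrt D%:R.

Lemma has_mean_expR i t : has_mean P (fun w => expR (t * Z i w)) (expR (t ^+ 2 / 2)).
Proof.
have mf : measurable_fun setT (fun x : R => expR (t * x)).
  by apply: measurableT_comp; [exact: measurable_expR | exact: mulrl_measurable].
apply: ge0_has_mean => //.
- by apply: (measurableT_comp mf).
- rewrite (integral_law iid.2 i (f := fun x => expR (t * x))) //.
  exact: gaussian_mgf.
Qed.

Lemma has_mean_exp_form (x : 'cV[R]_d1) (y : 'cV[R]_d2) (c : R) :
  has_mean P (fun w => expR (c * dotv x (noise Z w *m y)))
    (expR (c ^+ 2 * (sqn x * sqn y) / 2)).
Proof.
pose t (ij : 'I_d1 * 'I_d2) := c * (x ij.1 0 * y ij.2 0).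
have pairE (F : 'I_d1 * 'I_d2 -> R) : \sum_ij F ij = \sum_i \sum_j F (i, j).
  by rewrite pair_bigA; apply: eq_bigr => -[].
apply: has_mean_eq (ge0_has_mean_prod iid.1 (f := fun ij z => expR (t ij * z))
  (m := fun ij => expR (t ij ^+ 2 / 2)) _ _ _).
- move=> w; rewrite -expR_sum; congr expR; rewrite pairE.
  rewrite /dotv mulr_sumr.
  apply: eq_bigr => i _; rewrite mxE !mulr_sumr; apply: eq_bigr => j _.
  by rewrite /t mxE /=; ring.
- rewrite -expR_sum; congr expR; rewrite !sqnE mulr_suml mulr_sumr mulr_suml.
  rewrite pairE.
  apply: eq_bigr => i _; rewrite !mulr_sumr mulr_suml; apply: eq_bigr => j _.
  by rewrite /t /=; ring.
- by move=> i; apply: measurableT_comp; [exact: measurable_expR | exact: mulrl_measurable].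
- by move=> i z; exact: expR_ge0.
- by move=> i; exact: has_mean_expR.
Qed.

Let wt m (a : netidx D m) := \prod_i q ^+ (a i).2.
Let ok m (a : netidx D m) := sqn (netpt a : 'cV[R]_m) <= 1.

(** The exponentials of the form at all grid points of the unit ball, weighted
    so that the weights sum to at most [4 ^+ (d1 + d2)] although the grid is
    much larger. The weight of a pair of points in the unit ball is at least
    [expR (- (32 * D))] by [net_sum_le], and the prefactor compensates for
    this, so each exponential is at most [net_exp]. *)
Definition net_exp (w : T) : R := expR (32 * D%:R) *
  \sum_(a : netidx D d1 | ok a) \sum_(b : netidx D d2 | ok b)
    (wt a * wt b) * expR (s * dotv (netpt a) (noise Z w *m netpt b)).

Let wt_ge0 m (a : netidx D m) : 0 <= wt a.
Proof. by apply: prodr_ge0 => i _; rewrite exprn_ge0 // ltW. Qed.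

Let wt_ge m (a : netidx D m) : ok a -> expR (- (16 * D%:R)) <= wt a.
Proof.
move=> ha; rewrite /wt -expr_sum qX ler_expR lerN2.
exact: net_sum_le.
Qed.

Lemma net_exp_ge w a b : ok a -> ok b ->
  expR (s * dotv (netpt a) (noise Z w *m netpt b)) <= net_exp w.
Proof.
move=> ha hb; set f := expR _; have f0 : 0 <= f by exact: expR_ge0.
have t0 a' b' : 0 <= (wt a' * wt b') * expR (s * dotv (netpt a') (noise Z w *m netpt b')).
  by rewrite mulr_ge0 ?expR_ge0 // mulr_ge0.
apply: (@le_trans _ _ (expR (32 * D%:R) * ((wt a * wt b) * f))).
  rewrite mulrA -[X in X <= _]mul1r ler_wpM2r //.
  have h : expR (- (16 * D%:R)) * expR (- (16 * D%:R)) <= wt a * wt b.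
    by apply: ler_pM; rewrite ?expR_ge0 ?wt_ge.
  apply: (@le_trans _ _ (expR (32 * D%:R) * (expR (- (16 * D%:R)) * expR (- (16 * D%:R))))).
    by rewrite -!expRD -[X in X <= _]expR0 ler_expR; lra.
  by rewrite ler_wpM2l // expR_ge0.
rewrite /net_exp ler_wpM2l ?expR_ge0 // (bigD1 a) //= (bigD1 b) //= -addrA lerDl.
by apply: addr_ge0; [|apply: sumr_ge0 => a' _]; apply: sumr_ge0 => b' _; exact: t0.
Qed.

(** The exponent is the sum of 32 from the prefactor, twice 2 from the
    weights, since [4 <= expR 2], and one half from the Gaussian exponential
    moments at [s ^+ 2 = D]. *)
Lemma net_exp_mean : exists2 e, has_mean P net_exp e & e <= expR (37 * D%:R).
Proof.
pose e := expR (32 * D%:R) * \sum_(a : netidx D d1 | ok a) \sum_(b : netidx D d2 | ok b)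
    (wt a * wt b) * expR (s ^+ 2 * (sqn (netpt a) * sqn (netpt b)) / 2).
exists e.
  apply: has_meanZ; apply: has_mean_sum => a; apply: has_mean_sum => b.
  by apply: has_meanZ; exact: has_mean_exp_form.
have s2 : s ^+ 2 = D%:R by rewrite /s sqr_sqrtr.
have step : \sum_(a : netidx D d1 | ok a) \sum_(b : netidx D d2 | ok b)
    (wt a * wt b) * expR (s ^+ 2 * (sqn (netpt a) * sqn (netpt b)) / 2)
    <= (4 ^+ d1 * 4 ^+ d2) * expR (D%:R / 2).
  apply: (@le_trans _ _ ((\sum_(a : netidx D d1) wt a) * (\sum_(b : netidx D d2) wt b) * expR (D%:R / 2))).
    rewrite !mulr_suml.
    apply: (@le_trans _ _ (\sum_(a : netidx D d1 | ok a) wt a * (\sum_(b : netidx D d2) wt b) * expR (D%:R / 2))).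
      apply: ler_sum => a ha; rewrite mulr_sumr mulr_suml.
      apply: (@le_trans _ _ (\sum_(b : netidx D d2 | ok b) wt a * wt b * expR (D%:R / 2))).
        apply: ler_sum => b hb; rewrite ler_wpM2l ?mulr_ge0 // ler_expR s2.
        rewrite ler_wpM2r // -[X in _ <= X]mulr1 ler_wpM2l //.
        by apply: mulr_ile1 => //; exact: sqn_ge0.
      rewrite [X in _ <= X](bigID (@ok d2)) /= lerDl; apply: sumr_ge0 => b _.
      by rewrite mulr_ge0 ?expR_ge0 // mulr_ge0.
    rewrite [X in _ <= X](bigID (@ok d1)) /= lerDl; apply: sumr_ge0 => a _.
    by rewrite mulr_ge0 ?expR_ge0 // mulr_ge0 // sumr_ge0.
  rewrite ler_wpM2r ?expR_ge0 //; apply: ler_pM; rewrite ?sumr_ge0 //; exact: weight_sum.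
apply: (@le_trans _ _ (expR (32 * D%:R) * (4 ^+ d1 * 4 ^+ d2 * expR (D%:R / 2)))).
  by rewrite ler_wpM2l // expR_ge0.
have four k : (k <= D)%N -> 4 ^+ k <= expR (2 * D%:R) :> R.
  move=> kD; apply: (@le_trans _ _ (expR 2 ^+ k)).
    apply: lerXn2r; rewrite ?nnegrE ?expR_ge0 //.
    have -> : 2 = 1 + 1 :> R by rewrite -(natrD R 1 1).
    rewrite expRD; have := expR1_ge2; nra.
  rewrite -expRM_natr ler_expR ler_wpM2l //.
  by rewrite ler_nat.
have h1 := four d1 (leq_maxl _ _); have h2 := four d2 (leq_maxr _ _).
apply: (@le_trans _ _ (expR (32 * D%:R) * (expR (2 * D%:R) * expR (2 * D%:R) * expR (D%:R / 2)))).
  rewrite ler_wpM2l ?expR_ge0 // ler_wpM2r ?expR_ge0 //.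
  by apply: ler_pM; rewrite ?exprn_ge0.
rewrite -!expRD ler_expR.
have : 0 <= D%:R :> R by [].
lra.
Qed.

Lemma net_exp_ge1 w : 1 <= net_exp w.
Proof.
pose z m : netidx D m := [ffun => (false, ord0)].
have z0 m : netpt (z m) = 0 :> 'cV[R]_m.
  by apply/colP => i; rewrite !mxE ffunE /= mulr0 mul0r.
have okz m : ok (z m) by rewrite /ok z0 /sqn /dotv big1 // => i _; rewrite mxE mulr0.
have := net_exp_ge w (okz d1) (okz d2); rewrite !z0 mulmx0.
by rewrite /dotv big1 ?mulr0 ?expR0 // => i _; rewrite mxE mul0r.
Qed.

(** The logarithm of [net_exp] bounds [s] times the form at the grid points,
    and [net_bound] doubles the bound. Its moments are controlled by the mean
    of [net_exp]. *)
Definition norm_bound (w : T) : R := 2 * (ln (net_exp w) / s).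

Let s0 : 0 < s. Proof. by rewrite /s sqrtr_gt0 ltr0n. Qed.

Lemma norm_boundP w : opb (norm_bound w) (noise Z w).
Proof.
have S1 := net_exp_ge1 w; have S0 : 0 < net_exp w by apply: lt_le_trans S1.
apply: (net_bound D0).
- exact: leq_maxl.
- exact: leq_maxr.
- move=> a b ha hb; rewrite ler_pdivlMr // mulrC -ler_expR lnK ?posrE //.
  exact: net_exp_ge.
- by rewrite divr_ge0 ?ln_ge0 // ltW.
Qed.

(** With [u = ln (net_exp w) / D] the left-hand side is [64 D^3 u^6], and
    [u^6 <= 720 expR u]. If [u > 37], then [u - 37 <= (u - 37) D], so
    [expR (u - 37)] is at most [net_exp w * expR (- (37 * D))], whose mean is
    at most 1. *)
Lemma norm_bound6 w : norm_bound w ^+ 6 <=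
  64 * (720 * expR 37) * D%:R ^+ 3 * (1 + net_exp w * expR (- (37 * D%:R))).
Proof.
have S1 := net_exp_ge1 w; have S0 : 0 < net_exp w by apply: lt_le_trans S1.
have DR : 1 <= D%:R :> R by rewrite ler1n.
have DR0 : 0 < D%:R :> R by apply: lt_le_trans DR.
pose u := ln (net_exp w) / D%:R.
have u0 : 0 <= u by rewrite /u divr_ge0 // ln_ge0.
have lnE : ln (net_exp w) = u * D%:R by rewrite /u divfK // gt_eqF.
have nbE : norm_bound w ^+ 6 = 64 * D%:R ^+ 3 * u ^+ 6.
  have s2 : s ^+ 2 = D%:R by rewrite /s sqr_sqrtr.
  have -> : norm_bound w = 2 * (u * s).
    by rewrite /norm_bound lnE -s2; field; rewrite gt_eqF.
  by rewrite -s2; ring.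
have u6 : u ^+ 6 <= 720 * expR u.
  have f0 : 0 < 6`!%:R :> R by rewrite ltr0n fact_gt0.
  have := expR_ge1Dxn 5 u0; rewrite -(_ : 6`!%:R = 720 :> R) // => h.
  rewrite -ler_pdivrMl // mulrC; apply: le_trans h.
  by rewrite lerDr.
have eu : expR u <= expR 37 * (1 + net_exp w * expR (- (37 * D%:R))).
  have SE : net_exp w * expR (- (37 * D%:R)) = expR ((u - 37) * D%:R).
    by rewrite -{1}(lnK S0) lnE -expRD; congr expR; ring.
  rewrite SE; have [u37|u37] := leP u 37.
    apply: (@le_trans _ _ (expR 37 * 1)); first by rewrite mulr1 ler_expR.
    by rewrite ler_wpM2l ?expR_ge0 // lerDl expR_ge0.
  apply: (@le_trans _ _ (expR 37 * expR ((u - 37) * D%:R))); last first.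
    by rewrite ler_wpM2l ?expR_ge0 // lerDr.
  rewrite -expRD ler_expR.
  have : (u - 37) * 1 <= (u - 37) * D%:R by rewrite ler_wpM2l // subr_ge0 ltW.
  lra.
have k0 : 0 <= 720 :> R by rewrite ler0n.
have m0 : 0 <= 64 :> R by rewrite ler0n.
rewrite nbE; move: (1 + _) eu u6 k0 m0 => y.
move: (720 : R) (64 : R) (expR 37) => k m c eu u6 k0 m0.
have -> : m * (k * c) * D%:R ^+ 3 * y = m * D%:R ^+ 3 * (k * (c * y)) by ring.
rewrite ler_wpM2l ?mulr_ge0 ?exprn_ge0 //; apply: (le_trans u6).
by rewrite ler_wpM2l.
Qed.

Definition norm_const : R := 128 * (720 * expR 37).

Lemma norm_const_gt0 : 0 < norm_const.
Proof. by apply: mulr_gt0; [|apply: mulr_gt0; [|exact: expR_gt0]]; rewrite ltr0n. Qed.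

Lemma norm_bound_mean : exists (Bd : T -> R) b,
  [/\ forall w, norm_bound w ^+ 6 <= Bd w, has_mean P Bd b & b <= norm_const * D%:R ^+ 3].
Proof.
have [e he hle] := net_exp_mean.
pose c : R := 64 * (720 * expR 37) * D%:R ^+ 3.
exists (fun w => c * (1 + expR (- (37 * D%:R)) * net_exp w)).
exists (c * (1 + expR (- (37 * D%:R)) * e)); split.
- by move=> w; apply: le_trans (norm_bound6 w) _; rewrite /c [net_exp w * _]mulrC.
- by apply: has_meanZ; apply: has_meanD; [exact: has_mean_cst | exact: has_meanZ].
- have -> : norm_const * D%:R ^+ 3 = c * (1 + 1) by rewrite /norm_const /c; move: (720 * _) => k; ring.
  have c0 : 0 <= c.
    apply: mulr_ge0; last exact: exprn_ge0.
    by apply: mulr_ge0; [|apply: mulr_ge0; [|exact: expR_ge0]]; rewrite ler0n.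
  rewrite ler_wpM2l // lerD2l -[X in _ <= X](expRxMexpNx_1 (37 * D%:R)) mulrC.
  by rewrite ler_wpM2r ?expR_ge0.
Qed.

End random_norm.

(** * Means of the terms of the expansion *)

Section noise_means.
Context {R : realType} {d1 d2 r : nat}.
Variables (U : 'M[R]_(d1, r)) (lam : 'rV[R]_r) (V : 'M[R]_(d2, r)).
Hypothesis svd : compact_svd U lam V.
Context d (T : measurableType d) (P : probability T R).
Variable (Z : 'I_d1 * 'I_d2 -> {RV P >-> R}).
Hypothesis iid : iid_std_normal Z.
Local Notation n := (d1 + d2)%N.
Local Notation FP := (frakP U lam V).
Local Notation X w := (symmetrize (noise Z w)).
Let dstar : R := d1%:R + d2%:R - 2 * r%:R.
Let Delta : R := d1%:R - d2%:R.
Let L2 : R := \sum_i lam 0 i ^- 2.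
Let L4 : R := \sum_i lam 0 i ^- 4.

Lemma gmx_symdelta w : gmx Z symdelta w = X w.
Proof.
apply/matrixP => i j; rewrite /gmx summxE /symdelta /symmetrize.
have pairE (F : 'I_d1 * 'I_d2 -> R) : \sum_ij F ij = \sum_k \sum_l F (k, l).
  by rewrite pair_bigA; apply: eq_bigr => -[].
have pick (p q : nat) (F : 'I_p -> 'I_q -> R) k l :
    \sum_k' \sum_l' F k' l' * ((k == k') && (l == l'))%:R = F k l.
  rewrite (bigD1 k) //= (bigD1 l) //= !eqxx mulr1 big1 ?addr0 => [|l' /negbTE ll'].
    rewrite big1 ?addr0 // => k' /negbTE kk'.
    by apply: big1 => l' _; rewrite eq_sym kk' mulr0.
  by rewrite eq_sym ll' mulr0.
rewrite -(fintype.splitK i) -(fintype.splitK j).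
case: (fintype.split i) => i'; case: (fintype.split j) => j' /=.
- rewrite block_mxEul mxE; apply: big1 => a _; by rewrite mxE block_mxEul mxE mulr0.
- rewrite block_mxEur mxE -[RHS](pick _ _ (fun k l => Z (k, l) w)) pairE.
  by do 2![apply: eq_bigr => ? _]; rewrite mxE block_mxEur mxE.
- rewrite block_mxEdl !mxE -[RHS](pick _ _ (fun k l => Z (k, l) w)) pairE.
  by do 2![apply: eq_bigr => ? _]; rewrite mxE block_mxEdl !mxE.
- rewrite block_mxEdr mxE; apply: big1 => a _; by rewrite mxE block_mxEdr mxE mulr0.
Qed.

Lemma chain_mean A B C D :
  has_mean P (fun w => chain (X w) A B C D) (wick4 symdelta A B C D).
Proof.
apply: has_mean_eq (has_mean_tr4 iid.1 iid.2 symdelta A B C D) => // w.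
by rewrite gmx_symdelta.
Qed.

Let trP2 : \tr (FP 2) = 2 * L2.
Proof. by rewrite (tr_frakP svd) sqrrN expr1n -(natrD R 1 1). Qed.
Let trP4 : \tr (FP 4) = 2 * L4.
Proof. by rewrite (tr_frakP svd) -signr_odd expr0 -(natrD R 1 1). Qed.

(** Wick's formula for each word, with the values collected in
    [wick_fourth]. *)
Lemma fourth_mean :
  has_mean P (fun w => fourth (FP 0) (FP 1) (FP 2) (FP 3) (FP 4) (X w))
    (L4 * (dstar - Delta ^+ 2)).
Proof.
have PS k : FP k.+2 = FP k.+1 *m FP 1 by rewrite frakPD ?addn0.
have -> : L4 * (dstar - Delta ^+ 2) = 2 * L4 / 2 * (dstar - Delta ^+ 2) by field.
rewrite -(@wick_fourth _ _ _ symdelta flip (FP 0) (FP 1) dstar Delta (2 * L2) (2 * L4)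
  symdelta_covE _ _ _ _ _ _ _ _ _ _ _ _ _ (FP 2) (FP 3) (FP 4))
  ?frakP_T ?flipT ?flipK ?(frakWW svd) ?(frakPW svd) ?(frakWP svd)
  ?flip_W ?flip_P1 ?(tr_flip_frakP svd) ?(tr_flip_W svd) ?(tr_W svd) //.
- rewrite /fourth; do ![apply: has_meanD]; do ?[apply: has_meanN];
  do ?[apply: has_meanZ]; exact: chain_mean.
- by rewrite (tr_frakP svd) expr1 subrr mul0r.
- by rewrite -flip_P1 (tr_flip_frakP svd).
- by rewrite -flip_W (tr_flip_W svd).
- exact: symdeltaT.
Qed.

Lemma SA4_mean : has_mean P
  (fun w => mxdot (Theta U V *m (Theta U V)^T) (SA U lam V 4 (X w)))
  (L4 * (Delta ^+ 2 - dstar)).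
Proof.
apply: has_mean_eq (has_meanN fourth_mean) => [w|]; last by ring.
by rewrite tr_SA4 // symmetrizeT.
Qed.

(** By cyclicity the trace is that of [P^2 X W X], and [mxcov W] is
    [(dstar - Delta J) / 2]. *)
Lemma pG2_mean : has_mean P (fun w => \tr (pG2 (FP 0) (FP 1) (X w))) (dstar * L2).
Proof.
apply: has_mean_eq (has_mean_tr2 iid.1 iid.2 symdelta (FP 2) (FP 0)) => [w|].
  rewrite gmx_symdelta /pG2 /pE1 !trmx_mul !frakP_T symmetrizeT !mulmxA.
  rewrite -(mulmxA _ (FP 0) (FP 0)) (frakWW svd) [RHS]mxtrace_mulC !mulmxA.
  by rewrite frakPD.
rewrite (covW symdelta_covE (frakP_T _ _ _ _) flipK (flip_W _ _ _) (tr_W svd) (tr_flip_W svd)).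
rewrite mulmxBr mul_mx_scalar -scalemxAr raddfB /= !mxtraceZ trP2.
rewrite [\tr (_ *m flip)]mxtrace_mulC (tr_flip_frakP svd) mulr0 subr0 /dstar; by field.
Qed.

Let hX : hommx Z 1 (fun w => X w).
Proof.
have := hommx_gmx Z symdelta; by rewrite (_ : gmx Z symdelta = fun w => X w) //; apply/funext => w; exact: gmx_symdelta.
Qed.

(** Degrees are propagated with a separate equation for the sum, because the
    degree of a product is seldom literally of the form expected by the next
    step. *)
Let degM m p q k l kl (F : T -> 'M[R]_(m, p)) (G : T -> 'M[R]_(p, q)) : (k + l = kl)%N ->
  hommx Z k F -> hommx Z l G -> hommx Z kl (fun w => F w *m G w).
Proof. by move=> <-; exact: hommxM. Qed.

Let degWXYP k (F : T -> 'M[R]_n) : hommx Z k F ->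
  hommx Z k.+1 (fun w => FP 0 *m X w *m F w *m FP 1).
Proof.
move=> hF; apply: (degM (addn0 _) _ (hommx_cst _ _)).
apply: (degM (add1n _) _ hF).
exact: (degM (add0n _) (hommx_cst _ _) hX).
Qed.

Let degYXP k (F : T -> 'M[R]_n) : hommx Z k F -> hommx Z k.+1 (fun w => F w *m X w *m FP 1).
Proof.
move=> hF; apply: (degM (addn0 _) _ (hommx_cst _ _)).
exact: (degM (addn1 _) hF hX).
Qed.

Let degStep k (Y g h : T -> 'M[R]_n) : hommx Z k Y -> hommx Z k g -> hommx Z k h ->
  hommx Z k.+1 (fun w => pstep (FP 0) (FP 1) (X w) (Y w) (g w) (h w)).
Proof.
move=> hY hg hh; do ![apply: hommxB]; do ?[exact: degWXYP]; exact: degYXP.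
Qed.

Let degG k l kl (F G : T -> 'M[R]_n) : (k + l = kl)%N -> hommx Z k F -> hommx Z l G ->
  hommx Z kl (fun w => (F w)^T *m G w).
Proof. by move=> kE hF hG; apply: (degM kE _ hG); exact: hommxT. Qed.

Let degH k l kl (F G : T -> 'M[R]_n) : (k + l = kl)%N -> hommx Z k F -> hommx Z l G ->
  hommx Z kl (fun w => F w *m (G w)^T).
Proof. by move=> kE hF hG; apply: (degM kE hF); exact: hommxT. Qed.

Let degE1 : hommx Z 1 (fun w => pE1 (FP 0) (FP 1) (X w)).
Proof. by apply: degYXP; exact: hommx_cst. Qed.
Let degE2 : hommx Z 2 (fun w => pE2 (FP 0) (FP 1) (X w)).
Proof. by apply: hommxB; [exact: degWXYP | exact: degYXP]. Qed.
Let degG2 : hommx Z 2 (fun w => pG2 (FP 0) (FP 1) (X w)).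
Proof. exact: (degG (erefl _) degE1 degE1). Qed.
Let degH2 : hommx Z 2 (fun w => pH2 (FP 0) (FP 1) (X w)).
Proof. exact: (degH (erefl _) degE1 degE1). Qed.
Let degE3 : hommx Z 3 (fun w => pE3 (FP 0) (FP 1) (X w)).
Proof. exact: degStep. Qed.
Let degG3 : hommx Z 3 (fun w => pG3 (FP 0) (FP 1) (X w)).
Proof. by apply: hommxD; [exact: (degG (erefl _) degE1) | exact: (degG (erefl _) degE2)]. Qed.
Let degH3 : hommx Z 3 (fun w => pH3 (FP 0) (FP 1) (X w)).
Proof. by apply: hommxD; [exact: (degH (erefl _) degE1) | exact: (degH (erefl _) degE2)]. Qed.
Let degE4 : hommx Z 4 (fun w => pE4 (FP 0) (FP 1) (X w)).
Proof. exact: degStep. Qed.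
Let degG5 : hommx Z 5 (fun w => pG5 (FP 0) (FP 1) (X w)).
Proof.
do ![apply: hommxD].
- exact: (degG (erefl _) degE1 degE4).
- exact: (degG (erefl _) degE2 degE3).
- exact: (degG (erefl _) degE3 degE2).
- exact: (degG (erefl _) degE4 degE1).
- exact: (degM (erefl _) degG2 degG3).
- exact: (degM (erefl _) degG3 degG2).
Qed.

Lemma pG_mean : has_mean P (fun w => \tr (pG (FP 0) (FP 1) (X w)))
  (dstar * L2 - L4 * (Delta ^+ 2 - dstar)).
Proof.
have h3 := hompoly_odd iid.1 iid.2 (erefl : odd 3) (hompoly_tr degG3).
have h5 := hompoly_odd iid.1 iid.2 (erefl : odd 5) (hompoly_tr degG5).
apply: has_mean_eq (has_meanD (has_meanD (has_meanD pG2_mean h3) fourth_mean) h5).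
  move=> w; rewrite /pG (mxtraceD (pG2 _ _ _ + pG3 _ _ _ + pG4 _ _ _)) (mxtraceD (pG2 _ _ _ + pG3 _ _ _)) (mxtraceD (pG2 _ _ _)); congr (_ + _ + _ + _).
  rewrite (@tr_pG4 _ _ _ _ (FP 2) (FP 3) (FP 4)) ?frakP_T ?symmetrizeT ?(frakWW svd) //.
  - by rewrite frakPD.
  - by rewrite frakPD.
  - by rewrite frakPD.
by ring.
Qed.

End noise_means.

(** * Error bounds *)

(** The domination gives the integrability of [h] and, integrated, the
    distance between the means. *)
Lemma has_mean_approx d (T : measurableType d) (R : realType) (P : probability T R)
    (f g h : T -> R) (a b : R) : measurable_fun setT h ->
  (forall w, `|h w - f w| <= g w) -> has_mean P f a -> has_mean P g b ->
  exists2 e, has_mean P h e & `|e - a| <= b.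
Proof.
move=> mh hfg hf hg.
have ih : P.-integrable setT (fun w => (h w)%:E).
  have := integrableD measurableT (integrable_abse hf.1) hg.1.
  apply: le_integrable => //; first exact/measurable_EFinP.
  move=> w _ /=; rewrite lee_fin.
  have g0 : 0 <= g w by apply: le_trans (hfg w).
  rewrite [X in _ <= X]ger0_norm ?addr_ge0 //.
  by rewrite -lerBlDl; apply: le_trans (hfg w); exact: lerB_dist.
exists (fine 'E_P[h]); first exact: has_mean_exists.
have hh := has_mean_exists ih.
rewrite ler_distl; apply/andP; split.
- apply: has_mean_le (has_meanB hf hg) hh => w.
  by have := hfg w; rewrite ler_distl => /andP[].
- apply: has_mean_le hh (has_meanD hf hg) => w.
  by have := hfg w; rewrite ler_distl => /andP[].
Qed.

Section bounds.
Context {R : realType} {d1 d2 r : nat}.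
Variables (U : 'M[R]_(d1, r)) (lam : 'rV[R]_r) (V : 'M[R]_(d2, r)) (r_gt0 : (0 < r)%N).
Hypothesis svd : compact_svd U lam V.
Context d (T : measurableType d) (P : probability T R).
Variable (Z : 'I_d1 * 'I_d2 -> {RV P >-> R}).
Hypothesis iid : iid_std_normal Z.
Let dmax : R := (maxn d1 d2)%:R.
Let lamr : R := lam 0 (last_ord r_gt0).
Let Delta : R := d1%:R - d2%:R.
Let dstar : R := d1%:R + d2%:R - 2 * r%:R.
Let L2 : R := \sum_i lam 0 i ^- 2.
Let L4 : R := \sum_i lam 0 i ^- 4.

Let r_le1 : (r <= d1)%N. Proof. by case: svd => /mulmx1_min. Qed.
Let r_le2 : (r <= d2)%N. Proof. by case: svd => _ /mulmx1_min. Qed.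

(** [dstar] is between 0 and [2 * dmax], because orthonormal columns force
    [r <= d1] and [r <= d2]. *)
Lemma bias_le : `|L4 * dstar| <= 2 * (r%:R ^+ 2 * dmax / lamr ^+ 4).
Proof.
have r1 : 1 <= r%:R :> R by rewrite ler1n.
have h1 : r%:R <= d1%:R :> R by rewrite ler_nat.
have h2 : r%:R <= d2%:R :> R by rewrite ler_nat.
have h3 : d1%:R <= dmax by rewrite ler_nat leq_maxl.
have h4 : d2%:R <= dmax by rewrite ler_nat leq_maxr.
have s0 : 0 <= dstar by rewrite /dstar; lra.
have s2 : dstar <= 2 * dmax by rewrite /dstar; lra.
have L40 : 0 <= L4.
  apply: sumr_ge0 => i _; rewrite invr_ge0 exprn_ge0 // ltW //.
  by case: svd => _ _ _; apply.
have l0 : 0 < lamr by exact: (lamr_gt0 r_gt0 svd).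
rewrite ger0_norm ?mulr_ge0 //.
apply: (@le_trans _ _ (r%:R / lamr ^+ 4 * (2 * dmax))).
  by apply: ler_pM => //; exact: (frob_inv2_le r_gt0 svd).
have -> : 2 * (r%:R ^+ 2 * dmax / lamr ^+ 4) = r%:R / lamr ^+ 4 * (2 * dmax) * r%:R.
  by field; rewrite gt_eqF.
rewrite ler_peMr //; apply: mulr_ge0; last by apply: mulr_ge0 => //; exact: ler0n.
by apply: mulr_ge0; [exact: ler0n | rewrite invr_ge0 exprn_ge0 // ltW].
Qed.

Lemma SA4_bound : (`| 'E_P[fun w => mxdot (Theta U V *m (Theta U V)^T)
                              (SA U lam V 4 (symmetrize (noise Z w)))]
          - (Delta ^+ 2 * frobenius (invmx (diag_mx lam) *m invmx (diag_mx lam)) ^+ 2)%:E |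
       <= (2 * (r%:R ^+ 2 * dmax / lamr ^+ 4))%:E)%E.
Proof.
rewrite (has_mean_expectation (SA4_mean svd iid)) -EFinB abse_EFin lee_fin.
rewrite (frob_inv2 svd).
apply: le_trans bias_le; rewrite -normrN le_eqVlt; apply/orP; left; apply/eqP; congr `|_|.
by rewrite /Delta /L4 /dstar; ring.
Qed.

Definition remainder_const : R := 4 * (240 * 100) + 12 * 8 ^+ 6.

Lemma remainder_const_gt0 : 0 < remainder_const.
Proof.
apply: ltr_pwDl; first by rewrite !mulr_gt0 // ltr0n.
by apply: mulr_ge0; [exact: ler0n | apply: exprn_ge0; exact: ler0n].
Qed.

Variables (Uh : T -> 'M[R]_(d1, r)) (Vh : T -> 'M[R]_(d2, r)).
Hypothesis htop : forall w,
  top_singular_vectors (U *m diag_mx lam *m V^T + noise Z w) (Uh w) (Vh w).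
Hypothesis mdist : measurable_fun [set: T]%classic (fun w => dist2 (Uh w) (Vh w) U V).

(** The remainder of the expansion is integrated with the random norm bound,
    and the difference between the mean of [2 tr pG] and the claimed value is
    [2 * (L4 * dstar)]. *)
Lemma dist2_bound : (`| 'E_P[fun w => dist2 (Uh w) (Vh w) U V]
          - (2 * (dstar * frobenius (invmx (diag_mx lam)) ^+ 2
                  - Delta ^+ 2
                    * frobenius (invmx (diag_mx lam) *m invmx (diag_mx lam)) ^+ 2))%:E |
       <= (4 * (r%:R ^+ 2 * dmax / lamr ^+ 4)
           + (remainder_const * norm_const) * r%:R * (dmax / lamr ^+ 2) ^+ 3)%:E)%E.
Proof.
have D0 : (0 < maxn d1 d2)%N by apply: leq_trans (leq_trans r_gt0 r_le1) (leq_maxl _ _).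
have l0 : 0 < lamr by exact: (lamr_gt0 r_gt0 svd).
have [Bd [b [hBd mBd hb]]] := norm_bound_mean iid D0.
pose k : R := remainder_const * r%:R / lamr ^+ 6.
have rr0 : 0 <= remainder_const * r%:R by rewrite mulr_ge0 // ltW // remainder_const_gt0.
have k0 : 0 <= k by apply: mulr_ge0 => //; rewrite invr_ge0 exprn_ge0 // ltW.
have approx w : `|dist2 (Uh w) (Vh w) U V
    - 2 * \tr (pG (frakP U lam V 0) (frakP U lam V 1) (symmetrize (noise Z w)))| <= k * Bd w.
  have h := dist2_expansion r_gt0 svd (norm_boundP Z D0 w) (htop w).
  apply: (le_trans h); rewrite -/remainder_const expr_div_n mulrA mulrAC.
  by rewrite ler_wpM2l.
have [e he hle] := has_mean_approx mdist approx (has_meanZ 2 (pG_mean svd iid))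
  (has_meanZ k mBd).
rewrite (has_mean_expectation he) -EFinB abse_EFin lee_fin.
rewrite (frob_inv svd) (frob_inv2 svd).
move: hle; rewrite -/dstar -/Delta -/L2 -/L4 => hle.
have -> : e - 2 * (dstar * L2 - Delta ^+ 2 * L4)
  = 2 * (L4 * dstar) + (e - 2 * (dstar * L2 - L4 * (Delta ^+ 2 - dstar))) by ring.
apply: le_trans (ler_normD _ _) _; apply: lerD.
  rewrite normrM ger0_norm // (_ : 4 = 2 * 2 :> R); last by rewrite -natrM.
  by rewrite -mulrA ler_wpM2l // bias_le.
apply: le_trans hle _; apply: (@le_trans _ _ (k * (norm_const * dmax ^+ 3))).
  by rewrite ler_wpM2l.
rewrite le_eqVlt; apply/orP; left; apply/eqP; rewrite /k.
by move: remainder_const norm_const => c c'; field; rewrite gt_eqF.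
Qed.

End bounds.

Theorem lemma2 (R : realType) :
  (exists2 C2 : R, 0 < C2 &
    forall (d1 d2 r : nat) (r_gt0 : (0 < r)%N)
           (U : 'M[R]_(d1, r)) (lam : 'rV[R]_r) (V : 'M[R]_(d2, r))
           (d : measure_display) (T : measurableType d) (P : probability T R)
           (Z : 'I_d1 * 'I_d2 -> {RV P >-> R}),
      let dmax : R := (maxn d1 d2)%:R in
      let lamr : R := lam 0 (last_ord r_gt0) in
      let Delta : R := d1%:R - d2%:R in
      let Lambda : 'M[R]_r := diag_mx lam in
      let X (w : T) : 'M[R]_(d1 + d2) := symmetrize (noise Z w) in
      compact_svd U lam V ->
      iid_std_normal Z ->
      (`| 'E_P[fun w => mxdot (Theta U V *m (Theta U V)^T)
                              (SA U lam V 4 (X w))]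
          - (Delta ^+ 2 * frobenius (invmx Lambda *m invmx Lambda) ^+ 2)%:E |
       <= (C2 * (r%:R ^+ 2 * dmax / lamr ^+ 4))%:E)%E)
  /\
  (exists2 C0 : R, 0 < C0 & forall C1 : R, C0 <= C1 ->
    exists C2 C3 : R, [/\ 0 < C2, 0 < C3 &
    forall (d1 d2 r : nat) (r_gt0 : (0 < r)%N)
           (U : 'M[R]_(d1, r)) (lam : 'rV[R]_r) (V : 'M[R]_(d2, r))
           (d : measure_display) (T : measurableType d) (P : probability T R)
           (Z : 'I_d1 * 'I_d2 -> {RV P >-> R})
           (Uh : T -> 'M[R]_(d1, r)) (Vh : T -> 'M[R]_(d2, r)),
      let dmax : R := (maxn d1 d2)%:R in
      let lamr : R := lam 0 (last_ord r_gt0) in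
      let Delta : R := d1%:R - d2%:R in
      let dstar : R := d1%:R + d2%:R - 2 * r%:R in
      let Lambda : 'M[R]_r := diag_mx lam in
      let M : 'M[R]_(d1, d2) := U *m Lambda *m V^T in
      compact_svd U lam V ->
      iid_std_normal Z ->
      (forall w : T, top_singular_vectors (M + noise Z w) (Uh w) (Vh w)) ->
      measurable_fun [set: T]%classic (fun w => dist2 (Uh w) (Vh w) U V) ->
      C1 * Num.sqrt dmax <= lamr ->
      (`| 'E_P[fun w => dist2 (Uh w) (Vh w) U V]
          - (2 * (dstar * frobenius (invmx Lambda) ^+ 2
                  - Delta ^+ 2
                    * frobenius (invmx Lambda *m invmx Lambda) ^+ 2))%:E |
       <= (C2 * (r%:R ^+ 2 * dmax / lamr ^+ 4)
           + C3 * r%:R * (dmax / lamr ^+ 2) ^+ 3)%:E)%E]).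
Proof.
split.
  exists 2 => // d1 d2 r r_gt0 U lam V d T P Z /= svd iid.
  exact: SA4_bound.
exists 1 => // C1 _; exists 4, (remainder_const * norm_const); split=> //.
  by apply: mulr_gt0; [exact: remainder_const_gt0 | exact: norm_const_gt0].
move=> d1 d2 r r_gt0 U lam V d T P Z Uh Vh /= svd iid htop mdist _.
exact: (dist2_bound r_gt0 svd iid htop mdist).
Qed.
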